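(* Let $n\ge1$. The trivial DG polynomial algebra $\mathcal{A}(0,0,\cdots,0)$, i.e. $\Bbbk[x_1,\cdots,x_n]$ with $|x_i|=1$ and zero differential, is a Koszul, homologically smooth and Gorenstein DG algebra. Moreover, it is $0$-Calabi-Yau if and only if $n$ is an odd integer.
   Context: $\Bbbk$ is an algebraically closed field of characteristic $0$. A cochain DG algebra is a graded $\Bbbk$-algebra $\mathcal{A}$ with a $\Bbbk$-linear differential $\partial_{\mathcal{A}}$ of degree $1$, $\partial_{\mathcal{A}}^2=0$, satisfying $\partial_{\mathcal{A}}(ab)=(\partial_{\mathcal{A}}a)b+(-1)^{|a|}a(\partial_{\mathcal{A}}b)$; it is connected if $\mathcal{A}^0=\Bbbk$ and $\mathcal{A}^i=0$ for $i<0$, and then $\Bbbk$ is a DG $\mathcal{A}$-module via the augmentation $\mathcal{A}\to\mathcal{A}/\mathfrak{m}_{\mathcal{A}}=\Bbbk$, where $\mathfrak{m}_{\mathcal{A}}=\bigoplus_{i\ge1}\mathcal{A}^i$. The polynomial algebra $\Bbbk[x_1,\dots,x_n]$ is the ordinary commutative one ($x_ix_j=x_jx_i$ with no sign), graded by $|x_i|=1$. The opposite DG algebra $\mathcal{A}^{op}$ has multiplication $a\cdot b=(-1)^{|a||b|}ba$; the enveloping DG algebra is $\mathcal{A}^e=\mathcal{A}\otimes\mathcal{A}^{op}$; $\mathrm{D}((\mathcal{A}^e)^{op})$ is the derived category of right DG $\mathcal{A}^e$-modules. A DG module is compact if $\mathrm{Hom}$ in the derived category out of it preserves all coproducts. A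 semi-free resolution is a quasi-isomorphism from a semi-free DG module $F$ (one having a semi-basis); it is minimal if $\partial_F(F)\subseteq\mathfrak{m}_{\mathcal{A}}F$. The $j$-th suspension of a graded space $W$ is $(\Sigma^jW)^i=W^{i+j}$. $\mathcal{A}$ is: Gorenstein if $\dim_{\Bbbk}H(R\mathrm{Hom}_{\mathcal{A}}(\Bbbk,\mathcal{A}))=1$; Koszul if ${}_{\mathcal{A}}\Bbbk$ (equivalently ${}_{\mathcal{A}^e}\mathcal{A}$) has a minimal semi-free resolution with a semi-basis concentrated in degree $0$; homologically smooth if ${}_{\mathcal{A}}\Bbbk$ (equivalently the DG $\mathcal{A}^e$-module $\mathcal{A}$) is compact; $d$-Calabi-Yau ($d\in\mathbb{Z}$) if it is homologically smooth and $R\mathrm{Hom}_{\mathcal{A}^e}(\mathcal{A},\mathcal{A}^e)\cong\Sigma^{-d}\mathcal{A}$ in $\mathrm{D}((\mathcal{A}^e)^{op})$. *)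

(* Defs.v *)
From HB Require Import structures.
From mathcomp Require Import all_boot all_order all_algebra.
From mathcomp Require Import boolp functions.
From mathcomp Require Import mpoly.

Set Implicit Arguments.
Unset Strict Implicit.
Unset Printing Implicit Defensive.

Import Order.TTheory GRing.Theory Num.Theory.
Local Open Scope ring_scope.
Local Open Scope quotient_scope.

Definition par (i : int) : bool := odd `|i|%N.

(* [(-1)^i x] *)
Definition ksign (V : zmodType) (i : int) (x : V) : V :=
  if par i then - x else x.

Lemma parD i j : par (i + j) = par i (+) par j.
Proof.
rewrite /par; case: i => i; case: j => j.
- by rewrite -PoszD !absz_nat oddD.
- rewrite NegzE; case: (leqP j.+1 i) => h.
    by rewrite subzn // absz_nat oddB // abszN absz_nat.
  have -> : (Posz i - Posz j.+1) = - (Posz (j.+1 - i)%N).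
    by rewrite -subzn ?opprB // ltnW.
  by rewrite abszN absz_nat oddB 1?ltnW // abszN absz_nat addbC.
- rewrite NegzE addrC; case: (leqP i.+1 j) => h.
    by rewrite subzn // absz_nat oddB // abszN absz_nat addbC.
  have -> : (Posz j - Posz i.+1) = - (Posz (i.+1 - j)%N).
    by rewrite -subzn ?opprB // ltnW.
  by rewrite !abszN !absz_nat oddB 1?ltnW // addbC.
- by rewrite !NegzE -opprD !abszN -PoszD !absz_nat oddD.
Qed.

Lemma parN i : par (- i) = par i. Proof. by rewrite /par abszN. Qed.
Lemma parB i j : par (i - j) = par i (+) par j.
Proof. by rewrite parD parN. Qed.
Lemma parM i j : par (i * j) = par i && par j.
Proof. by rewrite /par abszM oddM. Qed.
Lemma par0 : par 0 = false. Proof. by []. Qed.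
Lemma par1 : par 1 = true. Proof. by []. Qed.
Definition parE := (parD, parN, parM, par0, par1).

Section Ksign.
Variables (V : zmodType).
Implicit Types (x y : V) (i : int).

Lemma ksign0 i : ksign i (0 : V) = 0.
Proof. by rewrite /ksign oppr0 if_same. Qed.
Lemma ksignD i x y : ksign i (x + y) = ksign i x + ksign i y.
Proof. by rewrite /ksign; case: par; rewrite // opprD. Qed.
Lemma ksignN i x : ksign i (- x) = - ksign i x.
Proof. by rewrite /ksign; case: par. Qed.
Lemma ksignB i x y : ksign i (x - y) = ksign i x - ksign i y.
Proof. by rewrite ksignD ksignN. Qed.
End Ksign.

(* A grading of the abelian group [V] is given by its homogeneous components:
   [c i] is the projection onto [V^i], so [x] is homogeneous of degree [i] when
   [c i x = x], and every [x] is the sum of finitely many of its components. *)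
Record is_grading (V : zmodType) (c : int -> V -> V) : Prop := IsGrading {
  gr_sub : forall i x y, c i (x - y) = c i x - c i y;
  gr_proj : forall i j x, c i (c j x) = if i == j then c j x else 0;
  gr_fin : forall x, exists s : seq int, uniq s /\ x = \sum_(i <- s) c i x }.

Definition of_deg (V : zmodType) (c : int -> V -> V) (i : int) (x : V) : Prop :=
  c i x = x.

(* A finite set of degrees containing those of the nonzero components. *)
Definition supp (V : zmodType) (c : int -> V -> V) (x : V) : seq int :=
  if pselect (exists s : seq int, uniq s /\ x = \sum_(i <- s) c i x) is left h
  then projT1 (cid h) else [::].

(* [\sum_i F i x_i], where the [x_i] are the homogeneous components of [x]. *)
Definition gsum (V U : zmodType) (c : int -> V -> V) (F : int -> V -> U) (x : V)
  : U := \sum_(i <- supp c x) F i (c i x).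

Lemma big_supset (U : zmodType) (I : eqType) (s t : seq I) (G : I -> U) :
    uniq s -> uniq t -> {subset s <= t} ->
    (forall i, i \in t -> i \notin s -> G i = 0) ->
  \sum_(i <- s) G i = \sum_(i <- t) G i.
Proof.
move=> us ut st G0; rewrite [RHS](bigID (mem s)) /= [X in _ + X]big_seq_cond.
rewrite [X in _ + X]big1 ?addr0; last by move=> i /andP[]; apply: G0.
rewrite -[RHS]big_filter; apply: perm_big; apply: uniq_perm => //.
  exact: filter_uniq.
by move=> i; rewrite mem_filter /= andb_idr // => /st.
Qed.

Section Grading.
Variables (V : zmodType) (c : int -> V -> V).
Hypothesis cP : is_grading c.

Lemma gr0 i : c i 0 = 0.
Proof. by rewrite -[X in c i X](subrr 0) (gr_sub cP) subrr. Qed.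
Lemma grN i x : c i (- x) = - c i x.
Proof. by rewrite -[X in c i X]sub0r (gr_sub cP) gr0 sub0r. Qed.
Lemma grD i x y : c i (x + y) = c i x + c i y.
Proof. by rewrite -{1}[y]opprK (gr_sub cP) grN opprK. Qed.
Lemma gr_sum i (I : Type) (s : seq I) (G : I -> V) :
  c i (\sum_(j <- s) G j) = \sum_(j <- s) c i (G j).
Proof. by elim/big_rec2: _ => [|j y z _ <-]; rewrite ?gr0 ?grD. Qed.

Lemma gr_of_deg i x : of_deg c i (c i x).
Proof. by rewrite /of_deg (gr_proj cP) eqxx. Qed.

Lemma of_degP i j x : of_deg c j x -> c i x = if i == j then x else 0.
Proof. by move=> hx; rewrite -hx (gr_proj cP) hx. Qed.

Lemma of_deg0 i : of_deg c i 0. Proof. exact: gr0. Qed.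
Lemma of_degN i x : of_deg c i x -> of_deg c i (- x).
Proof. by rewrite /of_deg grN => ->. Qed.
Lemma of_degD i x y : of_deg c i x -> of_deg c i y -> of_deg c i (x + y).
Proof. by rewrite /of_deg grD => -> ->. Qed.
Lemma of_deg_ksign i j x : of_deg c i x -> of_deg c i (ksign j x).
Proof. by rewrite /ksign; case: par => //; apply: of_degN. Qed.

Lemma suppP x : uniq (supp c x) /\ x = \sum_(i <- supp c x) c i x.
Proof.
rewrite /supp; case: pselect => [h|[]]; last exact: (gr_fin cP).
by case: (cid h).
Qed.

Lemma gr_out s x i : uniq s -> x = \sum_(i <- s) c i x -> i \notin s -> c i x = 0.
Proof.
move=> us xs is_; rewrite xs gr_sum big_seq big1 // => j js.
by rewrite (gr_proj cP); case: eqP => // ij; rewrite ij js in is_.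
Qed.

Lemma gr_sup s x : uniq s -> {subset supp c x <= s} -> x = \sum_(i <- s) c i x.
Proof.
have [us xs] := suppP x => us' ss; rewrite {1}xs; apply: big_supset => // i _.
exact: gr_out.
Qed.

Lemma gr_ind (P : V -> Prop) : P 0 -> (forall x y, P x -> P y -> P (x + y)) ->
  (forall i x, of_deg c i x -> P x) -> forall x, P x.
Proof.
move=> P0 PD Ph x; rewrite (suppP x).2; elim/big_ind: _ => // i _.
exact: Ph (gr_of_deg i x).
Qed.

Section Gsum.
Variables (U : zmodType).
Implicit Types F G : int -> V -> U.

Lemma gsumE F s x : (forall i, F i 0 = 0) -> uniq s -> x = \sum_(i <- s) c i x ->
  gsum c F x = \sum_(i <- s) F i (c i x).
Proof.
move=> F0 us xs; have [ux xx] := suppP x; rewrite /gsum.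
pose t := undup (supp c x ++ s); have ut : uniq t by rewrite undup_uniq.
transitivity (\sum_(i <- t) F i (c i x)); last symmetry; apply: big_supset => //.
- by move=> i; rewrite mem_undup mem_cat => ->.
- by move=> i _ ix; rewrite (gr_out ux xx ix) F0.
- by move=> i; rewrite mem_undup mem_cat orbC => ->.
- by move=> i _ ix; rewrite (gr_out us xs ix) F0.
Qed.

Lemma gsum_homog F i x : (forall i, F i 0 = 0) -> of_deg c i x -> gsum c F x = F i x.
Proof.
by move=> F0 hx; rewrite (@gsumE _ [:: i]) // ?big_seq1 ?hx // big_seq1 hx.
Qed.

Lemma gsumD F x y : (forall i u v, F i (u + v) = F i u + F i v) ->
  gsum c F (x + y) = gsum c F x + gsum c F y.
Proof.
move=> FD; have F0 i : F i 0 = 0.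
  by apply: (addrI (F i 0)); rewrite -FD !addr0.
pose t := undup (supp c x ++ supp c y); have ut : uniq t by rewrite undup_uniq.
have hx : x = \sum_(i <- t) c i x.
  by apply: gr_sup => // i; rewrite mem_undup mem_cat => ->.
have hy : y = \sum_(i <- t) c i y.
  by apply: gr_sup => // i; rewrite mem_undup mem_cat orbC => ->.
have hxy : x + y = \sum_(i <- t) c i (x + y).
  by under eq_bigr do rewrite grD; rewrite big_split -hx -hy.
rewrite (gsumE F0 ut hx) (gsumE F0 ut hy) (gsumE F0 ut hxy) -big_split /=.
by apply: eq_bigr => i _; rewrite grD FD.
Qed.

Lemma gsum_add F G x :
  gsum c (fun i y => F i y + G i y) x = gsum c F x + gsum c G x.
Proof. by rewrite /gsum big_split. Qed.

Lemma eq_gsum F G x : (forall i y, of_deg c i y -> F i y = G i y) ->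
  gsum c F x = gsum c G x.
Proof. by move=> FG; apply: eq_bigr => i _; rewrite FG //; apply: gr_of_deg. Qed.

End Gsum.

Lemma gsum_id x : gsum c (fun _ y => y) x = x.
Proof. by rewrite /gsum -(suppP x).2. Qed.

Lemma gsum_raddf (U W : zmodType) (g : {additive U -> W}) (F : int -> V -> U) x :
  g (gsum c F x) = gsum c (fun i y => g (F i y)) x.
Proof. by rewrite /gsum raddf_sum. Qed.

End Grading.

Section Gsum2.
Variables (V W U : zmodType) (c : int -> V -> V) (e : int -> W -> W).
Hypotheses (cP : is_grading c) (eP : is_grading e).
Variable (F : int -> int -> V -> W -> U).

Definition gsum2 (x : V) (y : W) : U :=
  gsum c (fun i xi => gsum e (fun j yj => F i j xi yj) y) x.

Hypothesis FDl : forall i j x x' y, F i j (x + x') y = F i j x y + F i j x' y.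
Hypothesis FDr : forall i j x y y', F i j x (y + y') = F i j x y + F i j x y'.

Lemma gsum2Dl x x' y : gsum2 (x + x') y = gsum2 x y + gsum2 x' y.
Proof.
rewrite /gsum2 gsumD // => i u v; rewrite -gsum_add.
by apply: eq_bigr => j _.
Qed.

Lemma gsum2Dr x y y' : gsum2 x (y + y') = gsum2 x y + gsum2 x y'.
Proof.
rewrite /gsum2 -gsum_add; apply: eq_bigr => i _; exact: gsumD.
Qed.

Lemma gsum2_homog i j x y : of_deg c i x -> of_deg e j y -> gsum2 x y = F i j x y.
Proof.
have F0l a b z : F a b 0 z = 0.
  by apply: (addrI (F a b 0 z)); rewrite -FDl !addr0.
have F0r a b z : F a b z 0 = 0.
  by apply: (addrI (F a b z 0)); rewrite -FDr !addr0.
move=> hx hy; rewrite /gsum2 (gsum_homog cP _ hx); last first.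
  by move=> a; rewrite /gsum big1.
by rewrite (gsum_homog eP _ hy).
Qed.
End Gsum2.

Record dgAlgebra (k : fieldType) := DGAlgebra {
  dga_alg :> algType k;
  dga_comp : int -> dga_alg -> dga_alg;
  dga_diff : dga_alg -> dga_alg;
  dga_grading : is_grading dga_comp;
  dga_compZ : forall i (c : k) a, dga_comp i (c *: a) = c *: dga_comp i a;
  dga_mul_deg : forall i j a b, of_deg dga_comp i a -> of_deg dga_comp j b ->
    of_deg dga_comp (i + j) (a * b);
  dga_diffD : forall a b, dga_diff (a + b) = dga_diff a + dga_diff b;
  dga_diffZ : forall (c : k) a, dga_diff (c *: a) = c *: dga_diff a;
  dga_diff_deg : forall i a, of_deg dga_comp i a ->
    of_deg dga_comp (i + 1) (dga_diff a);
  dga_diffK : forall a, dga_diff (dga_diff a) = 0;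
  dga_leibniz : forall i a b, of_deg dga_comp i a ->
    dga_diff (a * b) = dga_diff a * b + ksign i (a * dga_diff b) }.

Section DGAlgebraTheory.
Variables (k : fieldType) (A : dgAlgebra k).
Implicit Types a b : A.
Notation cA := (@dga_comp k A).
Notation hdeg := (of_deg (@dga_comp k A)).

Lemma dga_diff0 : dga_diff (0 : A) = 0.
Proof. by apply: (addrI (dga_diff (0 : A))); rewrite -dga_diffD !addr0. Qed.
Lemma dga_diffN a : dga_diff (- a) = - dga_diff a.
Proof. by rewrite -scaleN1r dga_diffZ scaleN1r. Qed.

Lemma of_degZ i (c : k) a : hdeg i a -> hdeg i (c *: a).
Proof. by rewrite /of_deg dga_compZ => ->. Qed.

Lemma dga_one_deg : hdeg 0 1.
Proof.
have gP := dga_grading A.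
suff h a : a * cA 0 1 = a by rewrite /of_deg -[LHS]mul1r h.
elim/(gr_ind gP): a => [|x y hx hy|j x hx]; rewrite ?mul0r ?mulrDl ?hx ?hy //.
have [us s1] := suppP gP (1 : A).
have -> : x = cA j (x * 1) by rewrite mulr1 hx.
rewrite [in RHS]s1 mulr_sumr gr_sum //.
have hi i : cA j (x * cA i 1) = if i == 0 then x * cA i 1 else 0.
  rewrite (of_degP gP _ (dga_mul_deg hx (gr_of_deg gP i 1))).
  by rewrite -[X in X == _]addr0 (inj_eq (addrI _)) eq_sym.
under eq_bigr do rewrite hi.
rewrite mulr1 hx; case: (boolP (0 \in supp cA (1 : A))) => h0; last first.
  rewrite (gr_out gP us s1 h0) mulr0 big_seq big1 // => i hi0.
  by case: eqP => // i0; rewrite -i0 hi0 in h0.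
by rewrite (bigD1_seq 0) //= big1 ?addr0 // => i /negbTE->.
Qed.

Lemma dga_diff1 : dga_diff (1 : A) = 0.
Proof.
have := dga_leibniz 1 dga_one_deg; rewrite mulr1 /ksign /= mulr1 mul1r.
by move=> h; apply: (addrI (dga_diff (1 : A))); rewrite -h addr0.
Qed.

Lemma of_degA c : hdeg 0 (c%:A).
Proof. exact/of_degZ/dga_one_deg. Qed.

End DGAlgebraTheory.

Lemma ksign_mull (R : pzRingType) i (a b : R) : ksign i a * b = ksign i (a * b).
Proof. by rewrite /ksign; case: par; rewrite ?mulNr. Qed.
Lemma ksign_mulr (R : pzRingType) i (a b : R) : a * ksign i b = ksign i (a * b).
Proof. by rewrite /ksign; case: par; rewrite ?mulrN. Qed.
Lemma ksign_scale (R : pzRingType) (M : lmodType R) i (a : R) (m : M) :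
  a *: ksign i m = ksign i (a *: m).
Proof. by rewrite /ksign; case: par; rewrite ?scalerN. Qed.
Lemma ksign_scalel (R : pzRingType) (M : lmodType R) i (a : R) (m : M) :
  ksign i a *: m = ksign i (a *: m).
Proof. by rewrite /ksign; case: par; rewrite ?scaleNr. Qed.

Section Opposite.
Variables (k : fieldType) (A : dgAlgebra k).
Notation cA := (@dga_comp k A).

Definition opT : Type := A.
HB.instance Definition _ := GRing.Lmodule.on opT.

(* [a . b = (-1)^(|a||b|) b a] *)
Definition opmul (a b : A) : A :=
  gsum2 cA cA (fun i j a b => ksign (i * j) (b * a)) a b.

Lemma opmulDl a a' b : opmul (a + a') b = opmul a b + opmul a' b.
Proof.
apply: gsum2Dl; first exact: dga_grading.
by move=> i j x x' y; rewrite mulrDr ksignD.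
Qed.
Lemma opmulDr a b b' : opmul a (b + b') = opmul a b + opmul a b'.
Proof.
apply: gsum2Dr; first exact: dga_grading.
by move=> i j x x' y; rewrite mulrDl ksignD.
Qed.
Lemma opmulE i j a b : of_deg cA i a -> of_deg cA j b ->
  opmul a b = ksign (i * j) (b * a).
Proof.
apply: (gsum2_homog (dga_grading A) (dga_grading A)) => *.
  by rewrite mulrDr ksignD.
by rewrite mulrDl ksignD.
Qed.

Lemma opmul0l b : opmul 0 b = 0.
Proof. by apply: (addrI (opmul 0 b)); rewrite -opmulDl !addr0. Qed.
Lemma opmul0r b : opmul b 0 = 0.
Proof. by apply: (addrI (opmul b 0)); rewrite -opmulDr !addr0. Qed.

Lemma opmul_deg i j a b : of_deg cA i a -> of_deg cA j b ->
  of_deg cA (i + j) (opmul a b).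
Proof.
move=> ha hb; rewrite (opmulE ha hb); apply: (of_deg_ksign (dga_grading A)).
by rewrite addrC; apply: dga_mul_deg.
Qed.

Lemma opmulA : associative opmul.
Proof.
have gP := dga_grading A; move=> a b c.
elim/(gr_ind gP): a => [|x y hx hy|i a ha].
- by rewrite !opmul0l.
- by rewrite !opmulDl hx hy.
elim/(gr_ind gP): b => [|x y hx hy|j b hb].
- by rewrite opmul0l !opmul0r opmul0l.
- by rewrite opmulDl !opmulDr opmulDl hx hy.
elim/(gr_ind gP): c => [|x y hx hy|l c hc].
- by rewrite !opmul0r.
- by rewrite !opmulDr hx hy.
rewrite (opmulE ha (opmul_deg hb hc)) (opmulE (opmul_deg ha hb) hc).
rewrite (opmulE hb hc) (opmulE ha hb) ksign_mull ksign_mulr mulrA /ksign !parE.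
by case: (par i); case: (par j); case: (par l); rewrite //= ?opprK.
Qed.

Lemma opmul1l : left_id 1 opmul.
Proof.
have gP := dga_grading A; move=> a.
elim/(gr_ind gP): a => [|x y hx hy|i a ha]; rewrite ?opmul0r ?opmulDr ?hx ?hy //.
by rewrite (opmulE (dga_one_deg A) ha) mulr1 /ksign mul0r.
Qed.
Lemma opmul1r : right_id 1 opmul.
Proof.
have gP := dga_grading A; move=> a.
elim/(gr_ind gP): a => [|x y hx hy|i a ha]; rewrite ?opmul0l ?opmulDl ?hx ?hy //.
by rewrite (opmulE ha (dga_one_deg A)) mul1r /ksign mulr0.
Qed.

HB.instance Definition _ := GRing.Zmodule_isNzRing.Build opT
  opmulA opmul1l opmul1r opmulDl opmulDr (oner_neq0 A).

Lemma opmulZl (c : k) (a b : A) : c *: opmul a b = opmul (c *: a) b.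
Proof.
have gP := dga_grading A.
elim/(gr_ind gP): a => [|x y hx hy|i a ha].
- by rewrite scaler0 !opmul0l scaler0.
- by rewrite scalerDr !opmulDl scalerDr hx hy.
elim/(gr_ind gP): b => [|x y hx hy|j b hb].
- by rewrite !opmul0r scaler0.
- by rewrite !opmulDr scalerDr hx hy.
by rewrite (opmulE ha hb) (opmulE (of_degZ c ha) hb) ksign_scale -scalerAr.
Qed.
HB.instance Definition _ := GRing.Lmodule_isLalgebra.Build k opT opmulZl.

Lemma opmulZr (c : k) (a b : A) : c *: opmul a b = opmul a (c *: b).
Proof.
have gP := dga_grading A.
elim/(gr_ind gP): a => [|x y hx hy|i a ha].
- by rewrite !opmul0l scaler0.
- by rewrite !opmulDl scalerDr hx hy.
elim/(gr_ind gP): b => [|x y hx hy|j b hb].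
- by rewrite scaler0 !opmul0r scaler0.
- by rewrite scalerDr !opmulDr scalerDr hx hy.
by rewrite (opmulE ha hb) (opmulE ha (of_degZ c hb)) ksign_scale -scalerAl.
Qed.
HB.instance Definition _ := GRing.Lalgebra_isAlgebra.Build k opT opmulZr.

Lemma op_leibniz i (a b : A) : of_deg cA i a ->
  dga_diff (opmul a b) = opmul (dga_diff a) b + ksign i (opmul a (dga_diff b)).
Proof.
have gP := dga_grading A => ha.
elim/(gr_ind gP): b => [|x y hx hy|j b hb].
- by rewrite dga_diff0 !opmul0r dga_diff0 ksign0 addr0.
- by rewrite dga_diffD !opmulDr ksignD dga_diffD hx hy addrACA.
have hda := dga_diff_deg ha; have hdb := dga_diff_deg hb.
rewrite (opmulE ha hb) (opmulE hda hb) (opmulE ha hdb).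
have -> : dga_diff (ksign (i * j) (b * a)) = ksign (i * j) (dga_diff (b * a)).
  by rewrite /ksign; case: par; rewrite ?dga_diffN.
rewrite (dga_leibniz _ hb) ksignD addrC /ksign !parE.
by case: (par i); case: (par j); rewrite //= ?opprK.
Qed.

Definition dga_op : dgAlgebra k :=
  @DGAlgebra k opT (@dga_comp k A) (@dga_diff k A) (dga_grading A)
    (@dga_compZ k A) opmul_deg (@dga_diffD k A) (@dga_diffZ k A)
    (@dga_diff_deg k A) (@dga_diffK k A) op_leibniz.

End Opposite.

Section Tensor.
Variables (k : fieldType) (V W : lmodType k).

Definition bilin (U : lmodType k) (f : V -> W -> U) : Prop :=
  (forall w, linear (f^~ w)) /\ (forall v, linear (f v)).

(* The formal sum [\sum_p p.1 (x) p.2] evaluated under [f]. *)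
Definition tens_ev (U : zmodType) (f : V -> W -> U) (s : seq (V * W)) : U :=
  \sum_(p <- s) f p.1 p.2.

(* The tensor product over [k]: formal sums of pure tensors, two of them being
   equal when no bilinear map separates them. *)
Definition tens_rel (s t : seq (V * W)) : bool :=
  `[< forall (U : lmodType k) (f : V -> W -> U), bilin f ->
        tens_ev f s = tens_ev f t >].

Lemma tens_relP : equiv_class_of tens_rel.
Proof.
split => [s|s t|t s u].
- exact/asboolP.
- by apply/asboolP/asboolP => h U f hf; rewrite h.
- by move=> /asboolP h1 /asboolP h2; apply/asboolP => U f hf; rewrite h1 ?h2.
Qed.
Canonical tens_equiv := EquivRelPack tens_relP.

Definition tensT : Type := {eq_quot tens_equiv}.
HB.instance Definition _ := Choice.on tensT.

(* The map out of the tensor product induced by a bilinear map. *)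
Definition tens_lift (U : zmodType) (f : V -> W -> U) (x : tensT) : U :=
  tens_ev f (repr x).

Definition tens_of (s : seq (V * W)) : tensT := \pi_{eq_quot tens_equiv} s.

Lemma tens_liftE (U : lmodType k) (f : V -> W -> U) s : bilin f ->
  tens_lift f (tens_of s) = tens_ev f s.
Proof.
move=> hf; have /asboolP h : tens_rel (repr (tens_of s)) s.
  by apply/eqmodP; rewrite reprK.
exact: h.
Qed.

Lemma tens_ext (x y : tensT) :
  (forall (U : lmodType k) (f : V -> W -> U), bilin f ->
     tens_lift f x = tens_lift f y) -> x = y.
Proof.
move=> h; rewrite -[x]reprK -[y]reprK; apply/eqmodP; exact/asboolP.
Qed.

Definition tens_add (x y : tensT) : tensT := tens_of (repr x ++ repr y).
Definition tens_opp (x : tensT) : tensT :=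
  tens_of [seq (- p.1, p.2) | p <- repr x].
Definition tens_scale (c : k) (x : tensT) : tensT :=
  tens_of [seq (c *: p.1, p.2) | p <- repr x].

Section Lift.
Variables (U : lmodType k) (f : V -> W -> U).
Hypothesis hf : bilin f.

Lemma bilin0l w : f 0 w = 0.
Proof. by have := hf.1 w (-1) 0 0; rewrite scaler0 addr0 scaleN1r addNr. Qed.
Lemma bilin0r v : f v 0 = 0.
Proof. by have := hf.2 v (-1) 0 0; rewrite scaler0 addr0 scaleN1r addNr. Qed.
Lemma bilinDl v v' w : f (v + v') w = f v w + f v' w.
Proof. by have := hf.1 w 1 v v'; rewrite !scale1r. Qed.
Lemma bilinDr v w w' : f v (w + w') = f v w + f v w'.
Proof. by have := hf.2 v 1 w w'; rewrite !scale1r. Qed.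
Lemma bilinZl c v w : f (c *: v) w = c *: f v w.
Proof. by have := hf.1 w c v 0; rewrite !addr0 bilin0l addr0. Qed.
Lemma bilinZr c v w : f v (c *: w) = c *: f v w.
Proof. by have := hf.2 v c w 0; rewrite !addr0 bilin0r addr0. Qed.

Lemma lift_add x y : tens_lift f (tens_add x y) = tens_lift f x + tens_lift f y.
Proof. by rewrite tens_liftE // /tens_ev big_cat. Qed.
Lemma lift_opp x : tens_lift f (tens_opp x) = - tens_lift f x.
Proof.
rewrite tens_liftE // /tens_ev big_map -sumrN; apply: eq_bigr => p _ /=.
by rewrite -scaleN1r bilinZl scaleN1r.
Qed.
Lemma lift_scale c x : tens_lift f (tens_scale c x) = c *: tens_lift f x.
Proof.
rewrite tens_liftE // /tens_ev big_map scaler_sumr; apply: eq_bigr => p _ /=.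
by rewrite bilinZl.
Qed.
Lemma lift_zero : tens_lift f (tens_of [::]) = 0.
Proof. by rewrite tens_liftE // /tens_ev big_nil. Qed.
End Lift.

Lemma tens_addA : associative tens_add.
Proof. by move=> x y z; apply: tens_ext => U f hf; rewrite !lift_add // addrA. Qed.
Lemma tens_addC : commutative tens_add.
Proof. by move=> x y; apply: tens_ext => U f hf; rewrite !lift_add // addrC. Qed.
Lemma tens_add0 : left_id (tens_of [::]) tens_add.
Proof.
by move=> x; apply: tens_ext => U f hf; rewrite lift_add // lift_zero // add0r.
Qed.
Lemma tens_addN : left_inverse (tens_of [::]) tens_opp tens_add.
Proof.
move=> x; apply: tens_ext => U f hf.
by rewrite lift_add // lift_zero // lift_opp // addNr.
Qed.
HB.instance Definition _ :=
  GRing.isZmodule.Build tensT tens_addA tens_addC tens_add0 tens_addN.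

Lemma tens_scaleA c d x : tens_scale c (tens_scale d x) = tens_scale (c * d) x.
Proof. by apply: tens_ext => U f hf; rewrite !lift_scale // scalerA. Qed.
Lemma tens_scale1 : left_id 1 tens_scale.
Proof. by move=> x; apply: tens_ext => U f hf; rewrite lift_scale // scale1r. Qed.
Lemma tens_scaleDr : right_distributive tens_scale (@GRing.add tensT).
Proof.
move=> c x y; apply: tens_ext => U f hf.
by rewrite lift_scale // !lift_add // !lift_scale // scalerDr.
Qed.
Lemma tens_scaleDl x : {morph tens_scale^~ x : c d / c + d}.
Proof.
move=> c d; apply: tens_ext => U f hf.
by rewrite lift_add // !lift_scale // scalerDl.
Qed.
HB.instance Definition _ := GRing.Zmodule_isLmodule.Build k tensT
  tens_scaleA tens_scale1 tens_scaleDr tens_scaleDl.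

Definition tens (v : V) (w : W) : tensT := tens_of [:: (v, w)].

Lemma tens_lift_tens (U : lmodType k) (f : V -> W -> U) v w : bilin f ->
  tens_lift f (tens v w) = f v w.
Proof. by move=> hf; rewrite tens_liftE // /tens_ev big_seq1. Qed.

Lemma tens_bilin : bilin tens.
Proof.
split => [w|v] c x y; apply: tens_ext => U f hf; rewrite lift_add //.
  rewrite lift_scale // !tens_lift_tens //; exact: hf.1.
rewrite lift_scale // !tens_lift_tens //; exact: hf.2.
Qed.

Lemma tens_lift_linear (U : lmodType k) (f : V -> W -> U) : bilin f ->
  linear (tens_lift f).
Proof. by move=> hf c x y; rewrite lift_add // lift_scale. Qed.

Lemma tensE (x : tensT) : x = \sum_(p <- repr x) tens p.1 p.2.
Proof.
apply: tens_ext => U f hf; pose g : {linear tensT -> U} :=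
  HB.pack (tens_lift f) (GRing.isLinear.Build k _ _ _ _ (tens_lift_linear hf)).
rewrite -[RHS]/(g _) raddf_sum /=; apply: eq_bigr => p _.
by rewrite tens_lift_tens.
Qed.

Lemma tens_universal (U : lmodType k) (f : V -> W -> U) : bilin f ->
  exists! g : tensT -> U, linear g /\ forall v w, g (tens v w) = f v w.
Proof.
move=> hf; exists (tens_lift f); split.
  split; [exact: tens_lift_linear | move=> v w; exact: tens_lift_tens].
move=> g [gl gE]; apply/funext => x; rewrite {2}(tensE x).
pose g' : {linear tensT -> U} := HB.pack g (GRing.isLinear.Build k _ _ _ _ gl).
by rewrite -[RHS]/(g' _) raddf_sum /=; apply: eq_bigr => p _; rewrite gE.
Qed.

Lemma tens_ind (P : tensT -> Prop) : P 0 ->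
  (forall x y, P x -> P y -> P (x + y)) -> (forall v w, P (tens v w)) ->
  forall x, P x.
Proof. by move=> P0 PD Pt x; rewrite (tensE x); elim/big_ind: _. Qed.

End Tensor.

Lemma gsumZ (k : fieldType) (V U : lmodType k) (c : int -> V -> V)
    (F : int -> V -> U) z x :
  is_grading c -> (forall i (z : k) x, c i (z *: x) = z *: c i x) ->
  (forall i u, F i (z *: u) = z *: F i u) -> (forall i, F i 0 = 0) ->
  gsum c F (z *: x) = z *: gsum c F x.
Proof.
move=> cP cZ FZ F0; have [us xs] := suppP cP x.
have zs : z *: x = \sum_(i <- supp c x) c i (z *: x).
  by rewrite {1}xs scaler_sumr; apply: eq_bigr => i _; rewrite cZ.
rewrite (gsumE cP F0 us zs) /gsum scaler_sumr.
by apply: eq_bigr => i _; rewrite cZ FZ.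
Qed.

Lemma gsum_scale (k : fieldType) (V U : lmodType k) (c : int -> V -> V)
    (F : int -> V -> U) z x :
  gsum c (fun i u => z *: F i u) x = z *: gsum c F x.
Proof. by rewrite /gsum scaler_sumr. Qed.

Section GsumZ.
Variables (k : fieldType) (V W U : lmodType k).
Variables (c : int -> V -> V) (e : int -> W -> W).
Hypotheses (cP : is_grading c) (eP : is_grading e).
Hypothesis cZ : forall i (z : k) x, c i (z *: x) = z *: c i x.
Hypothesis eZ : forall i (z : k) x, e i (z *: x) = z *: e i x.

Variable (F : int -> int -> V -> W -> U).
Hypothesis Fl : forall i j y, linear (F i j ^~ y).
Hypothesis Fr : forall i j x, linear (F i j x).

Let FDl i j x x' y : F i j (x + x') y = F i j x y + F i j x' y.
Proof. by have := Fl i j y 1 x x'; rewrite !scale1r. Qed.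
Let FDr i j x y y' : F i j x (y + y') = F i j x y + F i j x y'.
Proof. by have := Fr i j x 1 y y'; rewrite !scale1r. Qed.
Let F0l i j y : F i j 0 y = 0.
Proof. by apply: (addrI (F i j 0 y)); rewrite -FDl !addr0. Qed.
Let F0r i j x : F i j x 0 = 0.
Proof. by apply: (addrI (F i j x 0)); rewrite -FDr !addr0. Qed.
Let FZl i j z x y : F i j (z *: x) y = z *: F i j x y.
Proof. by have := Fl i j y z x 0; rewrite !addr0 F0l addr0. Qed.
Let FZr i j z x y : F i j x (z *: y) = z *: F i j x y.
Proof. by have := Fr i j x z y 0; rewrite !addr0 F0r addr0. Qed.

Lemma gsum2_bilin : bilin (gsum2 c e F).
Proof.
split => [y|x] z u v.
  rewrite gsum2Dl //; congr (_ + _); apply: gsumZ => // [i w|i].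
    by rewrite -gsum_scale; apply: eq_bigr => j _; rewrite FZl.
  by rewrite /gsum big1.
rewrite gsum2Dr //; congr (_ + _).
rewrite /gsum2 -gsum_scale; apply: eq_bigr => i _; exact: gsumZ.
Qed.
End GsumZ.

Section Finc.
Variables (V : zmodType) (c : int -> V -> V).
Hypothesis cB : forall i x y, c i (x - y) = c i x - c i y.

Definition finc (x : V) := exists s : seq int, forall t, uniq t ->
  {subset s <= t} -> x = \sum_(i <- t) c i x.

Lemma finc_fin x : finc x -> exists s, uniq s /\ x = \sum_(i <- s) c i x.
Proof.
move=> [s hs]; exists (undup s); split; first exact: undup_uniq.
by apply: hs (undup_uniq s) _ => i; rewrite mem_undup.
Qed.

Lemma finc0 : finc 0.
Proof.
have c0 i : c i 0 = 0 by rewrite -[X in c i X](subrr 0) cB subrr.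
by exists [::] => t _ _; rewrite big1.
Qed.

Lemma fincD x y : finc x -> finc y -> finc (x + y).
Proof.
have c0 i : c i 0 = 0 by rewrite -[X in c i X](subrr 0) cB subrr.
have cN i z : c i (- z) = - c i z by rewrite -[X in c i X]sub0r cB c0 sub0r.
have cD i u v : c i (u + v) = c i u + c i v by rewrite -{1}[v]opprK cB cN opprK.
move=> [s hs] [s' hs']; exists (s ++ s') => t ut st.
under eq_bigr do rewrite cD; rewrite big_split /= -hs -?hs' // => i h.
  by apply: st; rewrite mem_cat h orbT.
by apply: st; rewrite mem_cat h.
Qed.

Lemma finc_homog i x : (forall j, c j x = if j == i then x else 0) -> finc x.
Proof.
move=> h; exists [:: i] => t ut it; rewrite (bigD1_seq i) ?it ?mem_head //=.
by rewrite h eqxx big1 ?addr0 // => j /negbTE ji; rewrite h ji.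
Qed.
End Finc.

(* [cdga_aug] records the identification of [A^0] with [k]. *)
Record connDGAlgebra (k : fieldType) := ConnDGAlgebra {
  cdga :> dgAlgebra k;
  cdga_neg : forall i (a : cdga), (i < 0)%R -> dga_comp i a = 0;
  cdga_aug : cdga -> k;
  cdga_augP : forall a, dga_comp 0 a = (cdga_aug a)%:A }.

Section Aug.
Variables (k : fieldType) (A : connDGAlgebra k).
Notation cA := (@dga_comp k A).
Notation aug := (@cdga_aug k A).

Lemma scalA_inj (c d : k) : c%:A = d%:A :> A -> c = d.
Proof.
move=> /eqP; rewrite -subr_eq0 -scalerBl scaler_eq0 oner_eq0 orbF subr_eq0.
by move/eqP.
Qed.

Lemma augE a c : cA 0 a = c%:A -> aug a = c.
Proof. by rewrite cdga_augP => /scalA_inj. Qed.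

Lemma augD a b : aug (a + b) = aug a + aug b.
Proof. by apply: augE; rewrite (grD (dga_grading A)) !cdga_augP scalerDl. Qed.
Lemma augZ c a : aug (c *: a) = c * aug a.
Proof. by apply: augE; rewrite dga_compZ cdga_augP scalerA. Qed.
Lemma aug0 : aug 0 = 0.
Proof. by apply: augE; rewrite (gr0 (dga_grading A)) scale0r. Qed.
Lemma aug1 : aug 1 = 1.
Proof. by apply: augE; rewrite (dga_one_deg A) scale1r. Qed.

Lemma aug_deg i a : of_deg cA i a -> i != 0 -> aug a = 0.
Proof.
move=> ha /negbTE i0; apply: augE.
by rewrite (of_degP (dga_grading A) 0 ha) eq_sym i0 scale0r.
Qed.

Lemma aug_deg0 a : of_deg cA 0 a -> a = (aug a)%:A.
Proof. by rewrite -cdga_augP. Qed.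

Lemma augM a b : aug (a * b) = aug a * aug b.
Proof.
have gP := dga_grading A.
elim/(gr_ind gP): a => [|x y hx hy|i a ha].
- by rewrite mul0r aug0 mul0r.
- by rewrite mulrDl !augD mulrDl hx hy.
elim/(gr_ind gP): b => [|x y hx hy|j b hb].
- by rewrite mulr0 aug0 mulr0.
- by rewrite mulrDr !augD mulrDr hx hy.
have [i0|i0] := boolP (i == 0).
  rewrite (eqP i0) in ha; rewrite {1}(aug_deg0 ha) -scalerAl mul1r; exact: augZ.
rewrite (aug_deg ha i0) mul0r.
have [j0|j0] := boolP (j == 0).
  rewrite (eqP j0) in hb; rewrite (aug_deg0 hb) -scalerAr mulr1 augZ.
  by rewrite (aug_deg ha i0) mulr0.
case: (ltrP i 0) => hi; first by rewrite -ha (cdga_neg _ hi) mul0r aug0.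
case: (ltrP j 0) => hj; first by rewrite -hb (cdga_neg _ hj) mulr0 aug0.
apply: (aug_deg (dga_mul_deg ha hb)).
by rewrite addr_eq0; apply/eqP => eij; move: hi; rewrite eij oppr_ge0 leNgt lt_def hj j0.
Qed.
End Aug.

Section OpConn.
Variables (k : fieldType) (A : connDGAlgebra k).
Definition cdga_op : connDGAlgebra k :=
  @ConnDGAlgebra k (dga_op A) (@cdga_neg k A) (@cdga_aug k A) (@cdga_augP k A).
End OpConn.

Section TensDGA.
Variables (k : fieldType) (A B : connDGAlgebra k).
Notation cA := (@dga_comp k A).
Notation cB := (@dga_comp k B).
Notation T := (tensT A B).
Let gA := dga_grading A.
Let gB := dga_grading B.
Local Notation tens := (@tens k A B).

Let tDl a a' b : tens (a + a') b = tens a b + tens a' b.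
Proof. exact: bilinDl (tens_bilin _ _) _ _ _. Qed.
Let tDr a b b' : tens a (b + b') = tens a b + tens a b'.
Proof. exact: bilinDr (tens_bilin _ _) _ _ _. Qed.
Let tZl c a b : tens (c *: a) b = c *: tens a b.
Proof. exact: bilinZl (tens_bilin _ _) _ _ _. Qed.
Let tZr c a b : tens a (c *: b) = c *: tens a b.
Proof. exact: bilinZr (tens_bilin _ _) _ _ _. Qed.
Let t0l b : tens 0 b = 0.
Proof. exact: bilin0l (tens_bilin _ _) _. Qed.
Let t0r a : tens a 0 = 0.
Proof. exact: bilin0r (tens_bilin _ _) _. Qed.
Let tKl i a b : tens (ksign i a) b = ksign i (tens a b).
Proof. by rewrite /ksign; case: par; rewrite // -scaleN1r tZl scaleN1r. Qed.
Let tKr i a b : tens a (ksign i b) = ksign i (tens a b).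
Proof. by rewrite /ksign; case: par; rewrite // -scaleN1r tZr scaleN1r. Qed.

Lemma tens_hind (P : T -> Prop) : P 0 -> (forall x y, P x -> P y -> P (x + y)) ->
  (forall i j a b, of_deg cA i a -> of_deg cB j b -> P (tens a b)) ->
  forall x, P x.
Proof.
move=> P0 PD Ph; apply: tens_ind => // a b.
elim/(gr_ind gA): a => [|x y hx hy|i a ha]; rewrite ?t0l ?tDl; auto.
elim/(gr_ind gB): b => [|x y hx hy|j b hb]; rewrite ?t0r ?tDr; auto.
exact: Ph ha hb.
Qed.

(* [(a (x) b) (a' (x) b') = (-1)^(|b||a'|) aa' (x) bb'] *)
Definition tmul0 (a : A) (b : B) (a' : A) (b' : B) : T :=
  gsum2 cB cA (fun i j b a' => ksign (i * j) (tens (a * a') (b * b'))) b a'.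
Definition tmul (x y : T) : T :=
  tens_lift (fun a b => tens_lift (tmul0 a b) y) x.

Let ksZ i c (x : T) : ksign i (c *: x) = c *: ksign i x.
Proof. by rewrite ksign_scale. Qed.

Let tmul0_mid a b' : bilin (fun b a' => tmul0 a b a' b').
Proof.
apply: gsum2_bilin; rewrite ?gA ?gB //; try exact: dga_compZ.
- by move=> i j a' c x y; rewrite mulrDl -scalerAl tDr tZr ksignD ksZ.
- by move=> i j b c x y; rewrite mulrDr -scalerAr tDl tZl ksignD ksZ.
Qed.
Let tmul0_l b a' b' : linear (fun a => tmul0 a b a' b').
Proof.
move=> c x y; rewrite /tmul0 /gsum2 /gsum scaler_sumr -big_split.
apply: eq_bigr => i _ /=; rewrite scaler_sumr -big_split; apply: eq_bigr => j _ /=.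
by rewrite mulrDl -scalerAl tDl tZl ksignD ksZ.
Qed.
Let tmul0_r a b a' : linear (fun b' => tmul0 a b a' b').
Proof.
move=> c x y; rewrite /tmul0 /gsum2 /gsum scaler_sumr -big_split.
apply: eq_bigr => i _ /=; rewrite scaler_sumr -big_split; apply: eq_bigr => j _ /=.
by rewrite mulrDr -scalerAr tDr tZr ksignD ksZ.
Qed.
Lemma tmul0_bilin a b : bilin (tmul0 a b).
Proof. by split=> [b'|a']; [exact: (tmul0_mid a b').2|exact: tmul0_r]. Qed.
Lemma tmul_bilin y : bilin (fun a b => tens_lift (tmul0 a b) y).
Proof.
split => [b|a] c u v; rewrite /tens_lift /tens_ev scaler_sumr -big_split;
  apply: eq_bigr => p _.
- exact: tmul0_l.
- exact: ((tmul0_mid a p.2).1 p.1).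
Qed.

Lemma tmul_tens a b a' b' : tmul (tens a b) (tens a' b') = tmul0 a b a' b'.
Proof.
by rewrite /tmul (tens_lift_tens _ _ (tmul_bilin _)) tens_lift_tens //; exact: tmul0_bilin.
Qed.
Lemma tmulE i j a b a' b' : of_deg cB i b -> of_deg cA j a' ->
  tmul (tens a b) (tens a' b') = ksign (i * j) (tens (a * a') (b * b')).
Proof.
move=> hb ha; rewrite tmul_tens /tmul0 (gsum2_homog gB gA _ _ hb ha) // => *.
- by rewrite mulrDl tDr ksignD.
- by rewrite mulrDr tDl ksignD.
Qed.

Lemma tmulDl x x' y : tmul (x + x') y = tmul x y + tmul x' y.
Proof. exact: (lift_add (tmul_bilin y)). Qed.
Lemma tmulZl c x y : c *: tmul x y = tmul (c *: x) y.
Proof. by symmetry; exact: (lift_scale (tmul_bilin y)). Qed.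
Lemma tmulDr x y y' : tmul x (y + y') = tmul x y + tmul x y'.
Proof.
rewrite /tmul /tens_lift /tens_ev -big_split; apply: eq_bigr => p _ /=.
exact: (lift_add (tmul0_bilin _ _)).
Qed.
Lemma tmulZr c x y : c *: tmul x y = tmul x (c *: y).
Proof.
rewrite /tmul {1 3}/tens_lift /tens_ev scaler_sumr; apply: eq_bigr => p _.
by symmetry; exact: (lift_scale (tmul0_bilin _ _)).
Qed.
Lemma tmul0l x : tmul 0 x = 0.
Proof. by apply: (addrI (tmul 0 x)); rewrite -tmulDl !addr0. Qed.
Lemma tmul0r x : tmul x 0 = 0.
Proof. by apply: (addrI (tmul x 0)); rewrite -tmulDr !addr0. Qed.
Lemma tmulKl i x y : tmul (ksign i x) y = ksign i (tmul x y).
Proof. by rewrite /ksign; case: par; rewrite // -scaleN1r -tmulZl scaleN1r. Qed.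
Lemma tmulKr i x y : tmul x (ksign i y) = ksign i (tmul x y).
Proof. by rewrite /ksign; case: par; rewrite // -scaleN1r -tmulZr scaleN1r. Qed.

Lemma tmulA : associative tmul.
Proof.
move=> x y z.
elim/tens_hind: x => [|x x' hx hx'|i j a b ha hb].
- by rewrite !tmul0l.
- by rewrite !tmulDl hx hx'.
elim/tens_hind: y => [|y y' hy hy'|i' j' a' b' ha' hb'].
- by rewrite tmul0l !tmul0r tmul0l.
- by rewrite tmulDl !tmulDr tmulDl hy hy'.
elim/tens_hind: z => [|z z' hz hz'|i2 j2 a2 b2 ha2 hb2].
- by rewrite !tmul0r.
- by rewrite !tmulDr hz hz'.
rewrite (tmulE _ _ hb' ha2) (tmulE _ _ hb ha') tmulKl tmulKr.
rewrite (tmulE _ _ hb (dga_mul_deg ha' ha2)) (tmulE _ _ (dga_mul_deg hb hb') ha2).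
rewrite !mulrA /ksign !parE.
by case: (par j); case: (par i'); case: (par j'); case: (par i2);
  rewrite //= ?opprK.
Qed.

Lemma tmul1l : left_id (tens 1 1) tmul.
Proof.
move=> x; elim/tens_hind: x => [|x x' hx hx'|i j a b ha hb].
- by rewrite tmul0r.
- by rewrite tmulDr hx hx'.
by rewrite (tmulE _ _ (dga_one_deg B) ha) !mul1r /ksign mul0r.
Qed.
Lemma tmul1r : right_id (tens 1 1) tmul.
Proof.
move=> x; elim/tens_hind: x => [|x x' hx hx'|i j a b ha hb].
- by rewrite tmul0l.
- by rewrite tmulDl hx hx'.
by rewrite (tmulE _ _ hb (dga_one_deg A)) !mulr1 /ksign mulr0.
Qed.

Definition taug0 (a : A) (b : B) : k^o := cdga_aug a * cdga_aug b.
Lemma taug0_bilin : bilin taug0.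
Proof.
split => [b|a] c x y; rewrite /taug0 augD augZ.
  by rewrite mulrDl /GRing.scale /= mulrA.
by rewrite mulrDr /GRing.scale /= mulrCA.
Qed.
Lemma tens_one_neq0 : tens 1 1 != 0.
Proof.
apply/eqP => e; have := tens_lift_tens 1 1 taug0_bilin.
rewrite e (lift_zero taug0_bilin) /taug0 !aug1 mulr1 => /eqP.
by rewrite eq_sym oner_eq0.
Qed.

Definition tensAlgT : Type := T.
HB.instance Definition _ := GRing.Lmodule.on tensAlgT.
HB.instance Definition _ := GRing.Zmodule_isNzRing.Build tensAlgT
  tmulA tmul1l tmul1r tmulDl tmulDr tens_one_neq0.
HB.instance Definition _ := GRing.Lmodule_isLalgebra.Build k tensAlgT tmulZl.
HB.instance Definition _ := GRing.Lalgebra_isAlgebra.Build k tensAlgT tmulZr.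

(* The degree [n] component of [a (x) b] is [\sum_i a_i (x) b_(n-i)]. *)
Definition tcomp0 (n : int) (a : A) (b : B) : T :=
  gsum cA (fun i a => tens a (cB (n - i) b)) a.
Definition tcomp (n : int) : T -> T := tens_lift (tcomp0 n).

Lemma tcomp0_bilin n : bilin (tcomp0 n).
Proof.
split => [b|a] c x y; rewrite /tcomp0.
  rewrite gsumD // gsumZ // => i u v; exact: dga_compZ.
rewrite -gsum_scale -gsum_add; apply: eq_bigr => i _.
by rewrite (grD gB) dga_compZ tDr tZr.
Qed.

Lemma tcompE n i j a b : of_deg cA i a -> of_deg cB j b ->
  tcomp n (tens a b) = if n == i + j then tens a b else 0.
Proof.
move=> ha hb; rewrite /tcomp (tens_lift_tens _ _ (tcomp0_bilin n)) /tcomp0.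
rewrite (gsum_homog gA _ ha) => [|l]; last by rewrite t0l.
rewrite (of_degP gB _ hb) subr_eq [j + i]addrC.
by case: eqP => // _; rewrite t0r.
Qed.

Lemma tcompD n x y : tcomp n (x + y) = tcomp n x + tcomp n y.
Proof. exact: (lift_add (tcomp0_bilin n)). Qed.
Lemma tcompZ n c x : tcomp n (c *: x) = c *: tcomp n x.
Proof. exact: (lift_scale (tcomp0_bilin n)). Qed.
Lemma tcomp0' n : tcomp n 0 = 0.
Proof. exact: (lift_zero (tcomp0_bilin n)). Qed.

Lemma tcomp_grading : is_grading tcomp.
Proof.
have tB n x y : tcomp n (x - y) = tcomp n x - tcomp n y.
  by rewrite tcompD -scaleN1r tcompZ scaleN1r.
split => // [i j x|x].
  elim/tens_hind: x => [|x x' hx hx'|u v a b ha hb].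
  - by rewrite !tcomp0' if_same.
  - by rewrite !tcompD hx hx'; case: eqP; rewrite ?addr0.
  rewrite (tcompE j ha hb); have [->|_] := eqVneq j (u + v).
    by rewrite (tcompE _ ha hb).
  by rewrite tcomp0' if_same.
apply: finc_fin; elim/tens_hind: x => [|x x' hx hx'|u v a b ha hb].
- exact: finc0.
- exact: fincD.
- by apply: (@finc_homog _ _ (u + v)) => l; rewrite (tcompE l ha hb).
Qed.

(* [d (a (x) b) = da (x) b + (-1)^|a| a (x) db] *)
Definition tdiff0 (a : A) (b : B) : T :=
  tens (dga_diff a) b + gsum cA (fun i a => ksign i (tens a (dga_diff b))) a.
Definition tdiff : T -> T := tens_lift tdiff0.

Lemma tdiff0_bilin : bilin tdiff0.
Proof.
split => [b|a] c x y; rewrite /tdiff0.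
  rewrite dga_diffD dga_diffZ tDl tZl gsumD // => [|i u v].
    rewrite gsumZ //; first by rewrite scalerDr addrACA.
    - exact: dga_compZ.
    - by move=> i u; rewrite tZl ksZ.
    - by move=> i; rewrite t0l ksign0.
  by rewrite tDl ksignD.
rewrite tDr tZr scalerDr -gsum_scale addrACA -gsum_add; congr (_ + _).
by apply: eq_bigr => i _; rewrite dga_diffD dga_diffZ tDr tZr ksignD ksZ.
Qed.

Lemma tdiffE i a b : of_deg cA i a ->
  tdiff (tens a b) = tens (dga_diff a) b + ksign i (tens a (dga_diff b)).
Proof.
move=> ha; rewrite /tdiff (tens_lift_tens _ _ tdiff0_bilin) /tdiff0.
by rewrite (gsum_homog gA _ ha) // => l; rewrite t0l ksign0.
Qed.

Lemma tdiffD x y : tdiff (x + y) = tdiff x + tdiff y.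
Proof. exact: (lift_add tdiff0_bilin). Qed.
Lemma tdiffZ c x : tdiff (c *: x) = c *: tdiff x.
Proof. exact: (lift_scale tdiff0_bilin). Qed.
Lemma tdiff_0 : tdiff 0 = 0.
Proof. exact: (lift_zero tdiff0_bilin). Qed.
Lemma tdiffK' i x : tdiff (ksign i x) = ksign i (tdiff x).
Proof. by rewrite /ksign; case: par; rewrite // -scaleN1r tdiffZ scaleN1r. Qed.

Lemma tens_deg i j a b : of_deg cA i a -> of_deg cB j b ->
  of_deg tcomp (i + j) (tens a b).
Proof. by move=> ha hb; rewrite /of_deg (tcompE _ ha hb) eqxx. Qed.

(* To check a property of the homogeneous elements of degree [n], it is enough
   to check it on pure tensors of that degree. *)
Lemma tens_deg_ind n (P : T -> Prop) : P 0 ->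
  (forall x y, P x -> P y -> P (x + y)) ->
  (forall i j a b, of_deg cA i a -> of_deg cB j b -> n = i + j -> P (tens a b)) ->
  forall x, of_deg tcomp n x -> P x.
Proof.
move=> P0 PD Ph x <-; elim/tens_hind: x => [|x x' hx hx'|i j a b ha hb].
- by rewrite tcomp0'.
- by rewrite tcompD; apply: PD.
by rewrite (tcompE n ha hb); case: eqP => // nij; apply: Ph ha hb nij.
Qed.

Lemma tmul_deg n m x y : of_deg tcomp n x -> of_deg tcomp m y ->
  of_deg tcomp (n + m) (tmul x y).
Proof.
have gT := tcomp_grading; move=> hx hy; move: x hx.
apply: tens_deg_ind => [|x x' hx hx'|i j a b ha hb ->].
- by rewrite tmul0l; apply: of_deg0.
- by rewrite tmulDl; apply: of_degD.
move: y hy; apply: tens_deg_ind => [|y y' hy hy'|i' j' a' b' ha' hb' ->].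
- by rewrite tmul0r; apply: of_deg0.
- by rewrite tmulDr; apply: of_degD.
rewrite (tmulE _ _ hb ha'); apply: of_deg_ksign => //; rewrite addrACA.
by apply: tens_deg; apply: dga_mul_deg.
Qed.

Lemma tdiff_deg n x : of_deg tcomp n x -> of_deg tcomp (n + 1) (tdiff x).
Proof.
have gT := tcomp_grading; move: x.
apply: tens_deg_ind => [|x x' hx hx'|i j a b ha hb ->].
- by rewrite tdiff_0; apply: of_deg0.
- by rewrite tdiffD; apply: of_degD.
rewrite (tdiffE _ ha); apply: of_degD => //.
  by rewrite addrAC; apply: tens_deg => //; apply: dga_diff_deg.
apply: of_deg_ksign => //.
by rewrite -addrA; apply: tens_deg => //; apply: dga_diff_deg.
Qed.

Lemma tdiffK x : tdiff (tdiff x) = 0.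
Proof.
elim/tens_hind: x => [|x x' hx hx'|i j a b ha hb].
- by rewrite !tdiff_0.
- by rewrite !tdiffD hx hx' addr0.
rewrite (tdiffE _ ha) tdiffD tdiffK' (tdiffE _ ha) (tdiffE _ (dga_diff_deg ha)).
rewrite !dga_diffK t0l t0r add0r ksign0 addr0 /ksign !parE.
by case: (par i); rewrite /= ?addNr ?subrr.
Qed.

Lemma tdiff_leibniz n x y : of_deg tcomp n x ->
  tdiff (tmul x y) = tmul (tdiff x) y + ksign n (tmul x (tdiff y)).
Proof.
move: x; apply: tens_deg_ind => [|x x' hx hx'|i j a b ha hb ->].
- by rewrite tdiff_0 !tmul0l tdiff_0 ksign0 addr0.
- by rewrite tdiffD !tmulDl tdiffD hx hx' ksignD addrACA.
elim/tens_hind: y => [|y y' hy hy'|i' j' a' b' ha' hb'].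
- by rewrite tdiff_0 !tmul0r tdiff_0 ksign0 addr0.
- by rewrite tdiffD !tmulDr tdiffD hy hy' ksignD addrACA.
have hda' := dga_diff_deg ha'; have hdb := dga_diff_deg hb.
rewrite (tmulE _ _ hb ha') tdiffK' (tdiffE _ (dga_mul_deg ha ha')).
rewrite (dga_leibniz _ ha) (dga_leibniz _ hb) (tdiffE _ ha) (tdiffE _ ha').
rewrite tmulDl tmulDr tmulKl tmulKr (tmulE _ _ hb ha') (tmulE _ _ hdb ha').
rewrite (tmulE _ _ hb hda') (tmulE _ _ hb ha') tDl tDr tKl tKr !ksignD.
set t1 := tens (dga_diff a * a') _; set t2 := tens (a * dga_diff a') _.
set t3 := tens _ (dga_diff b * b'); set t4 := tens _ (b * dga_diff b').
rewrite /ksign !parE.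
case: (par i); case: (par j); case: (par i'); case: (par j');
  by rewrite /= ?opprD ?opprK -!addrA; congr (_ + _); rewrite addrCA.
Qed.

Definition dga_tens : dgAlgebra k :=
  @DGAlgebra k tensAlgT tcomp tdiff tcomp_grading tcompZ tmul_deg tdiffD tdiffZ
    tdiff_deg tdiffK tdiff_leibniz.

End TensDGA.

(* Left DG modules. The vector space structure is the restriction of the action
   to [k -> A]; projections and differential are [k]-linear because [c%:A] is a
   cocycle of degree [0]. *)
Record dgModule (k : fieldType) (A : dgAlgebra k) := DGModule {
  dgm_mod :> lmodType A;
  dgm_comp : int -> dgm_mod -> dgm_mod;
  dgm_diff : dgm_mod -> dgm_mod;
  dgm_grading : is_grading dgm_comp;
  dgm_act_deg : forall i j (a : A) (m : dgm_mod), of_deg (@dga_comp k A) i a ->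
    of_deg dgm_comp j m -> of_deg dgm_comp (i + j) (a *: m);
  dgm_diffD : forall m n, dgm_diff (m + n) = dgm_diff m + dgm_diff n;
  dgm_diff_deg : forall i m, of_deg dgm_comp i m ->
    of_deg dgm_comp (i + 1) (dgm_diff m);
  dgm_diffK : forall m, dgm_diff (dgm_diff m) = 0;
  dgm_leibniz : forall i (a : A) m, of_deg (@dga_comp k A) i a ->
    dgm_diff (a *: m) = dga_diff a *: m + ksign i (a *: dgm_diff m) }.

Section DGModuleTheory.
Variables (k : fieldType) (A : dgAlgebra k) (M : dgModule A).

Lemma dgm_diff0 : dgm_diff (0 : M) = 0.
Proof. by apply: (addrI (dgm_diff (0 : M))); rewrite -dgm_diffD !addr0. Qed.
Lemma dgm_diffN (m : M) : dgm_diff (- m) = - dgm_diff m.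
Proof. by apply: (addrI (dgm_diff m)); rewrite -dgm_diffD !subrr dgm_diff0. Qed.
Lemma dgm_diff_ksign i (m : M) : dgm_diff (ksign i m) = ksign i (dgm_diff m).
Proof. by rewrite /ksign; case: par; rewrite ?dgm_diffN. Qed.
Lemma dgm_diff_sum (I : Type) (s : seq I) (G : I -> M) :
  dgm_diff (\sum_(j <- s) G j) = \sum_(j <- s) dgm_diff (G j).
Proof. by elim/big_rec2: _ => [|j y z _ <-]; rewrite ?dgm_diff0 ?dgm_diffD. Qed.
End DGModuleTheory.

Section Suspension.
Variables (k : fieldType) (A : dgAlgebra k) (j : int) (M : dgModule A).
Notation cA := (@dga_comp k A).
Let gA := dga_grading A.
Let gM := dgm_grading M.

Definition suspT : Type := M.
HB.instance Definition _ := GRing.Zmodule.on suspT.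

(* [a . m = (-1)^(j|a|) a m] *)
Definition susp_scale (a : A) (m : M) : M :=
  gsum cA (fun i a => ksign (j * i) (a *: m)) a.

Lemma susp_scaleE i a m : of_deg cA i a ->
  susp_scale a m = ksign (j * i) (a *: m).
Proof.
by move=> ha; apply: (gsum_homog gA) => // l; rewrite scale0r ksign0.
Qed.
Lemma susp_scaleDl m : {morph susp_scale^~ m : a b / a + b}.
Proof.
by move=> a b; apply: (gsumD gA) => i u v; rewrite scalerDl ksignD.
Qed.
Lemma susp_scaleDr : right_distributive susp_scale +%R.
Proof.
move=> a m n; rewrite -gsum_add; apply: eq_bigr => i _.
by rewrite scalerDr ksignD.
Qed.
Lemma susp_scale0l m : susp_scale 0 m = 0.
Proof. by apply: (addrI (susp_scale 0 m)); rewrite -susp_scaleDl !addr0. Qed.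
Lemma susp_scale0r a : susp_scale a 0 = 0.
Proof. by apply: (addrI (susp_scale a 0)); rewrite -susp_scaleDr !addr0. Qed.
Lemma susp_scale1 : left_id 1 susp_scale.
Proof.
by move=> m; rewrite (susp_scaleE _ (dga_one_deg A)) scale1r /ksign mulr0.
Qed.
Lemma susp_scaleA a b m : susp_scale a (susp_scale b m) = susp_scale (a * b) m.
Proof.
elim/(gr_ind gA): a => [|x y hx hy|i a ha].
- by rewrite mul0r !susp_scale0l.
- by rewrite mulrDl !susp_scaleDl hx hy.
elim/(gr_ind gA): b => [|x y hx hy|l b hb].
- by rewrite mulr0 !susp_scale0l susp_scale0r.
- by rewrite mulrDr !susp_scaleDl susp_scaleDr hx hy.
rewrite (susp_scaleE _ ha) (susp_scaleE _ hb).
rewrite (susp_scaleE _ (dga_mul_deg ha hb)) ksign_scale scalerA /ksign !parE.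
by case: (par i); case: (par j); case: (par l); rewrite //= ?opprK.
Qed.
HB.instance Definition _ := GRing.Zmodule_isLmodule.Build A suspT
  susp_scaleA susp_scale1 susp_scaleDr susp_scaleDl.

Definition susp_comp (i : int) (m : M) : M := dgm_comp (i + j) m.
Definition susp_diff (m : M) : M := ksign j (dgm_diff m).

Lemma susp_grading : is_grading susp_comp.
Proof.
split=> [i x y|i l x|x]; first exact: (gr_sub gM).
  by rewrite /susp_comp (gr_proj gM) (inj_eq (addIr j)).
have [s [us xs]] := gr_fin gM x; exists [seq i - j | i <- s]; split.
  by rewrite map_inj_uniq // => a b /addIr.
rewrite big_map [LHS]xs; apply: eq_bigr => i _; by rewrite /susp_comp subrK.
Qed.
Lemma susp_act_deg i l (a : A) (m : M) : of_deg cA i a ->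
  of_deg susp_comp l m -> of_deg susp_comp (i + l) (susp_scale a m).
Proof.
move=> ha hm; rewrite (susp_scaleE _ ha); apply: (of_deg_ksign susp_grading).
by rewrite /of_deg /susp_comp -addrA; apply: dgm_act_deg.
Qed.
Lemma susp_diffD m n : susp_diff (m + n) = susp_diff m + susp_diff n.
Proof. by rewrite /susp_diff dgm_diffD ksignD. Qed.
Lemma susp_diff_deg i m : of_deg susp_comp i m ->
  of_deg susp_comp (i + 1) (susp_diff m).
Proof.
move=> hm; apply: (of_deg_ksign susp_grading).
by rewrite /of_deg /susp_comp addrAC; apply: dgm_diff_deg.
Qed.
Lemma susp_diffK m : susp_diff (susp_diff m) = 0.
Proof. by rewrite /susp_diff dgm_diff_ksign dgm_diffK !ksign0. Qed.
Lemma susp_leibniz i a m : of_deg cA i a ->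
  susp_diff (susp_scale a m)
  = susp_scale (dga_diff a) m + ksign i (susp_scale a (susp_diff m)).
Proof.
move=> ha; rewrite !(susp_scaleE _ ha) (susp_scaleE _ (dga_diff_deg ha)).
rewrite /susp_diff dgm_diff_ksign (dgm_leibniz _ ha) !ksignD !ksign_scale.
rewrite /ksign !parE.
by case: (par i); case: (par j); rewrite //= ?opprK.
Qed.

(* [Sigma^j M] *)
Definition susp : dgModule A :=
  @DGModule k A suspT susp_comp susp_diff susp_grading susp_act_deg susp_diffD
    susp_diff_deg susp_diffK susp_leibniz.
End Suspension.

Section Regular.
Variables (k : fieldType) (A : dgAlgebra k).
Definition dga_reg : dgModule A :=
  @DGModule k A A^o (@dga_comp k A) (@dga_diff k A) (dga_grading A)
    (@dga_mul_deg k A) (@dga_diffD k A) (@dga_diff_deg k A) (@dga_diffK k A)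
    (@dga_leibniz k A).
End Regular.

Section Trivial.
Variables (k : fieldType) (A : connDGAlgebra k).
Notation cA := (@dga_comp k A).

Definition trivT : Type := k.
HB.instance Definition _ := GRing.Zmodule.on trivT.

Definition triv_scale (a : A) (c : k) : k := cdga_aug a * c.
Lemma triv_scaleA a b c : triv_scale a (triv_scale b c) = triv_scale (a * b) c.
Proof. by rewrite /triv_scale augM mulrA. Qed.
Lemma triv_scale1 : left_id 1 triv_scale.
Proof. by move=> c; rewrite /triv_scale aug1 mul1r. Qed.
Lemma triv_scaleDr : right_distributive triv_scale +%R.
Proof. by move=> a c d; rewrite /triv_scale mulrDr. Qed.
Lemma triv_scaleDl c : {morph triv_scale^~ c : a b / a + b}.
Proof. by move=> a b; rewrite /triv_scale augD mulrDl. Qed.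
HB.instance Definition _ := GRing.Zmodule_isLmodule.Build A trivT
  triv_scaleA triv_scale1 triv_scaleDr triv_scaleDl.

Definition triv_comp (i : int) (c : k) : k := if i == 0 then c else 0.
Definition triv_diff (c : k) : k := 0.

Lemma triv_grading : is_grading triv_comp.
Proof.
rewrite /triv_comp; split=> [i x y|i j x|x].
- by case: ifP; rewrite ?subrr.
- have [->|j0] := eqVneq j 0; last by rewrite !if_same.
  by [].  
- by exists [:: 0]; rewrite big_seq1.
Qed.
Lemma triv_act_deg i j a c : of_deg cA i a -> of_deg triv_comp j c ->
  of_deg triv_comp (i + j) (triv_scale a c).
Proof.
rewrite /of_deg /triv_comp => ha; have [->|j0] := eqVneq j 0; last first.
  by move=> <-; rewrite /triv_scale mulr0 if_same.
move=> _; rewrite addr0; have [//|i0] := eqVneq i 0.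
by rewrite /triv_scale (aug_deg ha i0) mul0r.
Qed.
Lemma triv_leibniz i a c : of_deg cA i a ->
  triv_diff (triv_scale a c)
  = triv_scale (dga_diff a) c + ksign i (triv_scale a (triv_diff c)).
Proof.
move=> ha; rewrite /triv_diff /triv_scale mulr0 ksign0 addr0.
have [i1|i1] := eqVneq (i + 1) 0; last by rewrite (aug_deg (dga_diff_deg ha) i1) mul0r.
have i0 : (i < 0)%R by move/eqP: i1; rewrite addr_eq0 => /eqP->.
by rewrite -ha (cdga_neg _ i0) dga_diff0 aug0 mul0r.
Qed.
Lemma triv_diffD c d : triv_diff (c + d) = triv_diff c + triv_diff d.
Proof. by rewrite /triv_diff addr0. Qed.
Lemma triv_diff_deg i c : of_deg triv_comp i c ->
  of_deg triv_comp (i + 1) (triv_diff c).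
Proof. by move=> _; rewrite /of_deg /triv_comp /triv_diff if_same. Qed.
Lemma triv_diffK c : triv_diff (triv_diff c) = 0. Proof. by []. Qed.

(* [k = A / m_A] *)
Definition dg_triv : dgModule A :=
  @DGModule k A trivT triv_comp triv_diff triv_grading triv_act_deg triv_diffD
    triv_diff_deg triv_diffK triv_leibniz.
End Trivial.

Section Hom.
Variables (k : fieldType) (A : dgAlgebra k).
Notation cA := (@dga_comp k A).

(* [f] belongs to [Hom_A(M, N)^p]. *)
Record graded_hom (M N : dgModule A) (p : int) (f : M -> N) : Prop := GradedHom {
  ghD : forall x y, f (x + y) = f x + f y;
  gh_deg : forall i x, of_deg (@dgm_comp k A M) i x ->
    of_deg (@dgm_comp k A N) (i + p) (f x);
  ghZ : forall i a x, of_deg cA i a -> f (a *: x) = ksign (p * i) (a *: f x) }.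

Definition dg_hom (M N : dgModule A) (f : M -> N) : Prop :=
  graded_hom 0 f /\ forall x, f (dgm_diff x) = dgm_diff (f x).

Definition homotopic (M N : dgModule A) (f g : M -> N) : Prop :=
  exists2 h : M -> N, graded_hom (-1) h &
    forall x, f x - g x = dgm_diff (h x) + h (dgm_diff x).

Definition quasi_iso (M N : dgModule A) (f : M -> N) : Prop :=
  [/\ dg_hom f,
      forall x, dgm_diff x = 0 -> (exists y, f x = dgm_diff y) ->
        exists z, x = dgm_diff z &
      forall y, dgm_diff y = 0 ->
        exists2 x, dgm_diff x = 0 & exists z, y = f x + dgm_diff z].

(* [dim_k H(M) = n] *)
Definition cohom_dim (M : dgModule A) (n : nat) : Prop :=
  exists z : 'I_n -> M, (forall i, dgm_diff (z i) = 0) /\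
    forall x : M, dgm_diff x = 0 -> exists! c : 'rV[k]_n,
      exists y, x = \sum_i ((c 0 i)%:A : A) *: z i + dgm_diff y.

End Hom.

Section Dual.
Variables (k : fieldType) (A : dgAlgebra k) (M : dgModule A).
Notation cA := (@dga_comp k A).
Notation cM := (@dgm_comp k A M).
Notation cR := (@dgm_comp k A (dga_reg A)).
Let gA := dga_grading A.
Let gM := dgm_grading M.
Let gR := dgm_grading (dga_reg A).
Notation ghom := (@graded_hom k A M (dga_reg A)).

(* [Hom_A(M, A)] is the direct sum of its graded pieces: its elements are the
   finite sums of homogeneous maps. *)
Definition fin_hom (f : M -> dga_reg A) : Prop :=
  exists (s : seq int) (g : int -> M -> dga_reg A),
    (forall i, ghom i (g i)) /\ f = \sum_(i <- s) g i.

Definition fin_homb : {pred M -> dga_reg A} := fun f => `[< fin_hom f >].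

Lemma ghom0 p : ghom p (0 : M -> dga_reg A).
Proof.
split=> [x y|i x _|i a x _] /=; first by rewrite addr0.
  exact: of_deg0.
by rewrite scaler0 ksign0.
Qed.
Lemma ghomD p f g : ghom p f -> ghom p g -> ghom p (f + g).
Proof.
move=> [fD fd fZ] [gD gd gZ]; split=> [x y|i x hx|i a x ha].
- by rewrite /= !fctE fD gD addrACA.
- by apply: of_degD => //; [apply: fd|apply: gd].
- by rewrite !fctE (fZ _ _ _ ha) (gZ _ _ _ ha) scalerDr ksignD.
Qed.
Lemma ghomN p f : ghom p f -> ghom p (- f).
Proof.
move=> [fD fd fZ]; split=> [x y|i x hx|i a x ha].
- by rewrite /= !fctE fD opprD.
- by apply: of_degN => //; apply: fd.
- by rewrite !fctE (fZ _ _ _ ha) scalerN ksignN.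
Qed.

Lemma fin_hom_ghom p f : ghom p f -> fin_hom f.
Proof.
move=> hf; exists [:: p], (fun i => if i == p then f else 0); split.
  by move=> i; case: eqP => [->|_] //; apply: ghom0.
by rewrite big_seq1 eqxx.
Qed.
Lemma fin_hom0 : fin_hom 0. Proof. exact: fin_hom_ghom (ghom0 0). Qed.
Lemma fin_homD f g : fin_hom f -> fin_hom g -> fin_hom (f + g).
Proof.
have norm h : fin_hom h -> exists s g, [/\ uniq s, forall i, ghom i (g i),
    forall i, i \notin s -> g i = 0 & h = \sum_(i <- s) g i].
  move=> [s [u [hu ->]]]; exists (undup s), (fun i => u i *+ count_mem i s).
  split=> [|i|i|]; first exact: undup_uniq.
  - elim: (count_mem i s) => [|n IH]; first by rewrite mulr0n; apply: ghom0.
    by rewrite mulrS; apply: ghomD.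
  - by rewrite mem_undup => /count_memPn->; rewrite mulr0n.
  - rewrite -[LHS]big_undup_iterop_count; apply: eq_bigr => i _; by rewrite Monoid.iteropE iter_addr_0.
move=> /norm[s [u [us hu u0 ->]]] /norm[t [v [ut hv v0 ->]]].
exists (undup (s ++ t)), (fun i => u i + v i); split.
  by move=> i; apply: ghomD.
rewrite big_split; congr (_ + _); apply: big_supset; rewrite ?undup_uniq //.
- by move=> i; rewrite mem_undup mem_cat => ->.
- by move=> i _; apply: u0.
- by move=> i; rewrite mem_undup mem_cat orbC => ->.
- by move=> i _; apply: v0.
Qed.
Lemma fin_homN f : fin_hom f -> fin_hom (- f).
Proof.
move=> [s [g [hg ->]]]; exists s, (fun i => - g i); split.
  by move=> i; apply: ghomN.
by rewrite sumrN.
Qed.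

Lemma fin_homb_zmod : zmod_closed fin_homb.
Proof.
split; first by apply/asboolP; apply: fin_hom0.
move=> f g /asboolP hf /asboolP hg; apply/asboolP.
by apply: fin_homD => //; apply: fin_homN.
Qed.
HB.instance Definition _ := GRing.isZmodClosed.Build _ fin_homb fin_homb_zmod.

Record dualT : Type := DualT { dual_fun :> M -> dga_reg A; _ : dual_fun \in fin_homb }.
HB.instance Definition _ := [isSub for dual_fun].
HB.instance Definition _ := [Choice of dualT by <:].
HB.instance Definition _ := [SubChoice_isSubZmodule of dualT by <:].

Definition mk_dual (f : M -> dga_reg A) (hf : fin_hom f) : dualT :=
  DualT (asboolT hf : f \in fin_homb).

Lemma dualP (f : dualT) : fin_hom f.
Proof. by case: f => f /= /asboolP. Qed.
Lemma dual_ext (f g : dualT) : (forall x, f x = g x) -> f = g.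
Proof. by move=> h; apply: val_inj; apply/funext. Qed.
Lemma dualDE (f g : dualT) x : (f + g) x = f x + g x. Proof. by []. Qed.
Lemma dualBE (f g : dualT) x : (f - g) x = f x - g x. Proof. by []. Qed.
Lemma dual0E x : (0 : dualT) x = 0. Proof. by []. Qed.
Lemma dualNE (f : dualT) x : (- f) x = - f x. Proof. by []. Qed.
Lemma dual_sumE (I : Type) (s : seq I) (G : I -> dualT) x :
  (\sum_(i <- s) G i) x = \sum_(i <- s) G i x.
Proof.
by elim: s => [|i s IH]; [rewrite !big_nil|rewrite !big_cons dualDE IH].
Qed.

Lemma dual_ind (P : dualT -> Prop) : P 0 -> (forall f g, P f -> P g -> P (f + g)) ->
  (forall p (f : dualT), ghom p f -> P f) -> forall f, P f.
Proof.
move=> P0 PD Ph f; have [s [g [hg fE]]] := dualP f.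
have -> : f = \sum_(i <- s) mk_dual (fin_hom_ghom (hg i)).
  apply: dual_ext => x; rewrite dual_sumE fE; elim: s {fE} => [|i s IH].
    by rewrite !big_nil.
  by rewrite !big_cons -IH.
by elim/big_ind: _ => // i _; apply: (Ph i).
Qed.

Lemma dualD (f : dualT) x y : f (x + y) = f x + f y.
Proof.
elim/dual_ind: f => [|f g hf hg|p f hf].
- by rewrite !dual0E addr0.
- by rewrite !dualDE hf hg addrACA.
- exact: ghD hf _ _.
Qed.
Lemma dual0 (f : dualT) : f 0 = 0.
Proof. by apply: (addrI (f 0)); rewrite -dualD !addr0. Qed.

(* [(b f)(x) = b . f(x)], the product being that of the opposite algebra;
   equivalently the right action [(f b)(x) = (-1)^(|b||x|) f(x) b]. *)
Definition dual_scale_fun (b : A) (f : M -> dga_reg A) (x : M) : dga_reg A :=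
  opmul b (f x).

Lemma opmul_mul j i (b a c : A) : of_deg cA j b -> of_deg cA i a ->
  opmul b (a * c) = ksign (j * i) (a * opmul b c).
Proof.
move=> hb ha; elim/(gr_ind gA): c => [|x y hx hy|l c hc].
- by rewrite mulr0 opmul0r mulr0 ksign0.
- by rewrite mulrDr !opmulDr mulrDr ksignD hx hy.
rewrite (opmulE hb (dga_mul_deg ha hc)) (opmulE hb hc) ksign_mulr mulrA.
rewrite /ksign !parE.
by case: (par i); case: (par j); case: (par l); rewrite //= ?opprK.
Qed.

Lemma opmul_ksign u (b a : A) : opmul b (ksign u a) = ksign u (opmul b a).
Proof.
rewrite /ksign; case: par => //.
by apply: (addrI (opmul b a)); rewrite -opmulDr !subrr opmul0r.
Qed.

Lemma dual_scale_ghom j p (b : A) (f : M -> dga_reg A) : of_deg cA j b ->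
  ghom p f -> ghom (j + p) (dual_scale_fun b f).
Proof.
move=> hb [fD fd fZ]; rewrite /dual_scale_fun; split=> [x y|i x hx|i a x ha].
- by rewrite fD opmulDr.
- by rewrite addrCA; apply: (opmul_deg hb); apply: fd.
rewrite (fZ _ _ _ ha) opmul_ksign (opmul_mul _ hb ha) [in RHS]mulrDl.
by rewrite [in RHS]/GRing.scale /= /ksign !parE; case: (par i); case: (par j);
  case: (par p); rewrite //= ?opprK.
Qed.

Lemma dual_scale_fin (b : A) (f : dualT) :
  fin_hom (dual_scale_fun b f).
Proof.
elim/(gr_ind gA): b => [|x y hx hy|j b hb].
- have -> : dual_scale_fun 0 f = 0 by apply/funext => x; apply: opmul0l.
  exact: fin_hom0.
- have -> : dual_scale_fun (x + y) f = dual_scale_fun x f + dual_scale_fun y f.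
    by apply/funext => z; apply: opmulDl.
  exact: fin_homD.
elim/dual_ind: f => [|f g hf hg|p f hf].
- have -> : dual_scale_fun b (0 : dualT) = 0 by apply/funext => x; apply: opmul0r.
  exact: fin_hom0.
- have -> : dual_scale_fun b (f + g : dualT) = (dual_scale_fun b f) + dual_scale_fun b g.
    apply/funext => z; rewrite fctE /dual_scale_fun dualDE; exact: opmulDr.
  exact: fin_homD.
exact: fin_hom_ghom (dual_scale_ghom hb hf).
Qed.
Definition dual_scale (b : dga_op A) (f : dualT) : dualT :=
  mk_dual (dual_scale_fin b f).

Lemma dual_scaleA b c f : dual_scale b (dual_scale c f) = dual_scale (b * c) f.
Proof. by apply: dual_ext => x; apply: opmulA. Qed.
Lemma dual_scale1 : left_id 1 dual_scale.
Proof. by move=> f; apply: dual_ext => x; apply: opmul1l. Qed.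
Lemma dual_scaleDr : right_distributive dual_scale +%R.
Proof.
move=> b f g; apply: dual_ext => x; rewrite dualDE.
exact: (@opmulDr k A b (f x) (g x)).
Qed.
Lemma dual_scaleDl f : {morph dual_scale^~ f : b c / b + c}.
Proof. by move=> b c; apply: dual_ext => x; apply: opmulDl. Qed.
HB.instance Definition _ := GRing.Zmodule_isLmodule.Build (dga_op A) dualT
  dual_scaleA dual_scale1 dual_scaleDr dual_scaleDl.

(* The component of degree [p] of [f] sends a homogeneous [x] to [f(x)_(|x|+p)]. *)
Definition dual_comp_fun (p : int) (f : M -> dga_reg A) (x : M) : dga_reg A :=
  gsum cM (fun i x => cR (i + p) (f x)) x.

Lemma dual_comp_ghom p q (f : dualT) : ghom q f ->
  dual_comp_fun p f = if p == q then (f : M -> dga_reg A) else 0.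
Proof.
move=> hf; apply/funext => x; rewrite /dual_comp_fun.
have fE i y : of_deg cM i y -> cR (i + p) (f y) = if p == q then f y else 0.
  by move=> hy; rewrite (of_degP gR _ (gh_deg hf hy)) (inj_eq (addrI i)).
have -> : gsum cM (fun i x => cR (i + p) (f x)) x =
          gsum cM (fun i x => if p == q then f x else 0) x.
  by apply: eq_gsum.
case: eqP => _; last by rewrite /gsum big1.
rewrite [in RHS](suppP gM x).2 /gsum.
by elim/big_rec2: _ => [|i y z _ ->]; rewrite ?dual0 ?dualD.
Qed.

Lemma dual_comp_funD p (f g : dualT) :
  dual_comp_fun p (f + g : dualT) = dual_comp_fun p f + dual_comp_fun p g.
Proof.
apply/funext => x; rewrite /dual_comp_fun fctE -gsum_add.
by apply: eq_bigr => i _; rewrite dualDE (grD gR).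
Qed.
Lemma dual_comp_fun0 p : dual_comp_fun p (0 : dualT) = 0.
Proof.
by apply/funext => x; rewrite /dual_comp_fun /gsum big1 // => i _; apply: gr0.
Qed.

Lemma dual_comp_fin p (f : dualT) :
  fin_hom (dual_comp_fun p f).
Proof.
elim/dual_ind: f => [|f g hf hg|q f hf].
- by rewrite dual_comp_fun0; apply: fin_hom0.
- by rewrite dual_comp_funD; apply: fin_homD.
rewrite (dual_comp_ghom _ hf); case: eqP => _; last exact: fin_hom0.
exact: dualP.
Qed.
Definition dual_comp (p : int) (f : dualT) : dualT := mk_dual (dual_comp_fin p f).

Lemma dual_compD p f g : dual_comp p (f + g) = dual_comp p f + dual_comp p g.
Proof. by apply: val_inj; apply: dual_comp_funD. Qed.
Lemma dual_comp0 p : dual_comp p 0 = 0.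
Proof. by apply: val_inj; apply: dual_comp_fun0. Qed.
Lemma dual_compE p q (f : dualT) : ghom q f ->
  dual_comp p f = if p == q then f else 0.
Proof.
by move=> hf; apply: val_inj; rewrite /= (dual_comp_ghom _ hf); case: eqP.
Qed.

Lemma dual_grading : is_grading dual_comp.
Proof.
have cN p f : dual_comp p (- f) = - dual_comp p f.
  by apply: (addrI (dual_comp p f)); rewrite -dual_compD !subrr dual_comp0.
have cB p f g : dual_comp p (f - g) = dual_comp p f - dual_comp p g.
  by rewrite dual_compD cN.
split=> // [p q f|f].
  elim/dual_ind: f => [|f g hf hg|r f hf].
  - by rewrite !dual_comp0 if_same.
  - by rewrite !dual_compD hf hg; case: eqP; rewrite ?addr0.
  rewrite (dual_compE q hf); have [->|_] := eqVneq q r.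
    by rewrite (dual_compE p hf).
  by rewrite dual_comp0 if_same.
apply: finc_fin; elim/dual_ind: f => [|f g hf hg|r f hf].
- exact: finc0.
- exact: fincD.
- by apply: (@finc_homog _ _ r) => l; apply: dual_compE.
Qed.

Lemma dual_deg p (f : dualT) : of_deg dual_comp p f <-> ghom p f.
Proof.
split=> [<-|hf]; last by rewrite /of_deg (dual_compE _ hf) eqxx.
elim/dual_ind: f => [|f g hf hg|r f hf].
- by rewrite dual_comp0; apply: ghom0.
- by rewrite dual_compD; exact: (ghomD hf hg).
by rewrite (dual_compE _ hf); case: eqP => [->|_] //; apply: ghom0.
Qed.

(* [d(f) = d_A f - (-1)^|f| f d_M] *)
Definition dual_diff_fun (f : dualT) (x : M) : dga_reg A :=
  dgm_diff (f x) - gsum dual_comp (fun p g => ksign p (g (dgm_diff x))) f.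

Lemma dual_diffE p (f : dualT) x : ghom p f ->
  dual_diff_fun f x = dgm_diff (f x) - ksign p (f (dgm_diff x)).
Proof.
move=> hf; rewrite /dual_diff_fun (gsum_homog dual_grading _ (i := p)) //.
  by move=> i; rewrite ksign0.
exact/dual_deg.
Qed.
Lemma dual_diff_funD (f g : dualT) :
  dual_diff_fun (f + g) = dual_diff_fun f + dual_diff_fun g.
Proof.
apply/funext => x; rewrite fctE /dual_diff_fun (gsumD dual_grading).
  by rewrite dgm_diffD opprD addrACA.
by move=> i u v; rewrite dualDE ksignD.
Qed.
Lemma dual_diff_fun0 : dual_diff_fun 0 = 0.
Proof.
by apply: (addrI (dual_diff_fun 0)); rewrite -dual_diff_funD !addr0.
Qed.

Lemma ghom_ksign p (f : dualT) u y : ghom p f -> f (ksign u y) = ksign u (f y).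
Proof.
move=> hf; rewrite /ksign; case: par => //.
by apply: (addrI (f y)); rewrite -dualD !subrr dual0.
Qed.

Lemma dual_diff_ghom p (f : dualT) : ghom p f -> ghom (p + 1) (dual_diff_fun f).
Proof.
move=> hf; have [fD fd fZ] := hf; split=> [x y|i x hx|i a x ha].
- rewrite !(dual_diffE _ hf) dgm_diffD !fD dgm_diffD ksignD opprD; exact: addrACA.
- rewrite (dual_diffE _ hf); apply: (of_degD gA).
    by rewrite addrA; apply: dga_diff_deg; apply: fd.
  apply: (of_degN gA); apply: (of_deg_ksign gA).
  by rewrite addrCA addrC; apply: fd; apply: dgm_diff_deg.
rewrite !(dual_diffE _ hf) (dgm_leibniz _ ha) fD (fZ _ _ _ ha).
rewrite (ghom_ksign _ _ hf) (fZ _ _ _ ha) (fZ _ _ _ (dga_diff_deg ha)).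
rewrite dgm_diff_ksign (dgm_leibniz _ ha) scalerBr ksign_scale.
move: (dga_diff a *: f x) (a *: dgm_diff (f x)) (a *: f (dgm_diff x)) => t1 t2 t3.
rewrite /ksign !parE; case: (par i); case: (par p);
  by rewrite /= ?opprD ?opprK // addrACA ?addNr ?subrr add0r.
Qed.

Lemma dual_diff_fin (f : dualT) : fin_hom (dual_diff_fun f).
Proof.
elim/dual_ind: f => [|f g hf hg|q f hf].
- by rewrite dual_diff_fun0; apply: fin_hom0.
- by rewrite dual_diff_funD; apply: fin_homD.
exact: fin_hom_ghom (dual_diff_ghom hf).
Qed.
Definition dual_diff (f : dualT) : dualT := mk_dual (dual_diff_fin f).

Lemma dual_diffD f g : dual_diff (f + g) = dual_diff f + dual_diff g.
Proof. by apply: val_inj; apply: dual_diff_funD. Qed.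
Lemma dual_diff0 : dual_diff 0 = 0.
Proof. by apply: val_inj; apply: dual_diff_fun0. Qed.

Lemma dual_diff_deg p f : of_deg dual_comp p f ->
  of_deg dual_comp (p + 1) (dual_diff f).
Proof. by move=> /dual_deg hf; apply/dual_deg; apply: dual_diff_ghom. Qed.

Lemma dual_diffK f : dual_diff (dual_diff f) = 0.
Proof.
elim/dual_ind: f => [|f g hf hg|p f hf].
- by rewrite !dual_diff0.
- by rewrite !dual_diffD hf hg addr0.
apply: dual_ext => x.
rewrite [LHS](@dual_diffE (p + 1) (dual_diff f)); last exact: dual_diff_ghom.
have E y : dual_diff f y = dgm_diff (f y) - ksign p (f (dgm_diff y)).
  exact: dual_diffE.
rewrite !E !dgm_diffK dual0 ksign0 subr0.
rewrite dgm_diffD dgm_diffK dgm_diffN dgm_diff_ksign add0r.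
by rewrite /ksign !parE; case: (par p); rewrite /= ?opprK ?addNr ?subrr.
Qed.

Lemma dual_act_deg i p (b : dga_op A) (f : dualT) :
  of_deg (@dga_comp k (dga_op A)) i b ->
  of_deg dual_comp p f -> of_deg dual_comp (i + p) (b *: f).
Proof. by move=> hb /dual_deg hf; apply/dual_deg; apply: dual_scale_ghom. Qed.

Lemma dual_leibniz i (b : dga_op A) (f : dualT) :
  of_deg (@dga_comp k (dga_op A)) i b ->
  dual_diff (b *: f) = dga_diff b *: f + ksign i (b *: dual_diff f).
Proof.
move=> hb; elim/dual_ind: f => [|f g hf hg|p f hf].
- by rewrite dual_diff0 !scaler0 dual_diff0 ksign0 addr0.
- by rewrite dual_diffD !scalerDr dual_diffD hf hg ksignD addrACA.
apply: dual_ext => x; have hbf := dual_scale_ghom hb hf.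
rewrite [LHS](@dual_diffE (i + p) (b *: f)) // dualDE.
have -> : ksign i (b *: dual_diff f) x = ksign i (@opmul k A b (dual_diff f x)).
  by rewrite /ksign; case: par.
have -> : dual_diff f x = dgm_diff (f x) - ksign p (f (dgm_diff x)).
  exact: dual_diffE.
have -> : @opmul k A b (dgm_diff (f x) - ksign p (f (dgm_diff x))) =
   @opmul k A b (dgm_diff (f x)) - ksign p (@opmul k A b (f (dgm_diff x))).
  have <- := @opmul_ksign p b (f (dgm_diff x)).
  by rewrite -[- ksign p _]/(ksign 1 _) -[- opmul _ _]/(ksign 1 _) -opmul_ksign opmulDr.
rewrite [dgm_diff ((b *: f) x)](@op_leibniz k A _ _ _ hb) ksignB -addrA; congr (_ + (_ + _)).
by rewrite /ksign !parE; case: (par i); case: (par p); rewrite /= ?opprK.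
Qed.

(* [Hom_A(M, A)] as a DG module over [A^op], that is, a right DG [A]-module. *)
Definition dg_dual : dgModule (dga_op A) :=
  @DGModule k (dga_op A) dualT dual_comp dual_diff dual_grading dual_act_deg
    dual_diffD dual_diff_deg dual_diffK dual_leibniz.
End Dual.

Section DirectSum.
Variables (k : fieldType) (A : dgAlgebra k) (I : choiceType) (N : I -> dgModule A).

Definition dprodT : Type := forall i, N i.
HB.instance Definition _ := Choice.on dprodT.
Definition dprod_add (f g : dprodT) : dprodT := fun i => f i + g i.
Definition dprod_opp (f : dprodT) : dprodT := fun i => - f i.
Definition dprod_zero : dprodT := fun i => 0.
Lemma dprod_ext (f g : dprodT) : (forall i, f i = g i) -> f = g.
Proof. by move=> h; apply: functional_extensionality_dep. Qed.
Lemma dprod_addA : associative dprod_add.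
Proof. by move=> f g h; apply: dprod_ext => i; apply: addrA. Qed.
Lemma dprod_addC : commutative dprod_add.
Proof. by move=> f g; apply: dprod_ext => i; apply: addrC. Qed.
Lemma dprod_add0 : left_id dprod_zero dprod_add.
Proof. by move=> f; apply: dprod_ext => i; apply: add0r. Qed.
Lemma dprod_addN : left_inverse dprod_zero dprod_opp dprod_add.
Proof. by move=> f; apply: dprod_ext => i; apply: addNr. Qed.
HB.instance Definition _ :=
  GRing.isZmodule.Build dprodT dprod_addA dprod_addC dprod_add0 dprod_addN.

Definition fin_supp (f : dprodT) : Prop :=
  exists s : seq I, forall i, i \notin s -> f i = 0.
Definition fin_suppb : {pred dprodT} := fun f => `[< fin_supp f >].
Lemma fin_suppb_zmod : zmod_closed fin_suppb.
Proof.
split; first by apply/asboolP; exists [::].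
move=> f g /asboolP[s hs] /asboolP[t ht]; apply/asboolP; exists (s ++ t) => i.
rewrite mem_cat negb_or => /andP[/hs fi /ht gi].
by rewrite -[LHS]/(f i - g i) fi gi subrr.
Qed.
HB.instance Definition _ := GRing.isZmodClosed.Build _ fin_suppb fin_suppb_zmod.

Record dsumT : Type := DsumT { dsum_fun : dprodT; _ : dsum_fun \in fin_suppb }.
HB.instance Definition _ := [isSub for dsum_fun].
HB.instance Definition _ := [Choice of dsumT by <:].
HB.instance Definition _ := [SubChoice_isSubZmodule of dsumT by <:].

Definition mk_dsum (f : dprodT) (hf : fin_supp f) : dsumT :=
  DsumT (asboolT hf : f \in fin_suppb).
Lemma dsumP (x : dsumT) : fin_supp (dsum_fun x).
Proof. by case: x => f /= /asboolP. Qed.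
Lemma dsum_ext (x y : dsumT) : (forall i, dsum_fun x i = dsum_fun y i) -> x = y.
Proof. by move=> h; apply: val_inj; apply: dprod_ext. Qed.
Lemma dsumDE (x y : dsumT) i : dsum_fun (x + y) i = dsum_fun x i + dsum_fun y i.
Proof. by []. Qed.
Lemma dsumNE (x : dsumT) i : dsum_fun (- x) i = - dsum_fun x i.
Proof. by []. Qed.
Lemma dsum0E i : dsum_fun (0 : dsumT) i = 0.
Proof. by []. Qed.
Lemma dsum_sumE (J : Type) (s : seq J) (G : J -> dsumT) i :
  dsum_fun (\sum_(j <- s) G j) i = \sum_(j <- s) dsum_fun (G j) i.
Proof. by elim: s => [|j s IH]; [rewrite !big_nil|rewrite !big_cons dsumDE IH]. Qed.

Lemma dsum_map_fin (g : forall i, N i -> N i) (x : dsumT) : (forall i, g i 0 = 0) ->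
  fin_supp (fun i => g i (dsum_fun x i)).
Proof. by move=> g0; have [s hs] := dsumP x; exists s => i /hs->. Qed.

Definition dsum_map (g : forall i, N i -> N i) (g0 : forall i, g i 0 = 0)
  (x : dsumT) : dsumT := mk_dsum (dsum_map_fin x g0).

Definition dsum_scale (a : A) : dsumT -> dsumT :=
  @dsum_map (fun i y => a *: y) (fun i => scaler0 (N i) a).
Lemma dsum_scaleA a b x : dsum_scale a (dsum_scale b x) = dsum_scale (a * b) x.
Proof. by apply: dsum_ext => i; apply: scalerA. Qed.
Lemma dsum_scale1 : left_id 1 dsum_scale.
Proof. by move=> x; apply: dsum_ext => i; apply: scale1r. Qed.
Lemma dsum_scaleDr : right_distributive dsum_scale +%R.
Proof. by move=> a x y; apply: dsum_ext => i; exact: (scalerDr a). Qed.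
Lemma dsum_scaleDl x : {morph dsum_scale^~ x : a b / a + b}.
Proof. by move=> a b; apply: dsum_ext => i; exact: scalerDl. Qed.
HB.instance Definition _ := GRing.Zmodule_isLmodule.Build A dsumT
  dsum_scaleA dsum_scale1 dsum_scaleDr dsum_scaleDl.
Lemma dsumZE a (x : dsumT) i : dsum_fun (a *: x) i = a *: dsum_fun x i.
Proof. by []. Qed.

Definition dsum_comp (n : int) : dsumT -> dsumT :=
  @dsum_map (fun i => dgm_comp n) (fun i => gr0 (dgm_grading (N i)) n).
Definition dsum_diff : dsumT -> dsumT :=
  @dsum_map (fun i => @dgm_diff k A (N i)) (fun i => @dgm_diff0 k A (N i)).
Lemma dsum_compE n x i : dsum_fun (dsum_comp n x) i = dgm_comp n (dsum_fun x i).
Proof. by []. Qed.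
Lemma dsum_diffE x i : dsum_fun (dsum_diff x) i = dgm_diff (dsum_fun x i).
Proof. by []. Qed.

Lemma dsum_grading : is_grading dsum_comp.
Proof.
split=> [n x y|n m x|x].
- by apply: dsum_ext => i; exact: (gr_sub (dgm_grading (N i)) n).
- apply: dsum_ext => i; rewrite !dsum_compE (gr_proj (dgm_grading (N i))).
  by case: eqP.
have [J hJ] := dsumP x.
pose s := undup (flatten [seq supp (@dgm_comp k A (N i)) (dsum_fun x i) | i <- J]).
exists s; split; first exact: undup_uniq.
apply: dsum_ext => i; rewrite dsum_sumE.
have [iJ|/hJ xi] := boolP (i \in J); last first.
  by rewrite xi big1 // => n _; rewrite dsum_compE xi (gr0 (dgm_grading (N i))).
apply: (gr_sup (dgm_grading (N i))); first exact: undup_uniq.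
move=> n hn; rewrite mem_undup; apply/flatten_mapP; exists i => //.
Qed.

Lemma dsum_deg n x : of_deg dsum_comp n x <->
  forall i, of_deg (@dgm_comp k A (N i)) n (dsum_fun x i).
Proof.
split=> [hx i|hx]; last by apply: dsum_ext => i; apply: hx.
by rewrite /of_deg -dsum_compE hx.
Qed.
Lemma dsum_act_deg n m (a : A) (x : dsumT) : of_deg (@dga_comp k A) n a ->
  of_deg dsum_comp m x -> of_deg dsum_comp (n + m) (a *: x).
Proof.
by move=> ha /dsum_deg hx; apply/dsum_deg => i; rewrite dsumZE; apply: dgm_act_deg.
Qed.
Lemma dsum_diffD x y : dsum_diff (x + y) = dsum_diff x + dsum_diff y.
Proof.
by apply: dsum_ext => i; rewrite dsumDE !dsum_diffE dsumDE dgm_diffD.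
Qed.
Lemma dsum_diff_deg n x : of_deg dsum_comp n x ->
  of_deg dsum_comp (n + 1) (dsum_diff x).
Proof.
by move=> /dsum_deg hx; apply/dsum_deg => i; rewrite dsum_diffE; apply: dgm_diff_deg.
Qed.
Lemma dsum_diffK x : dsum_diff (dsum_diff x) = 0.
Proof. by apply: dsum_ext => i; rewrite !dsum_diffE dgm_diffK. Qed.
Lemma dsum_leibniz n (a : A) x : of_deg (@dga_comp k A) n a ->
  dsum_diff (a *: x) = dga_diff a *: x + ksign n (a *: dsum_diff x).
Proof.
move=> ha; apply: dsum_ext => i.
rewrite dsumDE dsum_diffE !dsumZE (dgm_leibniz _ ha); congr (_ + _).
by rewrite /ksign; case: par.
Qed.

Definition dg_dsum : dgModule A :=
  @DGModule k A dsumT dsum_comp dsum_diff dsum_grading dsum_act_deg dsum_diffD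
    dsum_diff_deg dsum_diffK dsum_leibniz.

Definition dinj_fun (i : I) (x : N i) : dprodT := fun j =>
  if i =P j is ReflectT e then eq_rect i (fun j => N j : Type) x j e else 0.
Lemma dinj_fin i x : fin_supp (@dinj_fun i x).
Proof.
exists [:: i] => j; rewrite inE /dinj_fun eq_sym.
by case: (i =P j).
Qed.
Definition dinj (i : I) (x : N i) : dg_dsum := mk_dsum (dinj_fin x).

End DirectSum.

Section Enveloping.
Variables (k : fieldType) (A : connDGAlgebra k).
Notation cA := (@dga_comp k A).
Let gA := dga_grading A.

(* [A^e = A (x) A^op] *)
Definition dga_env : dgAlgebra k := dga_tens A (cdga_op A).
Notation E := dga_env.
Notation cE := (@dga_comp k E).
Let gE : is_grading cE := dga_grading E.
Local Notation tens := (@tens k A (cdga_op A)).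

Definition diagLT : Type := A.
HB.instance Definition _ := GRing.Zmodule.on diagLT.

(* [(a (x) b) m = (-1)^(|b||m|) a m b] *)
Definition diagL_scale (t : E) (m : A) : A :=
  tens_lift (fun a (b : A) => a * opmul b m) t.

Lemma diagL_bilin m : bilin (fun (a : A) (b : cdga_op A) => a * @opmul k A b m).
Proof.
split=> [b|a] c x y /=; first by rewrite mulrDl scalerAl.
by rewrite opmulDl mulrDr -opmulZl scalerAr.
Qed.
Lemma diagL_scaleDr : right_distributive diagL_scale +%R.
Proof.
move=> t m n; rewrite /diagL_scale /tens_lift /tens_ev -big_split.
by apply: eq_bigr => p _; rewrite opmulDr mulrDr.
Qed.
Lemma diagL_scaleDl m : {morph diagL_scale^~ m : s t / s + t}.
Proof. move=> s t; exact: (lift_add (diagL_bilin m)). Qed.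
Lemma diagL_scaleE a b m : diagL_scale (tens a b) m = a * @opmul k A b m.
Proof. exact: (tens_lift_tens _ _ (diagL_bilin m)). Qed.
Lemma diagL_scale0l m : diagL_scale 0 m = 0.
Proof. by apply: (addrI (diagL_scale 0 m)); rewrite -diagL_scaleDl !addr0. Qed.
Lemma diagL_scale0r t : diagL_scale t 0 = 0.
Proof. by apply: (addrI (diagL_scale t 0)); rewrite -diagL_scaleDr !addr0. Qed.
Lemma diagL_scaleKl i t m : diagL_scale (ksign i t) m = ksign i (diagL_scale t m).
Proof.
rewrite /ksign; case: par => //; apply: (addrI (diagL_scale t m)).
by rewrite -diagL_scaleDl !subrr diagL_scale0l.
Qed.
Lemma diagL_scale1 : left_id 1 diagL_scale.
Proof. by move=> m; rewrite [LHS]diagL_scaleE opmul1l mul1r. Qed.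

Lemma diagL_scaleA s t m : diagL_scale s (diagL_scale t m) = diagL_scale (s * t) m.
Proof.
elim/tens_hind: s => [|s s' hs hs'|i j a b ha hb].
- by rewrite mul0r !diagL_scale0l.
- by rewrite mulrDl !diagL_scaleDl hs hs'.
elim/tens_hind: t => [|t t' ht ht'|i' j' a' b' ha' hb'].
- by rewrite mulr0 !diagL_scale0l diagL_scale0r.
- by rewrite mulrDr !diagL_scaleDl diagL_scaleDr ht ht'.
rewrite [X in _ = diagL_scale X _](tmulE _ _ hb ha') diagL_scaleKl !diagL_scaleE.
rewrite (@opmul_mul k A j i' b a' _ hb ha') ksign_mulr mulrA.
by rewrite (@opmulA k A b b' m).
Qed.
HB.instance Definition _ := GRing.Zmodule_isLmodule.Build E diagLT
  diagL_scaleA diagL_scale1 diagL_scaleDr diagL_scaleDl.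

Lemma diagL_act_deg n m t x : of_deg cE n t -> of_deg cA m x ->
  of_deg cA (n + m) (diagL_scale t x).
Proof.
move=> ht hx; move: t ht; apply: tens_deg_ind => [|s t hs ht|i j a b ha hb ->].
- by rewrite diagL_scale0l; apply: of_deg0.
- by rewrite diagL_scaleDl; apply: of_degD.
by rewrite diagL_scaleE -addrA; apply: dga_mul_deg => //; apply: (@opmul_deg k A).
Qed.
Lemma diagL_leibniz n t x : of_deg cE n t ->
  dga_diff (diagL_scale t x)
  = diagL_scale (dga_diff t) x + ksign n (diagL_scale t (dga_diff x)).
Proof.
move: t; apply: tens_deg_ind => [|s t hs ht|i j a b ha hb ->].
- by rewrite dga_diff0 !diagL_scale0l dga_diff0 ksign0 addr0.
- by rewrite dga_diffD !diagL_scaleDl dga_diffD hs ht ksignD addrACA.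
rewrite [@dga_diff k E _](tdiffE _ ha) diagL_scaleDl diagL_scaleKl.
rewrite !diagL_scaleE (dga_leibniz _ ha) (@op_leibniz k A _ _ _ hb).
rewrite mulrDr ksignD addrA; congr (_ + _); rewrite ksign_mulr /ksign !parE.
by case: (par i); case: (par j); rewrite //= ?opprK.
Qed.

(* [A] as a left DG [A^e]-module. *)
Definition dg_diagL : dgModule E :=
  @DGModule k E diagLT cA (@dga_diff k A) gA diagL_act_deg (@dga_diffD k A)
    (@dga_diff_deg k A) (@dga_diffK k A) diagL_leibniz.

(* The right action [m (a (x) b) = (-1)^(|b|(|m|+|a|)) b m a]. *)
Definition diag_ract (t : E) (m : A) : A :=
  tens_lift (fun a (b : A) => opmul (m * a) b) t.

Lemma diag_ract_bilin m : bilin (fun (a : A) (b : cdga_op A) => @opmul k A (m * a) b).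
Proof.
split=> [b|a] c x y /=; first by rewrite mulrDr opmulDl -scalerAr -opmulZl.
by rewrite opmulDr -opmulZr.
Qed.
Lemma diag_ractE a b m : diag_ract (tens a b) m = @opmul k A (m * a) b.
Proof. exact: (tens_lift_tens _ _ (diag_ract_bilin m)). Qed.
Lemma diag_ractDr t m n : diag_ract t (m + n) = diag_ract t m + diag_ract t n.
Proof.
rewrite /diag_ract /tens_lift /tens_ev -big_split.
by apply: eq_bigr => p _; rewrite mulrDl opmulDl.
Qed.
Lemma diag_ractDl m s t : diag_ract (s + t) m = diag_ract s m + diag_ract t m.
Proof. exact: (lift_add (diag_ract_bilin m)). Qed.
Lemma diag_ract0l m : diag_ract 0 m = 0.
Proof. by apply: (addrI (diag_ract 0 m)); rewrite -diag_ractDl !addr0. Qed.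
Lemma diag_ract0r t : diag_ract t 0 = 0.
Proof. by apply: (addrI (diag_ract t 0)); rewrite -diag_ractDr !addr0. Qed.
Lemma diag_ractKl i t m : diag_ract (ksign i t) m = ksign i (diag_ract t m).
Proof.
rewrite /ksign; case: par => //; apply: (addrI (diag_ract t m)).
by rewrite -diag_ractDl !subrr diag_ract0l.
Qed.
Lemma diag_ractKr i t m : diag_ract t (ksign i m) = ksign i (diag_ract t m).
Proof.
rewrite /ksign; case: par => //; apply: (addrI (diag_ract t m)).
by rewrite -diag_ractDr !subrr diag_ract0r.
Qed.
Lemma diag_ract1 m : diag_ract 1 m = m.
Proof. by rewrite [LHS]diag_ractE mulr1 opmul1r. Qed.

Lemma diag_ract_deg n m t x : of_deg cE n t -> of_deg cA m x ->
  of_deg cA (n + m) (diag_ract t x).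
Proof.
move=> ht hx; move: t ht; apply: tens_deg_ind => [|s t hs ht|i j a b ha hb ->].
- by rewrite diag_ract0l; apply: of_deg0.
- by rewrite diag_ractDl; apply: of_degD.
rewrite diag_ractE addrC addrA; apply: (@opmul_deg k A) => //.
exact: dga_mul_deg.
Qed.

Lemma diag_ractM s t m : diag_ract (s * t) m = diag_ract t (diag_ract s m).
Proof.
elim/tens_hind: s => [|s s' hs hs'|i j a b ha hb].
- by rewrite mul0r !diag_ract0l diag_ract0r.
- by rewrite mulrDl !diag_ractDl diag_ractDr hs hs'.
elim/tens_hind: t => [|t t' ht ht'|i' j' a' b' ha' hb'].
- by rewrite mulr0 !diag_ract0l.
- by rewrite mulrDr !diag_ractDl ht ht'.
rewrite [X in diag_ract X _ = _](tmulE _ _ hb ha') diag_ractKl !diag_ractE.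
elim/(gr_ind gA): m => [|x y hx hy|l m hm].
- by rewrite !(mul0r, opmul0l) ksign0.
- by rewrite !(mulrDl, opmulDl) ksignD hx hy.
have hma := dga_mul_deg hm ha.
rewrite (@opmulE k A _ _ _ _ hma hb) -[b * b']/(@opmul k A b b').
rewrite ksign_mull (@opmulE k A _ _ b b' hb hb').
have -> : forall u x y, @opmul k A (ksign u x) y = ksign u (opmul x y).
  move=> u x y; rewrite /ksign; case: par => //.
  by apply: (addrI (opmul x y)); rewrite -opmulDl !subrr opmul0l.
have hbb := @dga_mul_deg k A _ _ _ _ hb' hb.
have hbma := dga_mul_deg (@dga_mul_deg k A _ _ _ _ hb hma) ha'.
rewrite (@opmul_ksign k A) [m * (a * a')]mulrA (@opmulE k A _ _ _ _ (dga_mul_deg hma ha') hbb).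
rewrite (@opmulE k A _ _ _ _ hbma hb') !mulrA /ksign !parE.
by case: (par i); case: (par j); case: (par i'); case: (par j'); case: (par l);
  rewrite //= ?opprK.
Qed.

Definition diagRT : Type := A.
HB.instance Definition _ := GRing.Zmodule.on diagRT.

(* The left action of [(A^e)^op] given by [t m = (-1)^(|t||m|) m t]. *)
Definition diagR_scale (t : dga_op E) (m : A) : A :=
  gsum2 cE cA (fun i j t m => ksign (i * j) (diag_ract t m)) t m.

Lemma diagR_scaleDr : right_distributive diagR_scale +%R.
Proof.
move=> t m n; apply: gsum2Dr; first exact: gA.
move=> i j x y z; by rewrite diag_ractDr ksignD.
Qed.
Lemma diagR_scaleDl m : {morph diagR_scale^~ m : s t / s + t}.
Proof.
move=> s t; apply: gsum2Dl; first exact: gE.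
move=> i j x y z; by rewrite diag_ractDl ksignD.
Qed.
Lemma diagR_scaleE i j t m : of_deg cE i t -> of_deg cA j m ->
  diagR_scale t m = ksign (i * j) (diag_ract t m).
Proof.
move=> ht hm; apply: (gsum2_homog gE gA _ _ ht hm) => *.
  by rewrite diag_ractDl ksignD.
by rewrite diag_ractDr ksignD.
Qed.
Lemma diagR_scale0l m : diagR_scale 0 m = 0.
Proof. by apply: (addrI (diagR_scale 0 m)); rewrite -diagR_scaleDl !addr0. Qed.
Lemma diagR_scale0r t : diagR_scale t 0 = 0.
Proof. by apply: (addrI (diagR_scale t 0)); rewrite -diagR_scaleDr !addr0. Qed.

Lemma diagR_act_deg i j t m : of_deg cE i t -> of_deg cA j m ->
  of_deg cA (i + j) (diagR_scale t m).
Proof.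
move=> ht hm; rewrite (diagR_scaleE ht hm); apply: (of_deg_ksign gA).
exact: diag_ract_deg.
Qed.

Lemma diagR_scale1 : left_id 1 diagR_scale.
Proof.
move=> m; elim/(gr_ind gA): m => [|x y hx hy|j m hm].
- exact: diagR_scale0r.
- by rewrite diagR_scaleDr hx hy.
by rewrite (diagR_scaleE (dga_one_deg E) hm) [diag_ract _ _]diag_ract1 /ksign mul0r.
Qed.
Lemma diagR_scaleA s t m : diagR_scale s (diagR_scale t m) = diagR_scale (s * t) m.
Proof.
elim/(gr_ind gE): s => [|x y hx hy|i s hs].
- by rewrite mul0r !diagR_scale0l.
- by rewrite mulrDl !diagR_scaleDl hx hy.
elim/(gr_ind gE): t => [|x y hx hy|j t ht].
- by rewrite mulr0 !diagR_scale0l diagR_scale0r.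
- by rewrite mulrDr !diagR_scaleDl diagR_scaleDr hx hy.
elim/(gr_ind gA): m => [|x y hx hy|l m hm].
- by rewrite !diagR_scale0r.
- by rewrite !diagR_scaleDr hx hy.
have hst := opmul_deg hs ht.
rewrite [RHS](diagR_scaleE hst hm) (diagR_scaleE hs (diagR_act_deg ht hm)).
rewrite (diagR_scaleE ht hm) diag_ractKr (opmulE hs ht).
rewrite diag_ractKl diag_ractM /ksign !parE.
by case: (par i); case: (par j); case: (par l); rewrite //= ?opprK.
Qed.
HB.instance Definition _ := GRing.Zmodule_isLmodule.Build (dga_op E) diagRT
  diagR_scaleA diagR_scale1 diagR_scaleDr diagR_scaleDl.

Lemma diagR_leibniz n (t : dga_op E) x : of_deg (@dga_comp k (dga_op E)) n t ->
  dga_diff (diagR_scale t x)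
  = diagR_scale (dga_diff t) x + ksign n (diagR_scale t (dga_diff x)).
Proof.
move=> ht; elim/(gr_ind gA): x => [|x y hx hy|l x hx].
- by rewrite dga_diff0 !diagR_scale0r dga_diff0 ksign0 addr0.
- by rewrite dga_diffD !diagR_scaleDr dga_diffD hx hy ksignD addrACA.
rewrite (diagR_scaleE ht hx) (diagR_scaleE (dga_diff_deg ht) hx).
rewrite (diagR_scaleE ht (dga_diff_deg hx)).
have dK u (y : A) : dga_diff (ksign u y) = ksign u (dga_diff y).
  by rewrite /ksign; case: par; rewrite ?dga_diffN.
have key : dga_diff (diag_ract t x) =
    diag_ract t (dga_diff x) + ksign l (diag_ract (@dga_diff k E t) x).
  move: t {ht}; elim/tens_hind => [|s t hs ht|i j a b ha hb].
  - by rewrite dga_diff0 !diag_ract0l dga_diff0 ksign0 addr0.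
  - by rewrite dga_diffD !diag_ractDl dga_diffD hs ht ksignD addrACA.
  rewrite [@dga_diff k E _](tdiffE _ ha) diag_ractDl diag_ractKl !diag_ractE.
  rewrite (@op_leibniz k A _ _ _ (dga_mul_deg hx ha)) (dga_leibniz _ hx) opmulDl.
  rewrite ksignD addrA -addrA -addrA; congr (_ + _).
  have -> : forall u x y, @opmul k A (ksign u x) y = ksign u (opmul x y).
    move=> u y z; rewrite /ksign; case: par => //.
    by apply: (addrI (opmul y z)); rewrite -opmulDl !subrr opmul0l.
  congr (_ + _); rewrite /ksign !parE.
  by case: (par i); case: (par l); rewrite //= ?opprK.
rewrite dK key ksignD addrC; congr (_ + _); rewrite /ksign !parE.
  by case: (par n); case: (par l); rewrite //= ?opprK.
by case: (par n); case: (par l); rewrite //= ?opprK.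
Qed.

(* [A] as a right DG [A^e]-module. *)
Definition dg_diagR : dgModule (dga_op E) :=
  @DGModule k (dga_op E) diagRT cA (@dga_diff k A) gA diagR_act_deg
    (@dga_diffD k A) (@dga_diff_deg k A) (@dga_diffK k A) diagR_leibniz.

End Enveloping.

Section SemiFree.
Variables (k : fieldType) (A : dgAlgebra k).

(* [e] is a basis of [F] over [A] made of homogeneous elements, [e y] of degree
   [deg y], and the differential of a basis element of level [l] lies in the
   submodule generated by the basis elements of levels [< l]. *)
Record is_semibasis (F : dgModule A) (E : choiceType) (e : E -> F)
    (deg : E -> int) (lev : E -> nat) : Prop := IsSemibasis {
  sb_deg : forall y, of_deg (@dgm_comp k A F) (deg y) (e y);
  sb_span : forall x, exists (s : seq E) (c : E -> A),
    x = \sum_(y <- s) c y *: e y;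
  sb_free : forall (s : seq E) (c : E -> A), uniq s ->
    \sum_(y <- s) c y *: e y = 0 -> forall y, y \in s -> c y = 0;
  sb_filtr : forall y, exists (s : seq E) (c : E -> A),
    (forall z, z \in s -> (lev z < lev y)%N) /\
    dgm_diff (e y) = \sum_(z <- s) c z *: e z }.

Definition semi_free (F : dgModule A) : Prop :=
  exists (E : choiceType) (e : E -> F) deg lev, is_semibasis e deg lev.

Definition semi_free_resolution (F M : dgModule A) (q : F -> M) : Prop :=
  semi_free F /\ quasi_iso q.

End SemiFree.

Definition in_max (k : fieldType) (A : connDGAlgebra k) (a : A) : Prop :=
  forall i, (i <= 0)%R -> dga_comp i a = 0.

(* [d(F)] is contained in [m_A F]. *)
Definition minimal (k : fieldType) (A : connDGAlgebra k) (F : dgModule A) : Prop :=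
  forall x : F, exists s : seq (A * F),
    (forall p, p \in s -> in_max p.1) /\ dgm_diff x = \sum_(p <- s) p.1 *: p.2.

Section Derived.
Variables (k : fieldType) (A : dgAlgebra k).
Implicit Types M N : dgModule A.

(* A morphism [M -> N] of [D(A)] is represented by a roof [M <- X -> N] whose
   left leg is a quasi-isomorphism. *)
Record roof M N := Roof {
  roof_mid : dgModule A;
  roof_s : roof_mid -> M;
  roof_f : roof_mid -> N }.
Arguments roof_s {M N} r _.
Arguments roof_f {M N} r _.

Definition is_roof M N (r : roof M N) : Prop :=
  quasi_iso (roof_s r) /\ dg_hom (roof_f r).

(* Two roofs represent the same morphism when a third one dominates both in the
   homotopy category. *)
Definition roof_eq M N (r r' : roof M N) : Prop :=
  exists (Z : dgModule A) (p : Z -> roof_mid r) (p' : Z -> roof_mid r'),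
    [/\ dg_hom p, dg_hom p', quasi_iso (roof_s r \o p),
        homotopic (roof_s r \o p) (roof_s r' \o p') &
        homotopic (roof_f r \o p) (roof_f r' \o p')].

Definition roof_id M : roof M M := @Roof M M M id id.
Definition roof_zero M N : roof M N := @Roof M N M id (fun _ => 0).

(* [r''] represents [r' \o r]. *)
Definition roof_comp M N P (r : roof M N) (r' : roof N P) (r'' : roof M P) : Prop :=
  exists (Z : dgModule A) (u : Z -> roof_mid r) (v : Z -> roof_mid r'),
    [/\ quasi_iso u, dg_hom v, homotopic (roof_f r \o u) (roof_s r' \o v) &
        roof_eq (@Roof M P Z (roof_s r \o u) (roof_f r' \o v)) r''].

Definition derived_iso M N : Prop :=
  exists (r : roof M N) (r' : roof N M),
    [/\ is_roof r, is_roof r', roof_comp r r' (roof_id M) &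
        roof_comp r' r (roof_id N)].

(* [r] represents [\sum_(i <- J) dinj i \o u i]; the sum of morphisms of [D(A)]
   is computed on a common left leg. *)
Definition roof_dsum M (I : choiceType) (N : I -> dgModule A) (J : seq I)
    (u : forall i, roof M (N i)) (r : roof M (dg_dsum N)) : Prop :=
  exists (X : dgModule A) (s : X -> M) (f : forall i, X -> N i),
    [/\ quasi_iso s, forall i, dg_hom (f i),
        forall i, i \in J -> roof_eq (u i) (@Roof M (N i) X s (f i)) &
        roof_eq r (@Roof M (dg_dsum N) X s
          (fun x => \sum_(i <- J) dinj (f i x)))].

(* The canonical map from the direct sum of the [Hom_D(M, N i)] to
   [Hom_D(M, dg_dsum N)] is surjective and has a trivial kernel. *)
Definition compact M : Prop :=
  forall (I : choiceType) (N : I -> dgModule A),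
    (forall r : roof M (dg_dsum N), is_roof r ->
      exists (J : seq I) (u : forall i, roof M (N i)),
        [/\ uniq J, forall i, is_roof (u i) & roof_dsum J u r]) /\
    (forall (J : seq I) (u : forall i, roof M (N i)) (r : roof M (dg_dsum N)),
      uniq J -> (forall i, is_roof (u i)) -> is_roof r -> roof_dsum J u r ->
      roof_eq r (roof_zero M (dg_dsum N)) ->
      forall i, i \in J -> roof_eq (u i) (roof_zero M (N i))).

End Derived.

Section Properties.
Variables (k : fieldType) (A : connDGAlgebra k).

Definition koszul : Prop :=
  exists (F : dgModule A) (q : F -> dg_triv A),
    [/\ quasi_iso q, minimal F &
        exists (E : choiceType) (e : E -> F) (lev : E -> nat),
          is_semibasis e (fun _ => 0) lev].

Definition homologically_smooth : Prop := compact (dg_triv A).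

(* [RHom_A(k, A)] is computed as [Hom_A(F, A)]. *)
Definition gorenstein : Prop :=
  exists (F : dgModule A) (q : F -> dg_triv A),
    semi_free_resolution q /\ cohom_dim (dg_dual F) 1.

(* [RHom_(A^e)(A, A^e)] is computed as [Hom_(A^e)(F, A^e)]. *)
Definition calabi_yau (d : int) : Prop :=
  homologically_smooth /\
  exists (F : dgModule (dga_env A)) (q : F -> dg_diagL A),
    semi_free_resolution q /\
    derived_iso (dg_dual F) (susp (- d) (dg_diagR A)).

End Properties.

Section Poly.
Variables (k : fieldType) (n : nat).
Implicit Types p q : {mpoly k[n]}.

Definition poly_comp (i : int) (p : {mpoly k[n]}) : {mpoly k[n]} :=
  if i is Posz d then pihomog mdeg d p else 0.

Lemma poly_comp0 i : poly_comp i 0 = 0.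
Proof. by case: i => //= d; rewrite pihomog0. Qed.

Lemma poly_grading : is_grading poly_comp.
Proof.
split=> [[d|d] p q|[d|d] [e|e] p|p] /=; rewrite ?pihomogB ?subr0 ?pihomog0 ?if_same //.
  rewrite eqz_nat; case: eqP => [->|/eqP de]; first exact: pihomog_id.
  by apply: (pihomog_ne0 _ (pihomogP _ _ _)); rewrite eq_sym.
pose m := mmeasure mdeg p; exists [seq Posz i | i <- iota 0 m]; split.
  by rewrite map_inj_uniq ?iota_uniq // => i j [].
rewrite big_map /= {1}(@pihomog_partitionE n k mdeg m p) //.
by rewrite -(big_mkord xpredT (fun d => pihomog mdeg d p)) /index_iota subn0.
Qed.

Lemma poly_compZ i (c : k) p : poly_comp i (c *: p) = c *: poly_comp i p.
Proof. by case: i => d /=; rewrite ?scaler0 // linearZ. Qed.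

Lemma poly_mul_deg i j p q : of_deg poly_comp i p -> of_deg poly_comp j q ->
  of_deg poly_comp (i + j) (p * q).
Proof.
case: i => d; last by move=> <- _; rewrite mul0r; apply: poly_comp0.
case: j => e; last by move=> _ <-; rewrite mulr0; apply: poly_comp0.
move=> hp hq; rewrite /of_deg -PoszD /=; apply: pihomog_dE; apply: dhomogM.
  by rewrite -hp; apply: pihomogP.
by rewrite -hq; apply: pihomogP.
Qed.

Definition poly_diff (p : {mpoly k[n]}) : {mpoly k[n]} := 0.
Lemma poly_diffD p q : poly_diff (p + q) = poly_diff p + poly_diff q.
Proof. by rewrite /poly_diff addr0. Qed.
Lemma poly_diffZ (c : k) p : poly_diff (c *: p) = c *: poly_diff p.
Proof. by rewrite /poly_diff scaler0. Qed.
Lemma poly_diff_deg i p : of_deg poly_comp i p ->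
  of_deg poly_comp (i + 1) (poly_diff p).
Proof. by move=> _; apply: poly_comp0. Qed.
Lemma poly_diffK p : poly_diff (poly_diff p) = 0. Proof. by []. Qed.
Lemma poly_leibniz i p q : of_deg poly_comp i p ->
  poly_diff (p * q) = poly_diff p * q + ksign i (p * poly_diff q).
Proof. by rewrite /poly_diff mul0r mulr0 ksign0 addr0. Qed.

Definition poly_dga : dgAlgebra k :=
  @DGAlgebra k {mpoly k[n]} poly_comp poly_diff poly_grading poly_compZ
    poly_mul_deg poly_diffD poly_diffZ poly_diff_deg poly_diffK poly_leibniz.

Lemma poly_neg i p : (i < 0)%R -> poly_comp i p = 0.
Proof. by case: i. Qed.
Lemma poly_augP p : poly_comp 0 p = (p@_0%MM)%:A.
Proof.
rewrite /= pihomogE (eq_bigl (fun m => m == 0%MM)); last first.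
  by move=> m; rewrite mdeg_eq0.
have [h|h] := boolP (0%MM \in msupp p).
  rewrite big_mkcond (bigD1_seq 0%MM) //= eqxx big1 ?addr0 ?mpolyX0 // => m.
  by move/negbTE->.
rewrite memN_msupp_eq0 // scale0r big_seq_cond big1 // => m /andP[hm /eqP m0].
by rewrite -m0 hm in h.
Qed.

(* [A(0, ..., 0)]: [k[x_1, ..., x_n]] with [|x_i| = 1] and zero differential. *)
Definition trivial_poly_dga : connDGAlgebra k :=
  @ConnDGAlgebra k poly_dga poly_neg (fun p => p@_0%MM) poly_augP.

End Poly.

(* Main.v *)
(* Let A = k[x_1, ..., x_n]. The Koszul complex on the subsets T of {1, ..., n}, with
   all e_T in degree 0 and d(e_T) = \sum_(i in T) +-x_i e_(T - i), resolves k, and the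
   bimodule Koszul complex, with x_i replaced by x_i (x) 1 + (-1)^|T| 1 (x) x_i, resolves
   A over A^e; the sign (-1)^|T| comes from d(x_i m) = - x_i dm. These complexes and
   their duals are all treated by one argument: the de Rham differential in the first
   tensor factor is a homotopy from 0 to an operator that is triangular for the
   filtration by x-degree, with diagonal entries the nonzero integers deg + |T| (for the
   duals, deg + n - |T|). In characteristic 0 every cocycle is thus cohomologous to one
   in filtration 0.

   A finite semi-free resolution makes k compact, by lifting roofs along
   quasi-isomorphisms. The cohomology of the dual of the bimodule complex is generated by
   the class u of the dual of the top basis element, of degree 0, and
   (x_i (x) 1 + (-1)^n 1 (x) x_i) u is a coboundary. For odd n these are the relations
   satisfied by 1 in A as a right A^e-module. For even n an isomorphism in the derived
   category, computed with any semi-free resolution, would map u to a nonzero element m of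
   k = A^0 with 2 m x_i = 0. *)
From HB Require Import structures.
Require Import Defs.
From mathcomp Require Import all_boot all_order all_algebra.
From mathcomp Require Import boolp functions.
From mathcomp Require Import mpoly.

Set Implicit Arguments.
Unset Strict Implicit.
Unset Printing Implicit Defensive.

Import Order.TTheory GRing.Theory Num.Theory.
Local Open Scope ring_scope.

(** * Graded maps, homotopies and quasi-isomorphisms *)

(** All [e_T] fit in degree 0 because [x_i] has degree 1, the degree of a differential. This is the
    source of Koszulness; it also puts the dual of the top basis element in degree 0, in accordance
    with the shift by 0 in the Calabi-Yau condition. Exactness is obtained without regular sequences
    and without tensor products of complexes. Up to signs, the input is that the [i]-th partial
    derivative commutes with multiplication by [x_j] for [j] distinct from [i], and has commutator 1
    with multiplication by [x_i]. In the bimodule complex the terms containing [1 (x) x_i] do not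
    cancel, but after the derivative nothing restores their x-degree; hence the operator is
    triangular rather than diagonal. The descent stops because there are finitely many coordinates,
    each of finite degree. The Gorenstein and Calabi-Yau conditions only assert that some resolution
    exists. For the positive statements the Koszul complexes are supplied. For even [n] the
    resolution is unknown, so it is compared with the Koszul one by maps in both directions; the
    derived isomorphism enters through one cohomology class and its annihilator. *)

Section Ksign.
Variable V : zmodType.
Implicit Types (x : V) (i : int).

Lemma ksignK i : involutive (@ksign V i).
Proof. by move=> x; rewrite /ksign; case: par; rewrite ?opprK. Qed.

Lemma ksign_add i j x : ksign (i + j) x = ksign i (ksign j x).
Proof. by rewrite /ksign parD; case: par; case: par; rewrite ?opprK. Qed.

Lemma ksignC i j x : ksign i (ksign j x) = ksign j (ksign i x).
Proof. by rewrite -!ksign_add addrC. Qed.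

Lemma ksign_sum i (I : Type) (s : seq I) (F : I -> V) :
  ksign i (\sum_(j <- s) F j) = \sum_(j <- s) ksign i (F j).
Proof. by elim/big_rec2: _ => [|j y z _ <-]; rewrite ?ksign0 ?ksignD. Qed.

End Ksign.

Section GradedMaps.
Variables (k : fieldType) (A : dgAlgebra k).
Implicit Types M N L X Y P : dgModule A.
Notation hdeg M := (of_deg (@dgm_comp k A M)).

Lemma dgm_diffB M (x y : M) : dgm_diff (x - y) = dgm_diff x - dgm_diff y.
Proof. by rewrite dgm_diffD dgm_diffN. Qed.

Lemma dgm_comp_diff M i (x : M) :
  dgm_comp (i + 1) (dgm_diff x) = dgm_diff (dgm_comp i x).
Proof.
have gM := dgm_grading M.
elim/(gr_ind gM): x => [|x y hx hy|j x hx].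
- by rewrite dgm_diff0 !gr0 ?dgm_diff0.
- by rewrite dgm_diffD !grD // dgm_diffD hx hy.
rewrite (of_degP gM _ (dgm_diff_deg hx)) (of_degP gM _ hx) (inj_eq (addIr 1)).
by case: eqP; rewrite ?dgm_diff0.
Qed.

Lemma dgm_comp_act M i j (a : A) (x : M) : hdeg M j x ->
  dgm_comp i (a *: x) = dga_comp (i - j) a *: x.
Proof.
have gM := dgm_grading M; have gA := dga_grading A => hx.
elim/(gr_ind gA): a => [|a b ha hb|l a ha].
- by rewrite !(gr0, scale0r).
- by rewrite !(scalerDl, grD) // ha hb.
rewrite (of_degP gM _ (dgm_act_deg ha hx)) (of_degP gA _ ha) subr_eq.
by case: eqP; rewrite ?scale0r.
Qed.

Section OneMap.
Variables (M N : dgModule A) (p : int) (f : M -> N).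
Hypothesis hf : graded_hom p f.

Lemma gh0 : f 0 = 0.
Proof. by apply: (addrI (f 0)); rewrite -(ghD hf) !addr0. Qed.
Lemma ghN x : f (- x) = - f x.
Proof. by apply: (addrI (f x)); rewrite -(ghD hf) !subrr gh0. Qed.
Lemma ghB x y : f (x - y) = f x - f y.
Proof. by rewrite (ghD hf) ghN. Qed.
Lemma gh_sum (I : Type) (s : seq I) (F : I -> M) :
  f (\sum_(j <- s) F j) = \sum_(j <- s) f (F j).
Proof. by elim/big_rec2: _ => [|j y z _ <-]; rewrite ?gh0 ?(ghD hf). Qed.
Lemma gh_ksign i x : f (ksign i x) = ksign i (f x).
Proof. by rewrite /ksign; case: par; rewrite ?ghN. Qed.

Lemma gh_cmp i x : dgm_comp (i + p) (f x) = f (dgm_comp i x).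
Proof.
have gM := dgm_grading M; have gN := dgm_grading N.
elim/(gr_ind gM): x => [|x y hx hy|j x hx].
- by rewrite gh0 !gr0 ?gh0.
- by rewrite (ghD hf) !grD // (ghD hf) hx hy.
rewrite (of_degP gN _ (gh_deg hf hx)) (of_degP gM _ hx) (inj_eq (addIr p)).
by case: eqP; rewrite ?gh0.
Qed.

Lemma gh_opp : graded_hom p (fun x => - f x).
Proof.
split=> [x y|i x hx|i a x ha]; first by rewrite (ghD hf) opprD.
  by apply: (of_degN (dgm_grading N)); apply: (gh_deg hf).
by rewrite (ghZ hf _ ha) scalerN ksignN.
Qed.

End OneMap.

Lemma gh_zero M N p : graded_hom p (fun _ : M => 0 : N).
Proof.
split=> [x y|i x _|i a x _]; first by rewrite addr0.
  exact: of_deg0 (dgm_grading N) _.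
by rewrite scaler0 ksign0.
Qed.

Lemma gh_add M N p (f g : M -> N) : graded_hom p f -> graded_hom p g ->
  graded_hom p (fun x => f x + g x).
Proof.
move=> hf hg; split=> [x y|i x hx|i a x ha].
- by rewrite (ghD hf) (ghD hg) addrACA.
- by apply: (of_degD (dgm_grading N)); [apply: (gh_deg hf)|apply: (gh_deg hg)].
- by rewrite (ghZ hf _ ha) (ghZ hg _ ha) scalerDr ksignD.
Qed.

Lemma gh_sub M N p (f g : M -> N) : graded_hom p f -> graded_hom p g ->
  graded_hom p (fun x => f x - g x).
Proof. by move=> hf hg; apply: gh_add => //; apply: gh_opp. Qed.

Lemma gh_bigsum M N p (I : Type) (s : seq I) (f : I -> M -> N) :
  (forall i, graded_hom p (f i)) -> graded_hom p (fun x => \sum_(i <- s) f i x).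
Proof.
move=> hf; elim: s => [|i s IH].
  under eq_fun do rewrite big_nil; exact: gh_zero.
under eq_fun do rewrite big_cons; exact: gh_add.
Qed.

Lemma gh_id M : graded_hom 0 (@id M).
Proof.
by split=> // [i x hx|i a x _]; rewrite ?addr0 // mul0r /ksign.
Qed.

Lemma gh_comp M N L p q (g : N -> L) (f : M -> N) :
  graded_hom q g -> graded_hom p f -> graded_hom (p + q) (g \o f).
Proof.
move=> hg hf; split=> [x y|i x hx|i a x ha] /=.
- by rewrite (ghD hf) (ghD hg).
- by rewrite addrA; apply: (gh_deg hg); apply: (gh_deg hf).
- rewrite (ghZ hf _ ha) (gh_ksign hg) (ghZ hg _ ha) mulrDl addrC ksign_add ksignC.
  by rewrite -ksign_add addrC ksign_add.
Qed.

(** This is the differential of the Hom complex. Graded linearity survives because the two terms in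
    [dga_diff a], one from each Leibniz rule, cancel. *)
Lemma gh_diff M N p (f : M -> N) : graded_hom p f ->
  graded_hom (p + 1) (fun x => dgm_diff (f x) - ksign p (f (dgm_diff x))).
Proof.
move=> hf; split=> [x y|i x hx|i a x ha].
- by rewrite !(ghD hf, dgm_diffD, ksignD, opprD) addrACA.
- have gN := dgm_grading N; apply: (of_degD gN).
    by rewrite addrA; apply: dgm_diff_deg; apply: (gh_deg hf).
  apply: (of_degN gN); apply: (of_deg_ksign gN).
  by rewrite addrCA addrC; apply: (gh_deg hf); apply: dgm_diff_deg.
rewrite (dgm_leibniz _ ha) (ghD hf) (gh_ksign hf) !(ghZ hf _ ha).
rewrite (ghZ hf _ (dga_diff_deg ha)) dgm_diff_ksign (dgm_leibniz _ ha).
rewrite scalerBr ksign_scale.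
move: (dga_diff a *: f x) (a *: dgm_diff (f x)) (a *: f (dgm_diff x)) => t1 t2 t3.
rewrite /ksign !parE; case: (par i); case: (par p);
  by rewrite /= ?opprD ?opprK // addrACA ?addNr ?subrr add0r.
Qed.

Lemma dg_hom_id M : dg_hom (@id M). Proof. by split=> //; apply: gh_id. Qed.

Lemma dg_hom_comp M N L (g : N -> L) (f : M -> N) :
  dg_hom g -> dg_hom f -> dg_hom (g \o f).
Proof.
move=> [hg dg] [hf df]; split=> [|x]; last by rewrite /= df dg.
by rewrite -[0]addr0; apply: gh_comp.
Qed.

Lemma dg_hom_cmp M N (f : M -> N) i x : dg_hom f ->
  dgm_comp i (f x) = f (dgm_comp i x).
Proof. by move=> [hf _]; rewrite -(gh_cmp hf) addr0. Qed.

Lemma homotopic_refl M N (f : M -> N) : homotopic f f.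
Proof.
exists (fun=> 0); first exact: gh_zero.
by move=> x; rewrite subrr dgm_diff0 addr0.
Qed.

Lemma homotopic_sym M N (f g : M -> N) : homotopic f g -> homotopic g f.
Proof.
move=> [h hh hE]; exists (fun x => - h x); first exact: gh_opp.
by move=> x; rewrite dgm_diffN -opprD -hE opprB.
Qed.

Lemma homotopic_trans M N (f g h : M -> N) :
  homotopic f g -> homotopic g h -> homotopic f h.
Proof.
move=> [u hu uE] [v hv vE]; exists (fun x => u x + v x); first exact: gh_add.
by move=> x; rewrite dgm_diffD addrACA -uE -vE addrA subrK.
Qed.

Lemma homotopic_compl M N L (u : N -> L) (f g : M -> N) :
  dg_hom u -> homotopic f g -> homotopic (u \o f) (u \o g).
Proof.
move=> [hu du] [h hh hE]; exists (u \o h).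
  by rewrite -[-1]addr0; apply: gh_comp.
by move=> x /=; rewrite -(ghB hu) hE (ghD hu) du.
Qed.

Lemma homotopic_compr M N L (v : L -> M) (f g : M -> N) :
  dg_hom v -> homotopic f g -> homotopic (f \o v) (g \o v).
Proof.
move=> [hv dv] [h hh hE]; exists (h \o v).
  by rewrite -[-1]add0r; apply: gh_comp.
by move=> x /=; rewrite hE dv.
Qed.

Lemma quasi_iso_hom M N (f : M -> N) : quasi_iso f -> dg_hom f.
Proof. by case. Qed.

Lemma quasi_iso_id M : quasi_iso (@id M).
Proof.
split; first exact: dg_hom_id.
  by [].
by move=> y hy; exists y => //; exists 0; rewrite dgm_diff0 addr0.
Qed.

Lemma quasi_iso_homotopic M N (f g : M -> N) :
  quasi_iso f -> dg_hom g -> homotopic f g -> quasi_iso g.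
Proof.
move=> [hf injf surf] hg [h hh hE].
have hd x : dgm_diff x = 0 -> f x - g x = dgm_diff (h x).
  by move=> dx; rewrite hE dx (gh0 hh) addr0.
split=> // [x dx [y gy]|y dy].
  by apply: injf => //; exists (y + h x); rewrite dgm_diffD -gy addrC -hd ?subrK.
have [x dx [z yE]] := surf y dy; exists x => //; exists (h x + z).
by rewrite dgm_diffD -hd // addrA [g x + _]addrC subrK.
Qed.

(* A quasi-isomorphism has an acyclic mapping cone; the conditions [dx = 0] and
   [q x = dy] say that [(x, y)] is a cocycle of the cone. *)
Lemma quasi_iso_lift X Y (q : X -> Y) i (x : X) (y : Y) : quasi_iso q ->
    hdeg X (i + 1) x -> hdeg Y i y -> dgm_diff x = 0 -> q x = dgm_diff y ->
  exists a b, [/\ hdeg X i a, hdeg Y (i - 1) b, dgm_diff a = x &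
    y - q a = dgm_diff b].
Proof.
move=> [hq injq surq] hx hy dx qx.
have [z xE] := injq x dx (ex_intro _ y qx).
have dyz : dgm_diff (y - q z) = 0 by rewrite dgm_diffB -hq.2 -xE qx subrr.
have [w dw [b yE]] := surq _ dyz.
(* The elements [z], [w] and [b] need not be homogeneous; since [q] and the differentials are
   graded, passing to components keeps both equations. *)
exists (dgm_comp i (z + w)), (dgm_comp (i - 1) b); split.
- exact: gr_of_deg (dgm_grading X) _ _.
- exact: gr_of_deg (dgm_grading Y) _ _.
- by rewrite -dgm_comp_diff dgm_diffD dw addr0 -xE.
rewrite -(dg_hom_cmp _ _ hq) -{1}hy -(gr_sub (dgm_grading Y)).
rewrite -dgm_comp_diff subrK (ghD hq.1) opprD addrA yE.
by rewrite addrAC subrr add0r.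
Qed.

Lemma quasi_iso_lift0 X Y (q : X -> Y) i (y : Y) : quasi_iso q ->
    hdeg Y i y -> dgm_diff y = 0 ->
  exists x b, [/\ hdeg X i x, dgm_diff x = 0 & y = q x + dgm_diff b].
Proof.
move=> hq hy dy; have [hh _ _] := hq.
have [||x [b [hx _ dx yx]]] := quasi_iso_lift hq (of_deg0 (dgm_grading X) _) hy.
- exact: dgm_diff0.
- by rewrite (gh0 hh.1).
by exists x, b; split=> //; rewrite -yx addrC subrK.
Qed.

End GradedMaps.

(** * Coordinates in a semi-free module *)

Section GradedSign.
Variables (k : fieldType) (A : dgAlgebra k).
Notation cA := (@dga_comp k A).
Let gA := dga_grading A.

(* [(-1)^(p|a|) a] *)
Definition gsign (p : int) (a : A) : A := gsum cA (fun i a => ksign (p * i) a) a.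

Lemma gsignE p i a : of_deg cA i a -> gsign p a = ksign (p * i) a.
Proof. by apply: (gsum_homog gA) => j; rewrite ksign0. Qed.
Lemma gsignD p a b : gsign p (a + b) = gsign p a + gsign p b.
Proof. by apply: (gsumD gA) => i u v; rewrite ksignD. Qed.
Lemma gsign0 p : gsign p 0 = 0.
Proof. by apply: (addrI (gsign p 0)); rewrite -gsignD !addr0. Qed.
Lemma gsignN p a : gsign p (- a) = - gsign p a.
Proof. by apply: (addrI (gsign p a)); rewrite -gsignD !subrr gsign0. Qed.
Lemma gsign_ksign p i a : gsign p (ksign i a) = ksign i (gsign p a).
Proof. by rewrite /ksign; case: par; rewrite ?gsignN. Qed.
Lemma gsign1 p : gsign p 1 = 1.
Proof. by rewrite (gsignE p (dga_one_deg A)) mulr0. Qed.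
Lemma gsign_deg p i a : of_deg cA i a -> of_deg cA i (gsign p a).
Proof. by move=> ha; rewrite (gsignE p ha); apply: (of_deg_ksign gA). Qed.

Lemma gsignM p a b : gsign p (a * b) = gsign p a * gsign p b.
Proof.
elim/(gr_ind gA): a => [|x y hx hy|i a ha].
- by rewrite mul0r gsign0 mul0r.
- by rewrite mulrDl !gsignD mulrDl hx hy.
elim/(gr_ind gA): b => [|x y hx hy|j b hb].
- by rewrite mulr0 gsign0 mulr0.
- by rewrite mulrDr !gsignD mulrDr hx hy.
rewrite (gsignE p (dga_mul_deg ha hb)) (gsignE p ha) (gsignE p hb).
by rewrite ksign_mull ksign_mulr -ksign_add -mulrDr.
Qed.

Lemma gsignK p : involutive (gsign p).
Proof.
move=> a; elim/(gr_ind gA): a => [|x y hx hy|i a ha].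
- by rewrite !gsign0.
- by rewrite !gsignD hx hy.
by rewrite (gsignE p ha) gsign_ksign (gsignE p ha) ksignK.
Qed.

Lemma gsign_sum p (I : Type) (s : seq I) (F : I -> A) :
  gsign p (\sum_(j <- s) F j) = \sum_(j <- s) gsign p (F j).
Proof. by elim/big_rec2: _ => [|j y z _ <-]; rewrite ?gsign0 ?gsignD. Qed.

Lemma gsignZ p (c : k) a : gsign p (c *: a) = c *: gsign p a.
Proof.
apply: (gsumZ _ gA) => [i z x|i u|i]; first exact: dga_compZ.
  by rewrite ksign_scale.
by rewrite ksign0.
Qed.

End GradedSign.

Section Coordinates.
Variables (k : fieldType) (A : dgAlgebra k) (P : dgModule A).
Variables (E : choiceType) (e : E -> P) (deg : E -> int) (lev : E -> nat).
Hypothesis eP : is_semibasis e deg lev.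
Notation cA := (@dga_comp k A).
Notation cP := (@dgm_comp k A P).
Let gA := dga_grading A.
Let gP := dgm_grading P.

(** Multiplicities in the list are absorbed into the coefficients. Vanishing off [s] then makes the
    whole function [c], and not just its restriction to [s], determined by [x]. *)
Lemma sb_span_uniq (x : P) : exists (s : seq E) (c : E -> A),
  [/\ uniq s, forall y, y \notin s -> c y = 0 & x = \sum_(y <- s) c y *: e y].
Proof.
have [s [c ->]] := sb_span eP x.
exists (undup s), (fun y => c y *+ count_mem y s); split.
- exact: undup_uniq.
- by move=> y; rewrite mem_undup => /count_memPn->; rewrite mulr0n.
rewrite -[LHS]big_undup_iterop_count; apply: eq_bigr => y _.
by rewrite Monoid.iteropE iter_addr_0 scalerMnl.
Qed.

Definition coord_supp (x : P) : seq E := projT1 (cid (sb_span_uniq x)).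
Definition coord (x : P) : E -> A := projT1 (cid (projT2 (cid (sb_span_uniq x)))).

Lemma coordP x : [/\ uniq (coord_supp x),
  forall y, y \notin coord_supp x -> coord x y = 0 &
  x = \sum_(y <- coord_supp x) coord x y *: e y].
Proof. exact: (projT2 (cid (projT2 (cid (sb_span_uniq x))))). Qed.

Lemma coord_uniq x s c : uniq s -> (forall y, y \notin s -> c y = 0) ->
  x = \sum_(y <- s) c y *: e y -> coord x = c.
Proof.
move=> us c0 xE; have [ux x0 xx] := coordP x.
pose t := undup (s ++ coord_supp x); have ut : uniq t by apply: undup_uniq.
have xs : x = \sum_(y <- t) c y *: e y.
  rewrite {1}xE; apply: big_supset => // y.
    by rewrite mem_undup mem_cat => ->.
  by move=> _ /c0->; rewrite scale0r.
have xt : x = \sum_(y <- t) coord x y *: e y.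
  rewrite {1}xx; apply: big_supset => // y.
    by rewrite mem_undup mem_cat orbC => ->.
  by move=> _ /x0->; rewrite scale0r.
have z : \sum_(y <- t) (coord x y - c y) *: e y = 0.
  under eq_bigr do rewrite scalerBl.
  by rewrite sumrB -xs -xt subrr.
apply/funext => y; have [yt|] := boolP (y \in t).
  by apply/eqP; rewrite -subr_eq0; apply/eqP; apply: (sb_free eP ut z).
by rewrite mem_undup mem_cat negb_or => /andP[/c0-> /x0->].
Qed.

Lemma coord_sum x t : uniq t -> (forall y, coord x y != 0 -> y \in t) ->
  x = \sum_(y <- t) coord x y *: e y.
Proof.
move=> ut xt; have [ux x0 {1}->] := coordP x.
rewrite (bigID (fun y => coord x y == 0)) /= big1 ?add0r; last first.
  by move=> y /eqP->; rewrite scale0r.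
rewrite -big_filter [RHS](bigID (fun y => coord x y == 0)) /= [X in X + _]big1 ?add0r.
  rewrite -[RHS]big_filter; apply: perm_big.
  apply: uniq_perm; rewrite ?filter_uniq // => y; rewrite !mem_filter /=.
  have [_|cy] := eqVneq (coord x y) 0; rewrite //= xt //.
  by apply: contraNT cy => /x0/eqP.
by move=> y /eqP->; rewrite scale0r.
Qed.

Lemma coordD x x' : coord (x + x') = fun y => coord x y + coord x' y.
Proof.
have [ux x0 xE] := coordP x; have [ux' x0' xE'] := coordP x'.
pose t := undup (coord_supp x ++ coord_supp x').
have ut : uniq t by apply: undup_uniq.
apply: (coord_uniq ut) => [y|].
  by rewrite mem_undup mem_cat negb_or => /andP[/x0-> /x0'->]; rewrite addr0.
under eq_bigr do rewrite scalerDl; rewrite big_split /=; congr (_ + _).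
  apply: (coord_sum ut) => y; rewrite mem_undup mem_cat; apply: contraNT.
  by rewrite negb_or => /andP[/x0->].
apply: (coord_sum ut) => y; rewrite mem_undup mem_cat; apply: contraNT.
by rewrite negb_or => /andP[_ /x0'->].
Qed.

Lemma coordZ a x : coord (a *: x) = fun y => a * coord x y.
Proof.
have [ux x0 xE] := coordP x; apply: (coord_uniq ux) => [y /x0->|].
  by rewrite mulr0.
by rewrite {1}xE scaler_sumr; apply: eq_bigr => y _; rewrite scalerA.
Qed.

Lemma coord_basis y : coord (e y) = fun z => if z == y then 1 else 0.
Proof.
apply: (@coord_uniq _ [:: y]) => // [z|].
  by rewrite inE => /negbTE->.
by rewrite big_seq1 eqxx scale1r.
Qed.

Lemma coord_cmp i x y : coord (cP i x) y = cA (i - deg y) (coord x y).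
Proof.
have [ux x0 xE] := coordP x; move: y; apply/funeqP; apply: (coord_uniq ux).
  by move=> y /x0->; apply: gr0.
rewrite {1}xE gr_sum //; apply: eq_bigr => y _; apply: dgm_comp_act.
exact: (sb_deg eP).
Qed.

Lemma coord_span x s (c : E -> A) y : x = \sum_(z <- s) c z *: e z ->
  coord x y != 0 -> y \in s.
Proof.
move=> ->; apply: contraR => ys; apply/eqP; elim: s ys => [_|z s IH].
  by rewrite big_nil (@coord_uniq _ [::] (fun=> 0)) // big_nil.
rewrite inE negb_or big_cons coordD => /andP[/negbTE yz /IH->].
by rewrite coordZ coord_basis yz mulr0 addr0.
Qed.

(** The filtration condition becomes strict triangularity of the differential in coordinates, the
    form used by recursion on levels. *)
Lemma coord_diff_lev y z : coord (dgm_diff (e y)) z != 0 -> (lev z < lev y)%N.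
Proof.
have [s [c [hs dE]]] := sb_filtr eP y => h; apply: hs; exact: coord_span dE h.
Qed.

Section Lin.
Variables (N : dgModule A) (p : int).
Implicit Types phi psi : E -> N.

(** The graded-linear extension of degree [p] of a map given on the basis: [gsign p] is the sign of
    moving a map of degree [p] past a coefficient. *)
Definition lin phi (x : P) : N :=
  \sum_(y <- coord_supp x) gsign p (coord x y) *: phi y.

Lemma linE phi x t : uniq t -> (forall y, coord x y != 0 -> y \in t) ->
  lin phi x = \sum_(y <- t) gsign p (coord x y) *: phi y.
Proof.
move=> ut xt; have [ux x0 _] := coordP x; rewrite /lin.
have z y : coord x y == 0 -> gsign p (coord x y) *: phi y = 0.
  by move=> /eqP->; rewrite gsign0 scale0r.
rewrite (bigID (fun y => coord x y == 0)) /= big1 // add0r -big_filter.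
rewrite [RHS](bigID (fun y => coord x y == 0)) /= [X in X + _]big1 // add0r.
rewrite -[RHS]big_filter; apply: perm_big.
apply: uniq_perm; rewrite ?filter_uniq // => y; rewrite !mem_filter /=.
have [_|cy] := eqVneq (coord x y) 0; rewrite //= xt //.
by apply: contraNT cy => /x0/eqP.
Qed.

Lemma lin_basis phi y : lin phi (e y) = phi y.
Proof.
rewrite (@linE _ _ [:: y]) // ?big_seq1 ?coord_basis ?eqxx ?gsign1 ?scale1r //.
by move=> z; rewrite inE; case: (z == y) => //; rewrite eqxx.
Qed.

Lemma eq_lin phi psi x : (forall y, coord x y != 0 -> phi y = psi y) ->
  lin phi x = lin psi x.
Proof.
move=> h; apply: eq_bigr => y _; have [->|/h->//] := eqVneq (coord x y) 0.
by rewrite gsign0 !scale0r.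
Qed.

Lemma linD phi x x' : lin phi (x + x') = lin phi x + lin phi x'.
Proof.
pose t := undup (coord_supp x ++ coord_supp x').
have ut : uniq t by apply: undup_uniq.
have [_ x0 _] := coordP x; have [_ x0' _] := coordP x'.
rewrite !(@linE _ _ t) // => [|y|y|y]; rewrite ?mem_undup ?mem_cat.
- by rewrite -big_split coordD; apply: eq_bigr => y _; rewrite gsignD scalerDl.
- by apply: contraNT; rewrite negb_or => /andP[_ /x0'->].
- by apply: contraNT; rewrite negb_or => /andP[/x0->].
- apply: contraNT; rewrite negb_or coordD => /andP[/x0-> /x0'->].
  by rewrite addr0.
Qed.

Lemma linZ phi i a x : of_deg cA i a -> lin phi (a *: x) = ksign (p * i) (a *: lin phi x).
Proof.
move=> ha; have [ux x0 _] := coordP x.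
rewrite (@linE _ _ (coord_supp x)) // => [|y]; last first.
  by apply: contraNT; rewrite coordZ => /x0->; rewrite mulr0.
rewrite /lin scaler_sumr ksign_sum coordZ; apply: eq_bigr => y _.
by rewrite gsignM (gsignE p ha) -scalerA ksign_scalel.
Qed.

Lemma lin_gh phi : (forall y, of_deg (@dgm_comp k A N) (deg y + p) (phi y)) ->
  graded_hom p (lin phi).
Proof.
have gN := dgm_grading N; move=> hphi; split=> [||i a x]; [exact: linD| |exact: linZ].
move=> i x hx; rewrite /of_deg gr_sum //; apply: eq_bigr => y _.
rewrite (dgm_comp_act _ _ (hphi y)); congr (_ *: _).
rewrite opprD addrACA subrr addr0; apply: gsign_deg.
by rewrite /of_deg -coord_cmp hx.
Qed.

End Lin.

(** Only the basis elements occurring in [x] are compared, since during a recursion on levels the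
    maps are under control only below the current level. *)
Lemma gh_eq (N : dgModule A) p (f g : P -> N) x : graded_hom p f -> graded_hom p g ->
  (forall y, coord x y != 0 -> f (e y) = g (e y)) -> f x = g x.
Proof.
have hZ (u : P -> N) a y : graded_hom p u -> u (a *: y) = gsign p a *: u y.
  move=> hu; elim/(gr_ind gA): a => [|a b ha hb|i a ha].
  - by rewrite gsign0 !scale0r (gh0 hu).
  - by rewrite gsignD !scalerDl (ghD hu) ha hb.
  by rewrite (ghZ hu _ ha) (gsignE p ha) ksign_scalel.
move=> hf hg h; have [_ _ ->] := coordP x.
rewrite (gh_sum hf) (gh_sum hg); apply: eq_bigr => y _.
rewrite !hZ //; have [->|/h->//] := eqVneq (coord x y) 0.
by rewrite gsign0 !scale0r.
Qed.

End Coordinates.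

(* Recursion on the level for relational specifications: [R phi y t] says that
   [t] is an admissible value at [y], given the values of [phi] below [y]. *)
Lemma level_rec (E T : Type) (lev : E -> nat) (t0 : T) (R : (E -> T) -> E -> T -> Prop) :
  (forall phi psi y, (forall z, (lev z < lev y)%N -> phi z = psi z) ->
     R phi y = R psi y) ->
  (forall phi y, (forall z, (lev z < lev y)%N -> R phi z (phi z)) ->
     exists t, R phi y t) ->
  exists phi, forall y, R phi y (phi y).
Proof.
move=> Rloc Rstep.
pose pick (Q : T -> Prop) := if pselect (exists t, Q t) is left h then projT1 (cid h) else t0.
(* The index [l] is fuel: [Phi l] has its final values at all elements of level less than [l]. *)
pose Phi := fix Phi l := if l is l'.+1 then fun y => pick (R (Phi l') y) else fun=> t0.
pose phi y := Phi (lev y).+1 y.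
have PhiE l y : (lev y < l)%N -> Phi l y = phi y.
  have [m] := ubnP (lev y); elim: m l y => // m IH [//|l] y; rewrite !ltnS => hm hl.
  rewrite /phi /=; congr pick; apply: Rloc => z hz.
  have hzm := leq_trans hz hm.
  by rewrite (IH l) ?(leq_trans hz) // (IH (lev y)).
exists phi => y; have [m] := ubnP (lev y); elim: m y => // m IH y; rewrite ltnS => hm.
have -> : phi y = pick (R phi y).
  by rewrite /phi /=; congr pick; apply: Rloc => z hz; apply: PhiE.
rewrite /pick; case: pselect => [h|[]]; first exact: (projT2 (cid h)).
by apply: Rstep => z hz; apply: IH; apply: leq_trans hm.
Qed.

(** * Lifting and compactness *)

Section Lifting.
Variables (k : fieldType) (A : dgAlgebra k) (P X Y : dgModule A).
Variables (E : choiceType) (e : E -> P) (deg : E -> int) (lev : E -> nat).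
Hypothesis eP : is_semibasis e deg lev.
Variable q : X -> Y.
Hypothesis hq : quasi_iso q.
Notation hX := (of_deg (@dgm_comp k A X)).
Notation hY := (of_deg (@dgm_comp k A Y)).
Let gX := dgm_grading X.
Let gY := dgm_grading Y.

(* [(alpha, beta)] is a cocycle of [Hom(P, cone q)], and [(a, b)] a cochain
   bounding it. *)
Lemma semi_free_lift (p : int) (alpha : P -> X) (beta : P -> Y) :
    graded_hom (p + 1) alpha -> graded_hom p beta ->
    (forall x, dgm_diff (alpha x) = ksign (p + 1) (alpha (dgm_diff x))) ->
    (forall x, q (alpha x) = dgm_diff (beta x) - ksign p (beta (dgm_diff x))) ->
  exists (a : P -> X) (b : P -> Y),
    [/\ graded_hom p a, graded_hom (p - 1) b,
        forall x, dgm_diff (a x) - ksign p (a (dgm_diff x)) = alpha x &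
        forall x, beta x - q (a x) = dgm_diff (b x) + ksign p (b (dgm_diff x))].
Proof.
move=> ha hb da db; have [[hqh dq] _ _] := hq.
(* The pair [t] consists of the values of [a] and [b] at [e y]; both equations involve [phi] only
   through [dgm_diff (e y)], hence only at lower levels. *)
pose R (phi : E -> X * Y) (y : E) (t : X * Y) : Prop :=
  [/\ hX (deg y + p) t.1, hY (deg y + (p - 1)) t.2,
    dgm_diff t.1 = alpha (e y) + ksign p (lin eP p (fst \o phi) (dgm_diff (e y))) &
    beta (e y) - q t.1
      = dgm_diff t.2 + ksign p (lin eP (p - 1) (snd \o phi) (dgm_diff (e y)))].
have Rloc phi psi y : (forall z, (lev z < lev y)%N -> phi z = psi z) ->
    R phi y = R psi y.
  move=> h; apply/funext => t; rewrite /R.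
  rewrite (@eq_lin _ _ _ _ _ _ _ eP _ p (fst \o phi) (fst \o psi)); last first.
    by move=> z /coord_diff_lev hz /=; rewrite h.
  rewrite (@eq_lin _ _ _ _ _ _ _ eP _ (p - 1) (snd \o phi) (snd \o psi)) //.
  by move=> z /coord_diff_lev hz /=; rewrite h.
have pE : par (p - 1) = ~~ par p by rewrite parB addbT.
(* Both sides of each equation are graded maps in [x], so the equations at basis elements imply them
   at every [x] supported there. *)
have key phi : (forall y, hX (deg y + p) (phi y).1 /\ hY (deg y + (p - 1)) (phi y).2) ->
    forall x, (forall y, coord eP x y != 0 -> R phi y (phi y)) ->
    dgm_diff (lin eP p (fst \o phi) x) - ksign p (lin eP p (fst \o phi) (dgm_diff x))
      = alpha x /\
    beta x - q (lin eP p (fst \o phi) x) = dgm_diff (lin eP (p - 1) (snd \o phi) x)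
      + ksign p (lin eP (p - 1) (snd \o phi) (dgm_diff x)).
  move=> hphi x hx.
  have h1 := lin_gh eP (fun y => (hphi y).1); have h2 := lin_gh eP (fun y => (hphi y).2).
  rewrite -/(fst \o phi) in h1; rewrite -/(snd \o phi) in h2; split.
    apply: (gh_eq (eP := eP) (x := x) (gh_diff h1) ha) => y /hx[_ _ dy _].
    by rewrite /= lin_basis dy addrK.
  have h3 : graded_hom p (fun x => dgm_diff (lin eP (p - 1) (snd \o phi) x)
      + ksign p (lin eP (p - 1) (snd \o phi) (dgm_diff x))).
    have := gh_diff h2; rewrite subrK; congr graded_hom; apply/funext => z.
    by rewrite /ksign pE; case: par; rewrite /= ?opprK.
  have h4 : graded_hom p (fun x => beta x - q (lin eP p (fst \o phi) x)).
    by apply: gh_sub => //; rewrite -[p]addr0; apply: gh_comp hqh _; rewrite ?addr0.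
  by apply: (gh_eq (eP := eP) (x := x) h4 h3) => y /hx[_ _ _ dy]; rewrite !lin_basis dy.
have [|phi hphi] := @level_rec E (X * Y)%type lev (0, 0) R Rloc.
  move=> phi y hphi.
  (* Nothing is known about [phi] at or above the level of [y]. Replacing it there by 0 makes it
     homogeneous everywhere, as [lin_gh] demands, and leaves the condition at [y] unchanged. *)
  pose phi' z := if (lev z < lev y)%N then phi z else (0, 0).
  have hR z : (lev z < lev y)%N -> R phi' z (phi' z).
    move=> hz; rewrite (Rloc _ phi) => [|w hw].
      by rewrite /phi' hz; apply: hphi.
    by rewrite /phi' (ltn_trans hw hz).
  have hd z : hX (deg z + p) (phi' z).1 /\ hY (deg z + (p - 1)) (phi' z).2.
    have [/hR[]//|hz] := boolP (lev z < lev y)%N.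
    by rewrite /phi' (negbTE hz); split; apply: of_deg0.
  have [k1 k2] : _ /\ _ := key _ hd (dgm_diff (e y)) (fun z hz => hR z (coord_diff_lev hz)).
  rewrite (Rloc phi phi') => [|z hz]; last by rewrite /phi' hz.
  have h1 := lin_gh eP (fun y => (hd y).1); have h2 := lin_gh eP (fun y => (hd y).2).
  rewrite -/(fst \o phi') in h1; rewrite -/(snd \o phi') in h2.
  rewrite dgm_diffK (gh0 h1) ksign0 subr0 in k1.
  rewrite dgm_diffK (gh0 h2) ksign0 addr0 in k2.
  have hy := sb_deg eP y; have hdy := dgm_diff_deg hy.
  set u := lin eP p _ _ in k1 k2; set v := lin eP (p - 1) _ _ in k2.
  (* By [key] at [dgm_diff (e y)], the prescribed right-hand sides form a cocycle of the cone of
     [q], and acyclicity supplies the values at [e y]. *)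
  have [||||s [t [hs ht ds dt]]] := @quasi_iso_lift _ _ _ _ q (deg y + p)
    (alpha (e y) + ksign p u) (beta (e y) - ksign p v) hq.
  - apply: (of_degD gX); first by rewrite -addrA; apply: (gh_deg ha).
    by apply: (of_deg_ksign gX); rewrite addrAC; apply: (gh_deg h1).
  - apply: (of_degD gY); first exact: (gh_deg hb).
    apply: (of_degN gY); apply: (of_deg_ksign gY).
    by have := gh_deg h2 hdy; rewrite addrACA subrr addr0.
  - rewrite dgm_diffD dgm_diff_ksign k1 da.
    by rewrite /ksign parD addbT; case: par; rewrite /= ?addNr ?subrr.
  - rewrite (ghD hqh) db dgm_diffB dgm_diff_ksign (gh_ksign hqh) -k2 ksignB opprB.
    by rewrite addrA [RHS]addrAC addrAC.
  exists (s, t); split => //; first by rewrite addrA.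
  by rewrite -dt -/v addrAC subrK.
exists (lin eP p (fst \o phi)), (lin eP (p - 1) (snd \o phi)).
have hd z : hX (deg z + p) (phi z).1 /\ hY (deg z + (p - 1)) (phi z).2.
  by have [] := hphi z.
split.
- exact: (lin_gh eP (fun y => (hd y).1)).
- exact: (lin_gh eP (fun y => (hd y).2)).
- by move=> x; apply: (key _ hd x (fun y _ => hphi y)).1.
- by move=> x; apply: (key _ hd x (fun y _ => hphi y)).2.
Qed.

(** Case [p = 0], [alpha = 0], [beta = f]: the bounding cochain consists of the lift and of the
    homotopy. *)
Lemma semi_free_lift_map (f : P -> Y) : dg_hom f ->
  exists2 g : P -> X, dg_hom g & homotopic (q \o g) f.
Proof.
move=> [hf df].
have [||||a [b [ha hb aE bE]]] := @semi_free_lift 0 (fun=> 0) f.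
- exact: gh_zero.
- exact: hf.
- by move=> x; rewrite dgm_diff0 ksign0.
- by move=> x; rewrite (gh0 (quasi_iso_hom hq).1) df /ksign subrr.
exists a; first by split=> // x; move/eqP: (aE x); rewrite subr_eq0 => /eqP->.
by apply: homotopic_sym; exists b => // x; apply: bE.
Qed.

(** Case [p = -1], with [alpha] the difference [f - g] and [beta] the given homotopy after
    composition with [q]. *)
Lemma semi_free_lift_homotopy (f g : P -> X) : dg_hom f -> dg_hom g ->
  homotopic (q \o f) (q \o g) -> homotopic f g.
Proof.
move=> [hf df] [hg dg] [h hh hE].
have [||||a [b [ha hb aE bE]]] := @semi_free_lift (-1) (fun x => f x - g x) h.
- by rewrite addNr; apply: gh_sub.
- exact: hh.
- by move=> x; rewrite dgm_diffB -df -dg /ksign addNr.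
- move=> x; rewrite (ghB (quasi_iso_hom hq).1) [LHS]hE /ksign /=.
  by rewrite opprK.
by exists a => // x; rewrite -aE /ksign /= opprK.
Qed.

End Lifting.

Section Compactness.
Variables (k : fieldType) (A : dgAlgebra k) (M P : dgModule A).
Variables (E : finType) (e : E -> P) (deg : E -> int) (lev : E -> nat).
Hypothesis eP : is_semibasis e deg lev.
Variable q : P -> M.
Hypothesis hq : quasi_iso q.

(** Precomposition with [t] brings any roof out of [M] to one with middle [P] and left leg homotopic
    to [q], so that morphisms of the derived category become homotopy classes of maps out of [P]. *)
Let lift_qi (X : dgModule A) (s : X -> M) : quasi_iso s ->
  exists t : P -> X, [/\ dg_hom t, homotopic (s \o t) q & quasi_iso (s \o t)].
Proof.
move=> hs; have [t ht hst] := semi_free_lift_map eP hs (quasi_iso_hom hq).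
exists t; split=> //; apply: quasi_iso_homotopic hq _ (homotopic_sym hst).
exact: dg_hom_comp (quasi_iso_hom hs) ht.
Qed.

Let lift_unique (X : dgModule A) (s : X -> M) (t u : P -> X) :
  quasi_iso s -> dg_hom t -> dg_hom u ->
  homotopic (s \o t) q -> homotopic (s \o u) q -> homotopic t u.
Proof.
move=> hs ht hu st su; apply: (semi_free_lift_homotopy eP hs ht hu).
exact: homotopic_trans st (homotopic_sym su).
Qed.

Section DirectSum.
Variables (I : choiceType) (N : I -> dgModule A).

Lemma dinjE i (x : N i) : dsum_fun (dinj x) i = x.
Proof.
rewrite /dinj /= /dinj_fun; case: eqP => // e0.
by rewrite (Prop_irrelevance e0 erefl).
Qed.
Lemma dinjE0 i j (x : N i) : i != j -> dsum_fun (dinj x) j = 0.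
Proof. by rewrite /dinj /= /dinj_fun; case: eqP. Qed.

Lemma dsum_fun_hom i : dg_hom (fun x : dg_dsum N => dsum_fun x i).
Proof.
split; first split.
- by move=> x y.
- by move=> n x /dsum_deg hx; rewrite addr0; apply: hx.
- by move=> n a x _; rewrite mul0r.
by [].
Qed.

End DirectSum.

(** The images of the finitely many basis elements meet finitely many summands, so a map from [P] to
    a direct sum lands in a finite subsum; its components are the required roofs. *)
Lemma finite_semi_free_compact : compact M.
Proof.
move=> I N; split.
  move=> [X s f] [/= hs hf].
  have [t [ht hst qst]] := lift_qi hs.
  pose g i x := dsum_fun (f (t x)) i.
  have hg i : dg_hom (g i).
    apply: (@dg_hom_comp _ _ _ _ _ (fun x : dg_dsum N => dsum_fun x i) (f \o t)).
      exact: dsum_fun_hom.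
    exact: dg_hom_comp.
  have [sf hsf] : exists sf : E -> seq I, forall y i, i \notin sf y -> g i (e y) = 0.
    exists (fun y => projT1 (cid (dsumP (f (t (e y)))))) => y.
    exact: projT2 (cid (dsumP (f (t (e y))))).
  pose J := undup (flatten [seq sf y | y <- enum E]).
  have uJ : uniq J by apply: undup_uniq.
  have g0 x i : i \notin J -> g i x = 0.
    move=> iJ; apply: (gh_eq (eP := eP) (hg i).1 (gh_zero _ _ 0)) => y _.
    apply: hsf; apply: contraNN iJ => iy; rewrite mem_undup.
    by apply/flatten_mapP; exists y; rewrite ?mem_enum.
  exists J, (fun i => @Roof _ _ M (N i) P q (g i)); split=> //.
  exists P, q, g; split=> //.
    move=> i _; exists P, id, id; split.
    - exact: dg_hom_id.
    - exact: dg_hom_id.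
    - exact: hq.
    - exact: homotopic_refl.
    - exact: homotopic_refl.
  exists P, t, id; split=> //=; first exact: dg_hom_id.
  suff -> : f \o t = (fun x => \sum_(i <- J) dinj (g i x)) by exact: homotopic_refl.
  apply/funext => x; apply: dsum_ext => i; rewrite dsum_sumE -[LHS]/(g i x).
  have [iJ|iJ] := boolP (i \in J).
    rewrite (bigD1_seq i) // dinjE big1 => [|j ji]; last exact: dinjE0.
    by rewrite [RHS]addr0.
  rewrite g0 // big_seq big1 // => j jJ; apply: dinjE0.
  by apply: contraNneq iJ => <-.
(* For the kernel, all the roofs involved are pulled back to [P], where uniqueness of lifts makes
   the various comparison maps homotopic. *)
move=> J u [R sR fR] uJ hu [/= hsR hfR] [X [s [f [hs hf uf rf]]]] r0 i iJ.
have [t [ht hst _]] := lift_qi hs.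
have [Z [p [p' [hp hp' hsp hpp' fp0]]]] := r0.
have [Z1 [p1 [p1' [hp1 hp1' hsp1 hpp1 fp1]]]] := rf.
have [Z3 [p3 [p3' [hp3 hp3' hsp3 hpp3 fp3]]]] := uf i iJ.
have [hsu hfu] := hu i.
have [t1 [ht1 hst1 _]] := lift_qi hsp1.
have [t2 [ht2 hst2 _]] := lift_qi hsp.
have [t3 [ht3 hst3 qst3]] := lift_qi hsp3.
cbn [roof_mid roof_s roof_f] in *.
have e12 : homotopic (p1 \o t1) (p \o t2).
  by apply: (lift_unique hsR) => //; apply: dg_hom_comp.
have e13 : homotopic (p3' \o t3) (p1' \o t1).
  apply: (lift_unique hs); try exact: dg_hom_comp.
    apply: homotopic_trans hst3; apply: homotopic_sym.
    exact: (homotopic_compr ht3 hpp3).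
  apply: homotopic_trans hst1; apply: homotopic_sym.
  exact: (homotopic_compr ht1 hpp1).
have fp : homotopic (fR \o (p1 \o t1)) (fun=> 0).
  apply: homotopic_trans (homotopic_compl hfR e12) _.
  exact: (homotopic_compr ht2 fp0).
pose S x := \sum_(i <- J) dinj (f i x).
(* The sum over [J] is null-homotopic on [P], and projection to the summand [i] extracts [f i]. *)
have fi0 : homotopic (f i \o (p1' \o t1)) (fun=> 0).
  have h : homotopic (S \o (p1' \o t1)) (fun=> 0).
    apply: homotopic_trans fp; apply: homotopic_sym.
    exact: (homotopic_compr ht1 fp1).
  have := homotopic_compl (dsum_fun_hom N i) h; congr homotopic.
  apply/funext => x; rewrite /S /comp dsum_sumE (bigD1_seq i) // dinjE.
  by rewrite big1 => [|j ji]; [rewrite [LHS]addr0|apply: dinjE0].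
exists P, (p3 \o t3), q; split=> //.
- exact: dg_hom_comp.
- exact: quasi_iso_hom.
cbn [roof_zero roof_mid roof_s roof_f].
apply: homotopic_trans (homotopic_compr ht3 fp3) _.
exact: homotopic_trans (homotopic_compl (hf i) e13) fi0.
Qed.

End Compactness.

(** * Free DG modules on a finite basis in degree 0 *)

Lemma dga_comp_mulr (k : fieldType) (A : dgAlgebra k) i j (a b : A) :
  of_deg (@dga_comp k A) j b -> dga_comp i (a * b) = dga_comp (i - j) a * b.
Proof. exact: (@dgm_comp_act k A (dga_reg A)). Qed.

Lemma dga_comp_mull (k : fieldType) (A : dgAlgebra k) i j (a b : A) :
  of_deg (@dga_comp k A) j a -> dga_comp i (a * b) = a * dga_comp (i - j) b.
Proof.
have gA := dga_grading A => ha; elim/(gr_ind gA): b => [|b c hb hc|l b hb].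
- by rewrite !(mulr0, gr0).
- by rewrite !(mulrDr, grD) // hb hc.
rewrite (of_degP gA _ (dga_mul_deg ha hb)) (of_degP gA _ hb) subr_eq [l + j]addrC.
by case: eqP; rewrite ?mulr0.
Qed.

Section FreeModule.
Variables (k : fieldType) (A : dgAlgebra k) (E : finType) (m : E -> E -> A).
Notation cA := (@dga_comp k A).
Let gA := dga_grading A.

Hypothesis diff0 : forall a : A, dga_diff a = 0.
Hypothesis m_deg : forall T S, of_deg cA 1 (m T S).
Hypothesis m_sq : forall U S, \sum_T m U T * m T S = 0.

Definition freeT : Type := {ffun E -> A^o}.
HB.instance Definition _ := GRing.Lmodule.on freeT.
Implicit Types (c x : freeT).

Definition free_comp (i : int) (c : freeT) : freeT := [ffun S => cA i (c S)].
(* The basis element [e_T] has differential [\sum_S m T S *: e_S]. *)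
Definition free_diff (c : freeT) : freeT :=
  [ffun S => \sum_T gsign 1 (c T) * m T S].

Lemma free_grading : is_grading free_comp.
Proof.
split=> [i x y|i j x|x].
- by apply/ffunP => S; rewrite !ffunE (gr_sub gA).
- apply/ffunP => S; rewrite !ffunE (gr_proj gA).
  by case: eqP; rewrite !ffunE.
pose s := undup (flatten [seq supp cA (x T) | T <- enum E]).
exists s; split; first exact: undup_uniq.
apply/ffunP => S; rewrite sum_ffunE.
rewrite {1}(gr_sup gA (undup_uniq _) (_ : {subset supp cA (x S) <= s})).
  by apply: eq_bigr => i _; rewrite ffunE.
move=> i hi; rewrite mem_undup; apply/flatten_mapP; exists S => //.
by rewrite mem_enum.
Qed.

Lemma free_deg i x : of_deg free_comp i x <-> forall S, of_deg cA i (x S).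
Proof.
split=> [<- S|h]; first by rewrite ffunE; apply: gr_of_deg.
by apply/ffunP => S; rewrite ffunE h.
Qed.

Lemma free_act_deg i j (a : A) x : of_deg cA i a -> of_deg free_comp j x ->
  of_deg free_comp (i + j) (a *: x).
Proof.
move=> ha /free_deg hx; apply/free_deg => S; rewrite ffunE.
exact: dga_mul_deg ha (hx S).
Qed.

Lemma free_diffD x y : free_diff (x + y) = free_diff x + free_diff y.
Proof.
apply/ffunP => S; rewrite !ffunE -big_split; apply: eq_bigr => T _.
by rewrite ffunE gsignD mulrDl.
Qed.

Lemma free_diff_deg i x : of_deg free_comp i x ->
  of_deg free_comp (i + 1) (free_diff x).
Proof.
move=> /free_deg hx; apply/free_deg => S; rewrite ffunE /of_deg gr_sum //.
apply: eq_bigr => T _; apply: dga_mul_deg (m_deg T S); exact: gsign_deg.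
Qed.

Lemma free_diffK x : free_diff (free_diff x) = 0.
Proof.
apply/ffunP => S; rewrite !ffunE.
under eq_bigr do rewrite ffunE gsign_sum mulr_suml.
rewrite exchange_big big1 // => U _ /=.
transitivity (- x U * \sum_T m U T * m T S); last by rewrite m_sq mulr0.
rewrite mulr_sumr; apply: eq_bigr => T _.
by rewrite gsignM gsignK (gsignE _ (m_deg U T)) /ksign /= mulrN !mulNr mulrA.
Qed.

Lemma free_leibniz i (a : A) x : of_deg cA i a ->
  free_diff (a *: x) = dga_diff a *: x + ksign i (a *: free_diff x).
Proof.
move=> ha; rewrite diff0 scale0r add0r -ksign_scale; apply/ffunP => S.
rewrite !ffunE; have -> : (ksign i (free_diff x)) S = ksign i (free_diff x S).
  by rewrite /ksign; case: par; rewrite // ffunE.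
rewrite ffunE [RHS]ksign_mulr [_ * _]mulr_sumr ksign_sum; apply: eq_bigr => T _.
by rewrite ffunE gsignM (gsignE _ ha) mul1r mulrA !ksign_mull.
Qed.

Definition free_dg : dgModule A :=
  @DGModule k A freeT free_comp free_diff free_grading free_act_deg free_diffD
    free_diff_deg free_diffK free_leibniz.

Definition free_basis (T : E) : free_dg := [ffun S => if S == T then 1 else 0].

Lemma free_basis_deg T : of_deg (@dgm_comp k A free_dg) 0 (free_basis T).
Proof.
apply/free_deg => S; rewrite ffunE; case: eqP => _; first exact: dga_one_deg.
exact: of_deg0.
Qed.

Lemma free_expand (x : free_dg) : x = \sum_S (x : freeT) S *: free_basis S.
Proof.
apply/ffunP => S; rewrite sum_ffunE (bigD1 S) //= ffunE [X in _ *: X]ffunE eqxx.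
rewrite [X in _ = X + _]mulr1 big1 ?addr0 // => T TS.
rewrite ffunE [X in _ *: X]ffunE eq_sym (negbTE TS); exact: mulr0.
Qed.

Lemma free_diff_basis T : dgm_diff (free_basis T) = \sum_S m T S *: free_basis S.
Proof.
rewrite [LHS]free_expand; apply: eq_bigr => S _; congr (_ *: _).
rewrite ffunE (bigD1 T) //= ffunE eqxx gsign1 mul1r big1 ?addr0 // => U UT.
by rewrite ffunE (negbTE UT) gsign0 mul0r.
Qed.

Lemma free_semibasis (lev : E -> nat) :
  (forall T S, m T S != 0 -> (lev S < lev T)%N) ->
  is_semibasis free_basis (fun=> 0) lev.
Proof.
move=> hlev; split=> [T|x|s c us s0 S Ss|T]; first exact: free_basis_deg.
- by exists (index_enum E), (x : freeT); apply: free_expand.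
- move/ffunP/(_ S): s0; rewrite sum_ffunE (bigD1_seq S) //= ffunE.
  rewrite [X in _ *: X]ffunE eqxx ffunE big1 ?addr0 => [|T TS].
    by rewrite [LHS](_ : _ = c S) //; apply: mulr1.
  by rewrite ffunE [X in _ *: X]ffunE eq_sym (negbTE TS); apply: mulr0.
(* Zero entries of [m] satisfy no level condition and must be left out of the list. *)
exists [seq U <- index_enum E | m T U != 0], (m T); split.
  by move=> S; rewrite mem_filter => /andP[/hlev].
rewrite free_diff_basis big_filter [RHS]big_mkcond; apply: eq_bigr => S _.
by case: eqP => [->|//]; rewrite scale0r.
Qed.

Section Dual.
Notation D := (dg_dual free_dg).

(* [e_S |-> psi S] extended to [F]; the product of the opposite algebra supplies
   the sign of the graded-linear extension. *)
Definition free_dual_fun (psi : E -> A) (x : free_dg) : dga_reg A :=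
  \sum_S opmul (psi S) ((x : freeT) S).

Lemma free_dual_ghom p psi : (forall S, of_deg cA p (psi S)) ->
  graded_hom p (free_dual_fun psi).
Proof.
move=> hpsi; apply: gh_bigsum => S; split=> [x y|i x /free_deg hx|i a x ha].
- by rewrite ffunE opmulDr.
- by rewrite addrC; apply: opmul_deg.
by rewrite ffunE; apply: opmul_mul.
Qed.

(** As [E] is finite, the values of [psi] involve finitely many degrees altogether, so the map is a
    finite sum of homogeneous ones even when [psi] is not homogeneous. *)
Lemma free_dual_fin psi : fin_hom (free_dual_fun psi).
Proof.
pose t := undup (flatten [seq supp cA (psi T) | T <- enum E]).
exists t, (fun p => free_dual_fun (fun S => cA p (psi S))); split.
  by move=> p; apply: free_dual_ghom => S; apply: gr_of_deg.
apply/funext => x; rewrite fct_sumE exchange_big; apply: eq_bigr => S _ /=.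
have hs : {subset supp cA (psi S) <= t}.
  move=> i hi; rewrite mem_undup; apply/flatten_mapP; exists S => //.
  by rewrite mem_enum.
rewrite {1}(gr_sup gA (undup_uniq _) hs).
by elim/big_rec2: _ => [|i y z _ <-]; rewrite ?opmul0l ?opmulDl.
Qed.
Definition free_dual (psi : E -> A) : D := mk_dual (free_dual_fin psi).

Lemma dual_expand (phi : D) (x : free_dg) :
  (phi : dualT free_dg) x =
  \sum_S opmul ((phi : dualT free_dg) (free_basis S)) ((x : freeT) S).
Proof.
elim/(@dual_ind k A free_dg): phi => [|f g hf hg|p f hf].
- by rewrite big1 // => S _; rewrite [X in opmul X]dual0E opmul0l.
- rewrite dualDE hf hg -big_split; apply: eq_bigr => S _.
  by rewrite [X in _ = opmul X _]dualDE opmulDl.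
rewrite {1}(free_expand x) (gh_sum hf); apply: eq_bigr => S _.
have hb := gh_deg hf (free_basis_deg S); rewrite add0r in hb.
elim/(gr_ind gA): ((x : freeT) S) => [|a b ha hb'|i a ha].
- by rewrite scale0r (gh0 hf) opmul0r.
- by rewrite scalerDl (ghD hf) ha hb' opmulDr.
by rewrite (ghZ hf _ ha) (opmulE hb ha).
Qed.

Lemma dual_eqP (phi chi : D) :
  (forall S, (phi : dualT free_dg) (free_basis S) = (chi : dualT free_dg) (free_basis S)) ->
  phi = chi.
Proof.
move=> h; apply: dual_ext => x; rewrite !dual_expand.
by apply: eq_bigr => S _; rewrite h.
Qed.

Lemma free_dualE psi S : (free_dual psi : dualT free_dg) (free_basis S) = psi S.
Proof.
rewrite /= /free_dual_fun (bigD1 S) //= ffunE eqxx opmul1r big1 ?addr0 // => T TS.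
by rewrite ffunE (negbTE TS) opmul0r.
Qed.

(** For [phi] of degree [p], the sign [(-1)^p] of the Hom differential cancels the one from moving
    [phi] past the degree 1 entry [m T S]. The formula is thus independent of [p] and holds for
    inhomogeneous [phi]. *)
Lemma dual_diff_basis (phi : D) T :
  (dgm_diff phi : dualT free_dg) (free_basis T) =
  - \sum_S m T S * (phi : dualT free_dg) (free_basis S).
Proof.
elim/(@dual_ind k A free_dg): phi => [|f g hf hg|p f hf].
- rewrite dgm_diff0 big1 ?oppr0 // => S _; exact: mulr0.
- rewrite dgm_diffD dualDE hf hg -opprD -big_split; congr (- _).
  by apply: eq_bigr => S _; symmetry; apply: mulrDr.
rewrite [LHS](dual_diffE _ hf) [X in X - _]diff0 sub0r free_diff_basis (gh_sum hf) ksign_sum.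
congr (- _); apply: eq_bigr => S _.
by rewrite (ghZ hf _ (m_deg T S)) mulr1 ksignK.
Qed.

End Dual.
End FreeModule.

(** Every coordinate of a differential is a sum of multiples of entries of degree 1, hence lies in
    the augmentation ideal. *)
Lemma free_minimal (k : fieldType) (A : connDGAlgebra k) (E : finType)
    (m : E -> E -> A) diff0 m_deg m_sq :
  minimal (@free_dg k A E m diff0 m_deg m_sq).
Proof.
have gA := dga_grading A; move=> x.
pose y : {ffun E -> A^o} := dgm_diff x.
exists [seq (y T, free_basis diff0 m_deg m_sq T) | T <- index_enum E]; split.
  move=> _ /mapP[S _ ->] i i0 /=; rewrite ffunE gr_sum // big1 // => T _.
  rewrite (dga_comp_mulr _ _ (m_deg T S)) cdga_neg ?mul0r //.
  by rewrite subr_lt0; apply: le_lt_trans i0 _.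
by rewrite big_map /= [LHS]free_expand.
Qed.

(** * Koszul complexes *)

Section KoszulSigns.
Variable n : nat.
Implicit Types (i j : 'I_n) (S T U : {set 'I_n}).

(** The exterior algebra sign: the parity of the number of generators of [e_S] that precede
    [e_i]. *)
Definition psgn i S : bool := odd #|[set j in S | (j < i)%N]|.

Lemma psgn_setD1 i j S : j \in S -> psgn i S = psgn i (S :\ j) (+) (j < i)%N.
Proof.
move=> jS; rewrite /psgn (cardsD1 j) inE jS /= oddD addbC.
have -> : [set l in S | (l < i)%N] :\ j = [set l in S :\ j | (l < i)%N].
  by apply/setP => l; rewrite !inE andbA.
by case: (_ < _)%N.
Qed.

Lemma psgn_setU1 i j S : i \notin S -> psgn j (i |: S) = psgn j S (+) (i < j)%N.
Proof. by move=> iS; rewrite (psgn_setD1 _ (setU11 i S)) setU1K. Qed.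

Lemma psgn_setU1_id i S : i \notin S -> psgn i (i |: S) = psgn i S.
Proof. by move=> iS; rewrite psgn_setU1 // ltnn addbF. Qed.

Let ltn_xor i j : i != j -> (i < j)%N = ~~ (j < i)%N.
Proof. by rewrite -val_eqE /=; case: ltngtP. Qed.

(** Exterior multiplication by [e_i] and contraction by [e_j] anticommute. *)
Lemma psgn_cross i j S : i \notin S -> j \in S ->
  psgn i S (+) psgn j (i |: S) = ~~ (psgn j S (+) psgn i (S :\ j)).
Proof.
move=> iS jS; have ij : i != j by apply: contraNneq iS => ->.
rewrite (psgn_setD1 i jS) (psgn_setU1 j iS) (ltn_xor ij).
by case: psgn; case: psgn; case: (_ < _)%N.
Qed.

Lemma psgn_swap i j U : i \in U -> j \in U -> i != j ->
  psgn i U (+) psgn j (U :\ i) = ~~ (psgn j U (+) psgn i (U :\ j)).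
Proof.
move=> iU jU ij; rewrite (psgn_setD1 i jU) (psgn_setD1 j iU) (ltn_xor ij).
by case: psgn; case: psgn; case: (_ < _)%N.
Qed.

Section Operators.
Variable V : zmodType.
Implicit Types (v : V) (c : {set 'I_n} -> V).

Definition sg (b : bool) (v : V) : V := if b then - v else v.

Lemma sg_addb a b v : sg (a (+) b) v = sg a (sg b v).
Proof. by case: a; case: b; rewrite /= ?opprK. Qed.
Lemma sgK b v : sg b (sg b v) = v.
Proof. by rewrite -sg_addb addbb. Qed.
Lemma sgN b v : sg (~~ b) v = - sg b v.
Proof. by case: b; rewrite /= ?opprK. Qed.
Lemma sg0 b : sg b 0 = 0. Proof. by case: b; rewrite //= oppr0. Qed.
Lemma sgD b v w : sg b (v + w) = sg b v + sg b w.
Proof. by case: b; rewrite //= opprD. Qed.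
Lemma sg_sum b (I : Type) (s : seq I) (P : pred I) (F : I -> V) :
  sg b (\sum_(i <- s | P i) F i) = \sum_(i <- s | P i) sg b (F i).
Proof. by case: b => //=; rewrite sumrN. Qed.
Lemma sg_opp b v : sg b (- v) = - sg b v.
Proof. by case: b. Qed.

(* The first argument of [f] and [g] is the cardinality of the set at which the
   result is taken. *)
Variables f g : nat -> 'I_n -> V -> V.

(** Contraction, and below it exterior multiplication, combined with operators on the coefficients.
    The Koszul differential, its transpose and the de Rham homotopies all have one of these two
    shapes. *)
Definition kdown c S : V := \sum_(i | i \notin S) sg (psgn i S) (f #|S| i (c (i |: S))).
Definition kup c S : V := \sum_(i in S) sg (psgn i S) (g #|S| i (c (S :\ i))).

Hypothesis fB : forall p i v w, f p i (v - w) = f p i v - f p i w.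
Hypothesis gB : forall p i v w, g p i (v - w) = g p i v - g p i w.

Let f0 p i : f p i 0 = 0. Proof. by rewrite -{1}(subrr 0) fB subrr. Qed.
Let fN p i v : f p i (- v) = - f p i v. Proof. by rewrite -[- v]sub0r fB f0 sub0r. Qed.
Let fD p i v w : f p i (v + w) = f p i v + f p i w.
Proof. by rewrite -{1}[w]opprK fB fN opprK. Qed.
Let f_sg p i b v : f p i (sg b v) = sg b (f p i v).
Proof. by case: b => //=; rewrite fN. Qed.
Let f_sum p i (J : Type) (s : seq J) (P : pred J) (F : J -> V) :
  f p i (\sum_(j <- s | P j) F j) = \sum_(j <- s | P j) f p i (F j).
Proof. exact: (big_morph (f p i) (fD p i) (f0 p i)). Qed.
Let g0 p i : g p i 0 = 0. Proof. by rewrite -{1}(subrr 0) gB subrr. Qed.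
Let gN p i v : g p i (- v) = - g p i v. Proof. by rewrite -[- v]sub0r gB g0 sub0r. Qed.
Let gD p i v w : g p i (v + w) = g p i v + g p i w.
Proof. by rewrite -{1}[w]opprK gB gN opprK. Qed.
Let g_sg p i b v : g p i (sg b v) = sg b (g p i v).
Proof. by case: b => //=; rewrite gN. Qed.
Let g_sum p i (J : Type) (s : seq J) (P : pred J) (F : J -> V) :
  g p i (\sum_(j <- s | P j) F j) = \sum_(j <- s | P j) g p i (F j).
Proof. exact: (big_morph (g p i) (gD p i) (g0 p i)). Qed.

Hypothesis fg : forall p i j v, i != j -> f p.+1 i (g p.+2 j v) = g p.+1 j (f p i v).

(** A Cartan formula: the terms with distinct indices cancel in pairs, since the exterior signs
    anticommute while the coefficient operators commute by [fg]. Only the terms with equal indices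
    survive. *)
Lemma kdown_kup c S : kdown (kup c) S + kup (kdown c) S =
  \sum_(i | i \notin S) f #|S| i (g #|S|.+1 i (c S)) +
  \sum_(i in S) g #|S| i (f #|S|.-1 i (c S)).
Proof.
pose F i j := sg (psgn i S (+) psgn j (i |: S))
  (f #|S| i (g #|S|.+1 j (c ((i |: S) :\ j)))).
have -> : kdown (kup c) S = \sum_(i | i \notin S) f #|S| i (g #|S|.+1 i (c S)) +
    \sum_(i | i \notin S) \sum_(j in S) F i j.
  rewrite -big_split; apply: eq_bigr => i iS.
  rewrite /kup f_sum sg_sum (bigD1 i) ?setU11 //= cardsU1 iS add1n.
  rewrite f_sg psgn_setU1_id // sgK setU1K //; congr (_ + _).
  apply: eq_big => [j|j jS]; last by rewrite f_sg -sg_addb.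
  by rewrite !inE; case: eqVneq => [->|]; rewrite ?(negbTE iS) ?andbT.
have -> : kup (kdown c) S = \sum_(i in S) g #|S| i (f #|S|.-1 i (c S)) +
    \sum_(j in S) \sum_(i | i \notin S) - F i j.
  rewrite -big_split; apply: eq_bigr => j jS.
  have cS : #|S :\ j| = #|S|.-1 by rewrite (cardsD1 j S) jS.
  rewrite /kdown g_sum sg_sum (bigD1 j) ?setD11 //= cS.
  rewrite g_sg setD1K // {1}(psgn_setD1 j jS) ltnn addbF sgK; congr (_ + _).
  apply: eq_big => [i|i /andP[iSj ij]].
    by rewrite !inE negb_and negbK; case: eqVneq => [->|]; rewrite ?jS ?andbT.
  have iS : i \notin S by move: iSj; rewrite !inE negb_and negbK (negbTE ij).
  rewrite g_sg -sg_addb /F (psgn_cross iS jS) sgN opprK; congr sg.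
  have [p pE] : exists p, #|S| = p.+1.
    by exists #|S :\ j|; rewrite (cardsD1 j S) jS.
  rewrite pE /= fg //; congr (g _ _ (f _ _ (c _))).
  apply/setP => l; rewrite !inE; case: (eqVneq l i) => [->|//]; by rewrite ij.
rewrite addrACA [X in _ + (_ + X)]exchange_big /= -big_split /=.
rewrite [X in _ + X]big1 ?addr0 // => i _; rewrite -big_split big1 // => j _.
by rewrite /= subrr.
Qed.

End Operators.
End KoszulSigns.

(** * Lowering a filtration with Euler operators *)

Section EulerDescent.
Variables (k : fieldType) (V : lmodType k) (X : finType).
Hypothesis hk : [pchar k] =i pred0.

(* [fil r v] says that [v] has order less than [r]. *)
Record is_filtration (fil : nat -> V -> Prop) : Prop := IsFiltration {
  fil0 : forall v, fil 0%N v -> v = 0;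
  fil_zero : forall r, fil r 0;
  fil_scale : forall r (a : k) v, fil r v -> fil r (a *: v);
  fil_mono : forall r s v, (r <= s)%N -> fil r v -> fil s v;
  fil_ex : forall v, exists r, fil r v }.

Variable fil : nat -> V -> Prop.
Hypothesis filP : is_filtration fil.
Variables (wt : X -> nat) (L : X -> V -> V).

(* [L] acts on the symbols of order [r] as the scalar [r + wt x]. *)
Hypothesis L0 : forall x, L x 0 = 0.
Hypothesis L_euler : forall x r v, fil r.+1 v ->
  fil r (L x v - (r + wt x)%:R *: v).

Lemma natk_neq0 m : (m.+1%:R : k) != 0.
Proof. by rewrite (pcharf0P k).1. Qed.

(** If the order at [x] is at most [m.+1 - wt x], the eigenvalue on the leading symbol is [m.+1]
    whatever [x] is, so one scalar removes the leading symbols at all [x] simultaneously. Where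
    [wt x] exceeds [m.+1], the truncated bound already forces [c x = 0]. *)
Lemma euler_step m (c : X -> V) : (forall x, fil (m.+2 - wt x) (c x)) ->
  forall x, fil (m.+1 - wt x) (c x - m.+1%:R^-1 *: L x (c x)).
Proof.
move=> hc x; case: (leqP (wt x) m.+1) => hx; last first.
  have := hc x; rewrite (eqP (hx : m.+2 - wt x == 0)%N) => /(fil0 filP)->.
  by rewrite L0 scaler0 subr0; apply: fil_zero.
have := hc x; rewrite (subSn hx) => /(L_euler x); rewrite subnK //.
move=> /(fil_scale filP (- m.+1%:R^-1)).
by rewrite scalerBr scalerA mulNr mulVf ?natk_neq0 // scaleN1r opprK scaleNr addrC.
Qed.

Lemma fil_bound (c : X -> V) : exists m, forall x, fil (m.+1 - wt x) (c x).
Proof.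
pose r x := projT1 (cid (fil_ex filP (c x))).
have hr x : fil (r x) (c x) := projT2 (cid (fil_ex filP (c x))).
exists (\sum_x (r x + wt x))%N => x; apply: (fil_mono filP _ (hr x)).
rewrite leq_subRL (bigD1 x) //=; last first.
  by apply: leqW; rewrite -addnA addnCA leq_addr.
by apply: leqW; rewrite [(wt x + _)%N]addnC leq_addr.
Qed.

End EulerDescent.

Section KoszulModule.
Variables (k : fieldType) (A : dgAlgebra k) (n : nat).
Hypothesis hk : [pchar k] =i pred0.
Variable z : nat -> 'I_n -> A.
Implicit Types (S T U : {set 'I_n}) (i j : 'I_n).
Hypothesis diff0 : forall a : A, dga_diff a = 0.
Hypothesis z_deg : forall p i, of_deg (@dga_comp k A) 1 (z p i).
Hypothesis z_comm : forall p i j, z p.+2 i * z p.+1 j = z p.+2 j * z p.+1 i.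

(** The sum has at most one term, as [T] and [S] determine [i]. The dependence of [z] on the
    cardinality of [T] lets one construction serve both for [A] and for [A^e], where signs alternate
    with the cardinality. *)
Definition kmat T S : A := \sum_(i in T | T :\ i == S) sg (psgn i T) (z #|T| i).

Lemma kmat_deg T S : of_deg (@dga_comp k A) 1 (kmat T S).
Proof.
have gA := dga_grading A; apply: (big_ind (of_deg (@dga_comp k A) 1)).
- exact: of_deg0.
- by move=> x y; apply: of_degD.
by move=> i _; rewrite /sg; case: psgn; [apply: of_degN|].
Qed.

Lemma kmat_suml T (F : {set 'I_n} -> A) :
  \sum_S kmat T S * F S = \sum_(i in T) sg (psgn i T) (z #|T| i * F (T :\ i)).
Proof.
transitivity (\sum_S \sum_(i in T | T :\ i == S) sg (psgn i T) (z #|T| i * F (T :\ i))).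
  apply: eq_bigr => S _; rewrite mulr_suml; apply: eq_bigr => i /andP[_ /eqP->].
  by rewrite /sg; case: psgn; rewrite ?mulNr.
by rewrite -(partition_big (fun i => T :\ i) xpredT).
Qed.

Lemma kmat_sumr S (F : {set 'I_n} -> A) :
  \sum_T F T * kmat T S =
  \sum_(i | i \notin S) sg (psgn i S) (F (i |: S) * z #|S|.+1 i).
Proof.
transitivity (\sum_(T : {set 'I_n}) \sum_(i | (i \in T) && (T :\ i == S))
    sg (psgn i T) (F T * z #|T| i)).
  apply: eq_bigr => T _; rewrite mulr_sumr; apply: eq_bigr => i _.
  by rewrite /sg; case: psgn; rewrite ?mulrN.
rewrite (exchange_big_dep (fun i => i \notin S)) /=; last first.
  by move=> T i _ /andP[_ /eqP<-]; rewrite setD11.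
apply: eq_bigr => i iS; rewrite (big_pred1 (i |: S)).
  by rewrite psgn_setU1_id // cardsU1 iS.
move=> T /=; apply/andP/eqP => [[iT /eqP<-]|->]; first by rewrite setD1K.
by rewrite setU11 setU1K.
Qed.

(** Deleting [i] and [j] in the two possible orders gives opposite exterior signs by [psgn_swap] and
    equal coefficients by [z_comm]. *)
Lemma kmat_sq U S : \sum_T kmat U T * kmat T S = 0.
Proof.
rewrite kmat_suml.
pose F i j := if U :\ i :\ j == S then
  sg (psgn i U (+) psgn j (U :\ i)) (z #|U| i * z #|U|.-1 j) else 0.
have FN i j : i \in U -> j \in U -> i != j -> F i j = - F j i.
  move=> iU jU ij; rewrite /F psgn_swap // sgN.
  have -> : U :\ i :\ j = U :\ j :\ i by apply/setP => l; rewrite !inE andbCA.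
  case: eqP; rewrite ?oppr0 // => _; congr (- sg _ _).
  have [p pE] : exists p, #|U| = p.+2.
    exists #|U :\ i :\ j|; rewrite (cardsD1 i U) iU (cardsD1 j (U :\ i)).
    by rewrite !inE eq_sym ij jU.
  by rewrite pE.
transitivity (\sum_(i in U) \sum_(j in U | j != i) F i j).
  apply: eq_bigr => i iU; rewrite mulr_sumr sg_sum [RHS]big_mkcondr /= big_mkcond.
  rewrite [RHS]big_mkcond; apply: eq_bigr => j _; rewrite !inE /F.
  rewrite (cardsD1 i U) iU /=.
  case: (j \in U); case: (j != i); rewrite //=; case: eqP => // _.
  by rewrite sg_addb; congr sg; rewrite /sg; case: psgn; rewrite ?mulrN.
(* Splitting by the order of [i] and [j] matches each term with its opposite; antisymmetry alone
   would only show that twice the sum vanishes. *)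
transitivity (\sum_(i in U) (\sum_(j in U | (j < i)%N) F i j +
                             \sum_(j in U | (i < j)%N) F i j)).
  apply: eq_bigr => i iU; rewrite (bigID (fun j : 'I_n => (j < i)%N)) /=.
  congr (_ + _); apply: eq_bigl => j; rewrite -andbA; congr (_ && _);
    by rewrite -val_eqE /=; case: ltngtP.
rewrite big_split /= [X in _ + X](exchange_big_dep (mem U)) //=; last first.
  by move=> i j iU /andP[].
rewrite -big_split big1 // => i iU /=.
rewrite [X in _ + X](eq_bigl (fun j => (j \in U) && (j < i)%N)) => [|j]; last first.
  by rewrite iU.
rewrite -big_split big1 // => j /andP[jU ji]; rewrite FN //; first exact: addNr.
by rewrite -val_eqE /= gtn_eqF.
Qed.

Definition koszul_dg : dgModule A := free_dg diff0 kmat_deg kmat_sq.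
Definition koszul_basis : {set 'I_n} -> koszul_dg := free_basis diff0 kmat_deg kmat_sq.

Lemma koszul_semibasis :
  is_semibasis koszul_basis (fun=> 0) (fun T : {set 'I_n} => #|T|).
Proof.
apply: free_semibasis => T S; apply: contraNT; rewrite -leqNgt => h.
rewrite /kmat big1 // => i /andP[iT /eqP TS].
by move: h; rewrite -TS (cardsD1 i T) iT ltnn.
Qed.

Definition koszul_val (x : koszul_dg) (S : {set 'I_n}) : A := (x : {ffun _ -> A^o}) S.
Definition koszul_coval (phi : dg_dual koszul_dg) (S : {set 'I_n}) : A :=
  (phi : dualT koszul_dg) (koszul_basis S).

(** Here [p] is the cardinality of the index of the result, whereas [z] is indexed by the larger of
    the two sets: hence [p.+1] here and [p] in [kz_up]. The [gsign 1] is the Leibniz sign. *)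
Definition kz_down p i (v : A) : A := gsign 1 v * z p.+1 i.
Definition kz_up p i (v : A) : A := - (z p i * v).

Lemma kz_downB p i v w : kz_down p i (v - w) = kz_down p i v - kz_down p i w.
Proof. by rewrite /kz_down gsignD gsignN mulrBl. Qed.
Lemma kz_upB p i v w : kz_up p i (v - w) = kz_up p i v - kz_up p i w.
Proof. by rewrite /kz_up mulrBr opprD. Qed.

Lemma koszul_valB x y S : koszul_val (x - y) S = koszul_val x S - koszul_val y S.
Proof. by rewrite /koszul_val !ffunE. Qed.
Lemma koszul_covalB phi chi S :
  koszul_coval (phi - chi) S = koszul_coval phi S - koszul_coval chi S.
Proof. by []. Qed.

Lemma koszul_diffE x S :
  koszul_val (dgm_diff x) S = kdown kz_down (koszul_val x) S.
Proof. by rewrite [LHS]ffunE kmat_sumr. Qed.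

Lemma koszul_codiffE phi T :
  koszul_coval (dgm_diff phi) T = kup kz_up (koszul_coval phi) T.
Proof.
rewrite /koszul_coval [LHS]dual_diff_basis kmat_suml -sumrN.
by apply: eq_bigr => i _; rewrite sg_opp.
Qed.

Variable fil : nat -> A -> Prop.
Hypothesis filP : is_filtration fil.

(** The homotopy is [kup g], with total weight order plus [#|S|]. The truncated [1 - #|S|] in the
    conclusion says that all coordinates at nonempty [S] vanish and that the one at the empty set
    has order 0. *)
Lemma koszul_descent (g : nat -> 'I_n -> A -> A) :
    (forall p i v w, g p i (v - w) = g p i v - g p i w) ->
    (forall p i j v, i != j -> kz_down p.+1 i (g p.+2 j v) = g p.+1 j (kz_down p i v)) ->
    (forall S r v, fil r.+1 v ->
      fil r (\sum_(i | i \notin S) kz_down #|S| i (g #|S|.+1 i v) +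
        \sum_(i in S) g #|S| i (kz_down #|S|.-1 i v) - (r + #|S|)%:R *: v)) ->
  forall x, dgm_diff x = 0 ->
    exists w, forall S, fil (1 - #|S|) (koszul_val (x - dgm_diff w) S).
Proof.
move=> gB gcomm gE x dx.
pose L S v := \sum_(i | i \notin S) kz_down #|S| i (g #|S|.+1 i v) +
        \sum_(i in S) g #|S| i (kz_down #|S|.-1 i v).
have g0 p i : g p i 0 = 0 by rewrite -{1}(subrr 0) gB subrr.
have d0 p i : kz_down p i 0 = 0 by rewrite /kz_down gsign0 mul0r.
have L0 S : L S 0 = 0 by rewrite /L !big1 ?addr0 // => i _; rewrite ?g0 ?d0 ?g0.
have [m hm] := fil_bound filP (fun S : {set 'I_n} => #|S|) (koszul_val x).
elim: m x dx hm => [|m IH] x dx hm.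
  by exists 0 => S; rewrite dgm_diff0 subr0.
(* On a cocycle the Cartan formula reduces to one term, so the differential of [kup g] of it is [L]
   applied coordinatewise. *)
pose w : koszul_dg := [ffun S => m.+1%:R^-1 *: kup g (koszul_val x) S] : {ffun _ -> A^o}.
have dw S : koszul_val (dgm_diff w) S = m.+1%:R^-1 *: L S (koszul_val x S).
  rewrite koszul_diffE /L -kdown_kup //; last exact: kz_downB.
  have -> : kdown kz_down (koszul_val x) = fun=> 0.
    by apply/funext => T; rewrite -koszul_diffE dx /koszul_val ffunE.
  rewrite [X in _ + X]big1 ?addr0 => [|i _]; last by rewrite g0 sg0.
  rewrite scaler_sumr; apply: eq_bigr => i _.
  rewrite /koszul_val ffunE /kz_down gsignZ -scalerAl.
  by rewrite /sg; case: psgn; rewrite ?scalerN.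
have [||w' hw'] := IH (x - dgm_diff w).
- by rewrite dgm_diffB dx dgm_diffK subrr.
- move=> S; rewrite koszul_valB dw.
  exact: (euler_step hk filP L0 gE hm).
exists (w + w') => S; rewrite dgm_diffD opprD addrA; exact: hw'.
Qed.

(** On the dual the homotopy is [kdown f] and the weight [n - #|S|], so the surviving coordinate is
    the one at the full set. *)
Lemma koszul_codescent (f : nat -> 'I_n -> A -> A) :
    (forall p i v w, f p i (v - w) = f p i v - f p i w) ->
    (forall p i j v, i != j -> f p.+1 i (kz_up p.+2 j v) = kz_up p.+1 j (f p i v)) ->
    (forall S r v, fil r.+1 v ->
      fil r (\sum_(i | i \notin S) f #|S| i (kz_up #|S|.+1 i v) +
        \sum_(i in S) kz_up #|S| i (f #|S|.-1 i v) - (r + (n - #|S|))%:R *: v)) ->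
  forall phi, dgm_diff phi = 0 ->
    exists chi, forall S, fil (1 - (n - #|S|)) (koszul_coval (phi - dgm_diff chi) S).
Proof.
move=> fB fcomm fE phi dphi.
pose L S v := \sum_(i | i \notin S) f #|S| i (kz_up #|S|.+1 i v) +
        \sum_(i in S) kz_up #|S| i (f #|S|.-1 i v).
have f0 p i : f p i 0 = 0 by rewrite -{1}(subrr 0) fB subrr.
have u0 p i : kz_up p i 0 = 0 by rewrite /kz_up mulr0 oppr0.
have L0 S : L S 0 = 0 by rewrite /L !big1 ?addr0 // => i _; rewrite ?f0 ?u0 ?f0.
have [m hm] := fil_bound filP (fun S : {set 'I_n} => n - #|S|)%N (koszul_coval phi).
elim: m phi dphi hm => [|m IH] phi dphi hm.
  by exists 0 => S; rewrite dgm_diff0 subr0.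
pose chi : dg_dual koszul_dg := free_dual diff0 kmat_deg kmat_sq
  (fun S => m.+1%:R^-1 *: kdown f (koszul_coval phi) S).
have chiE S : koszul_coval chi S = m.+1%:R^-1 *: kdown f (koszul_coval phi) S.
  exact: free_dualE.
have dchi S : koszul_coval (dgm_diff chi) S = m.+1%:R^-1 *: L S (koszul_coval phi S).
  rewrite koszul_codiffE /L -kdown_kup //; last exact: kz_upB.
  have -> : kup kz_up (koszul_coval phi) = fun=> 0.
    by apply/funext => T; rewrite -koszul_codiffE dphi.
  rewrite [X in _ *: (X + _)]big1 ?add0r => [|i _]; last by rewrite f0 sg0.
  rewrite scaler_sumr; apply: eq_bigr => i _.
  by rewrite chiE /kz_up -scalerAr -scalerN /sg; case: psgn; rewrite ?scalerN.
have [||w' hw'] := IH (phi - dgm_diff chi).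
- by rewrite dgm_diffB dphi dgm_diffK subrr.
- move=> S; rewrite koszul_covalB dchi.
  exact: (euler_step hk filP L0 fE hm).
exists (chi + w') => S; rewrite dgm_diffD opprD addrA; exact: hw'.
Qed.

End KoszulModule.

(** * The polynomial algebra *)

Section Polynomials.
Variables (k : fieldType) (n : nat).
Notation A := (trivial_poly_dga k n).
Notation cA := (@dga_comp k A).
Implicit Types (i j : 'I_n) (m : 'X_{1..n}).

Definition pvar i : A := ('X_i : {mpoly k[n]}).
Definition pder i (a : A) : A := mderiv i (a : {mpoly k[n]}).
Definition pcoef m (a : A) : k := (a : {mpoly k[n]})@_m.
Definition pfil (r : nat) (a : A) : Prop := forall m, (r <= mdeg m)%N -> pcoef m a = 0.

Lemma pcoefP (a b : A) : (forall m, pcoef m a = pcoef m b) -> a = b.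
Proof. by move=> h; apply/mpolyP. Qed.

Lemma pdiff0 (a : A) : dga_diff a = 0. Proof. by []. Qed.
Lemma pmulC (a b : A) : a * b = b * a. Proof. exact: (@mulrC {mpoly k[n]}). Qed.

Lemma pcoef_comp d m (a : A) : pcoef m (cA d a) = if d == mdeg m then pcoef m a else 0.
Proof.
case: d => d; last exact: mcoeff0.
rewrite /pcoef /= pihomogE raddf_sum /= eqz_nat.
have [hm|hm] := boolP (m \in msupp (a : {mpoly k[n]})).
  rewrite big_mkcond (bigD1_seq m) ?msupp_uniq //= big1 ?addr0 => [|m' mm'].
    by rewrite eq_sym; case: eqP; rewrite // mcoeffZ mcoeffX eqxx mulr1.
  by case: eqP; rewrite // mcoeffZ mcoeffX (negbTE mm') mulr0.
rewrite (memN_msupp_eq0 hm) if_same big_seq_cond big1 // => m' /andP[hm' _].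
rewrite mcoeffZ mcoeffX; case: eqP => [mm'|]; last by rewrite mulr0.
by rewrite -mm' hm' in hm.
Qed.

Lemma pdegP d (a : A) :
  of_deg cA d a <-> forall m, d != mdeg m -> pcoef m a = 0.
Proof.
split=> [<- m dm|h]; first by rewrite pcoef_comp (negbTE dm).
by apply: pcoefP => m; rewrite pcoef_comp; case: eqP => // /eqP/h.
Qed.

Lemma pvar_deg i : of_deg cA 1 (pvar i).
Proof.
apply/pdegP => m; rewrite /pcoef /pvar mcoeffX.
by case: (U_(i)%MM =P m) => // <-; rewrite mdeg1.
Qed.

Lemma pder_deg i d (a : A) : of_deg cA d a -> of_deg cA (d - 1) (pder i a).
Proof.
move=> /pdegP ha; apply/pdegP => m dm.
rewrite /pcoef /pder mcoeff_deriv [X in X *+ _](ha (m + U_(i))%MM) ?mul0rn //.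
by apply: contra dm => /eqP->; rewrite mdegD mdeg1 PoszD addrK.
Qed.

Lemma pderD i (a b : A) : pder i (a + b) = pder i a + pder i b.
Proof. exact: mderivD. Qed.
Lemma pder0 i : pder i 0 = 0. Proof. exact: mderiv0. Qed.
Lemma pderN i (a : A) : pder i (- a) = - pder i a.
Proof. exact: mderivN. Qed.
Lemma pderB i (a b : A) : pder i (a - b) = pder i a - pder i b.
Proof. exact: mderivB. Qed.
Lemma pderZ i (c : k) (a : A) : pder i (c *: a) = c *: pder i a.
Proof. exact: mderivZ. Qed.
Lemma pder_ksign i d (a : A) : pder i (ksign d a) = ksign d (pder i a).
Proof. by rewrite /ksign; case: par; rewrite ?pderN. Qed.

Lemma pder_var i j (a : A) :
  pder i (pvar j * a) = (if i == j then a else 0) + pvar j * pder i a.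
Proof.
rewrite /pder [X in mderiv i X = _]/(_ * _) mderivM; congr (_ + _).
rewrite mderivX mnmE eq_sym; case: eqP => [->|_]; last by rewrite scale0r mul0r.
by rewrite -{1}[U_(j)%MM]add0m addmK mpolyX0 scale1r mul1r.
Qed.

Lemma pder_gsign i (a : A) : pder i (gsign 1 a) = - gsign 1 (pder i a).
Proof.
have gA := dga_grading A; elim/(gr_ind gA): a => [|a b ha hb|d a ha].
- by rewrite pder0 gsign0 pder0 oppr0.
- by rewrite gsignD !pderD ha hb gsignD opprD.
rewrite (gsignE _ ha) (gsignE _ (pder_deg i ha)) pder_ksign !mul1r /ksign parB.
by rewrite /= addbT; case: par; rewrite /= ?opprK.
Qed.

Lemma pfilP : is_filtration pfil.
Proof.
split=> [a h|r m _|r c a h m /h a0|r s a rs h m sm|a].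
- by apply: pcoefP => m; rewrite h // [RHS]mcoeff0.
- exact: mcoeff0.
- by rewrite /pcoef mcoeffZ [X in _ * X]a0 mulr0.
- by apply: h; apply: leq_trans sm.
- exists (msize (a : {mpoly k[n]})) => m hm; apply: memN_msupp_eq0.
  by apply: contraL hm => /msize_mdeg_lt; rewrite ltnNge.
Qed.

Lemma pfil_der i r (a : A) : pfil r.+1 a -> pfil r (pder i a).
Proof.
move=> h m rm; rewrite /pcoef /pder mcoeff_deriv [X in X *+ _](h (m + U_(i))%MM) ?mul0rn //.
by rewrite mdegD mdeg1 addn1.
Qed.

Lemma pfil1 (a : A) : pfil 1 a -> a = (cdga_aug a)%:A.
Proof.
move=> h; apply: pcoefP => m; rewrite /pcoef mcoeffZ mcoeff1.
have [->|m0] := eqVneq m 0%MM; first by rewrite mulr1.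
by rewrite mulr0; apply: h; rewrite lt0n mdeg_eq0.
Qed.

(** Euler's identity: monomials of degree [r] are eigenvectors with eigenvalue [r], so they cancel
    and only smaller degrees remain. *)
Lemma pfil_euler r (a : A) : pfil r.+1 a ->
  pfil r (\sum_i pvar i * pder i a - r%:R *: a).
Proof.
move=> ha m rm.
have EX m' : \sum_i 'X_i * mderiv i 'X_[m'] = (mdeg m')%:R *: 'X_[m'] :> {mpoly k[n]}.
  rewrite mdegE natr_sum scaler_suml; apply: eq_bigr => i _.
  rewrite mderivX -scalerAr; case: (posnP (m' i)) => [->|mi]; first by rewrite !scale0r.
  by rewrite -mpolyXD addmC submK // lep1mP -lt0n.
have E : \sum_i 'X_i * mderiv i a =
    \sum_(m' <- msupp (a : {mpoly k[n]})) (pcoef m' a * (mdeg m')%:R) *: 'X_[m']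
    :> {mpoly k[n]}.
  rewrite {1}(mpolyE (a : {mpoly k[n]})).
  under eq_bigr do rewrite raddf_sum mulr_sumr; rewrite exchange_big.
  apply: eq_bigr => m' _ /=; under eq_bigr do rewrite mderivZ -scalerAr.
  by rewrite -scaler_sumr EX scalerA.
have c0 m' : m' \in msupp (a : {mpoly k[n]}) -> (mdeg m' < r.+1)%N.
  move=> hm; rewrite ltnNge; apply: contraL hm => /ha h.
  by rewrite mcoeff_msupp -/(pcoef m' a) h eqxx.
suff -> : (\sum_i pvar i * pder i a - r%:R *: a : A) =
    \sum_(m' <- msupp (a : {mpoly k[n]})) (pcoef m' a * ((mdeg m')%:R - r%:R)) *: 'X_[m']
    :> {mpoly k[n]}.
  rewrite /pcoef raddf_sum big_seq big1 //= => m' hm'; rewrite mcoeffZ mcoeffX.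
  case: eqP => [mm'|]; last by rewrite mulr0.
  have -> : mdeg m' = r by apply/eqP; rewrite eqn_leq -ltnS c0 // mm' rm.
  by rewrite subrr mulr0 mul0r.
have aE : r%:R *: a =
    \sum_(m' <- msupp (a : {mpoly k[n]})) (pcoef m' a * r%:R) *: 'X_[m']
    :> {mpoly k[n]}.
  rewrite {1}(mpolyE (a : {mpoly k[n]})) scaler_sumr; apply: eq_bigr => m' _.
  by rewrite scalerA mulrC.
rewrite [X in X - _]E [X in _ - X]aE -sumrB.
by apply: eq_bigr => m' _; rewrite -scalerBl -mulrBr.
Qed.

End Polynomials.

(** With [a] and [b] the Euler sum over [S] and over its complement, [e] the multiple by [r] and [c]
    the multiple by the weight, this reduces the hypothesis of the descent to [pfil_euler]. *)
Lemma addr_shuffle (V : zmodType) (a b c e : V) :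
  (a + b) - e = b + (c + a) - (e + c).
Proof. by rewrite [c + a]addrC addrA [e + c]addrC addrKA [b + a]addrC. Qed.

Section Augmentation.
Variables (k : fieldType) (A : connDGAlgebra k).

Lemma augN (a : A) : cdga_aug (- a) = - cdga_aug a.
Proof. by apply: (addrI (cdga_aug a)); rewrite -augD !subrr aug0. Qed.

Lemma aug_sum (I : Type) (s : seq I) (P : pred I) (F : I -> A) :
  cdga_aug (\sum_(i <- s | P i) F i) = \sum_(i <- s | P i) cdga_aug (F i).
Proof. exact: (big_morph (@cdga_aug k A) (@augD k A) (aug0 A)). Qed.

Lemma aug_sg b (a : A) : cdga_aug a = 0 -> cdga_aug (sg b a) = 0.
Proof. by case: b => //= a0; rewrite augN a0 oppr0. Qed.

End Augmentation.

(** * The Koszul complex of the polynomial algebra and its dual *)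

Section KoszulPoly.
Variables (k : fieldType) (n : nat).
Hypothesis hk : [pchar k] =i pred0.
Notation A := (trivial_poly_dga k n).
Notation cA := (@dga_comp k A).
Implicit Types (i j : 'I_n) (S T : {set 'I_n}).

Let z (p : nat) i : A := pvar k i.
Let z_deg p i : of_deg cA 1 (z p i). Proof. exact: pvar_deg. Qed.
Let z_comm p i j : z p.+2 i * z p.+1 j = z p.+2 j * z p.+1 i.
Proof. exact: pmulC. Qed.

Notation K := (koszul_dg (@pdiff0 k n) z_deg z_comm).
Notation val := (@koszul_val k A n z (@pdiff0 k n) z_deg z_comm).
Notation coval := (@koszul_coval k A n z (@pdiff0 k n) z_deg z_comm).

(** Each [i] in [S] contributes an extra [v], from differentiating [x_i v]; this is the origin of
    the weight [#|S|]. The [gsign 1] in the homotopy offsets the one in [kz_down]. *)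
Lemma poly_koszul_exact (x : K) : dgm_diff x = 0 ->
  exists w, forall S, pfil (1 - #|S|) (val (x - dgm_diff w) S).
Proof.
apply: (koszul_descent hk (@pfilP k n) (g := fun _ i v => gsign 1 (pder i v))).
- by move=> p i v w; rewrite pderB gsignD gsignN.
- move=> p i j v ij; rewrite /kz_down /z gsignK [gsign 1 v * _]pmulC pder_var eq_sym.
  rewrite (negbTE ij) add0r gsignM pder_gsign gsignN gsignK (gsignE _ (pvar_deg k i)).
  by rewrite /ksign /= mulrN mulNr opprK pmulC.
move=> S r v hv; rewrite /kz_down /z.
have -> : \sum_(i | i \notin S) gsign 1 (gsign 1 (pder i v)) * pvar k i =
    \sum_(i | i \notin S) pvar k i * pder i v.
  by apply: eq_bigr => i _; rewrite gsignK pmulC.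
have -> : \sum_(i in S) gsign 1 (pder i (gsign 1 v * pvar k i)) =
    #|S|%:R *: v + \sum_(i in S) pvar k i * pder i v.
  rewrite scaler_nat -sumr_const -big_split; apply: eq_bigr => i _ /=.
  rewrite [gsign 1 v * _]pmulC pder_var eqxx gsignD gsignK; congr (_ + _).
  rewrite gsignM pder_gsign gsignN gsignK (gsignE _ (pvar_deg _ i)).
  by rewrite /ksign /= mulrN mulNr opprK.
have := pfil_euler hv; congr pfil.
by rewrite (bigID (mem S)) /= natrD scalerDl -addr_shuffle.
Qed.

Definition koszul_aug (x : K) : dg_triv A := cdga_aug (val x set0).

Lemma koszul_aug_hom : dg_hom koszul_aug.
Proof.
split; first split.
- by move=> x y; rewrite /koszul_aug -augD /koszul_val ffunE.
- move=> d x /free_deg/(_ set0) hx; rewrite addr0 /of_deg /= /triv_comp.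
  by case: eqP => // /eqP d0; rewrite /koszul_aug (aug_deg hx d0).
- by move=> d a x _; rewrite mul0r /koszul_aug /koszul_val ffunE; apply: augM.
move=> x; rewrite /koszul_aug koszul_diffE aug_sum big1 // => i _.
by apply: aug_sg; rewrite augM (aug_deg (z_deg _ _)) // mulr0.
Qed.

Lemma koszul_aug_qi : quasi_iso koszul_aug.
Proof.
split; first exact: koszul_aug_hom.
  move=> x dx [y xy]; have [w hw] := poly_koszul_exact dx; exists w.
  apply/eqP; rewrite -subr_eq0; apply/eqP/ffunP => S; rewrite [RHS]ffunE.
  rewrite -[LHS]/(val (x - dgm_diff w) S); have := hw S.
  have [->|/set0Pn[i iS]] := eqVneq S set0; last first.
    by rewrite (cardsD1 i S) iS => /(fil0 (@pfilP k n)).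
  rewrite cards0 => /pfil1->.
  (* The constant left at the empty set is the augmentation of a cocycle whose image is a boundary
     of [dg_triv], hence 0. *)
  rewrite -[cdga_aug _]/(koszul_aug (x - dgm_diff w)).
  have [h dh] := koszul_aug_hom.
  by rewrite (ghB h) dh xy [X in X - _]/= [X in _ - X]/= subrr scale0r.
move=> c _; pose x : K := [ffun S => if S == set0 then c%:A else 0] : {ffun _ -> A^o}.
exists x; last first.
  exists 0; rewrite dgm_diff0 addr0 /koszul_aug /koszul_val ffunE eqxx augZ aug1.
  by rewrite mulr1.
apply/ffunP => S; rewrite [RHS]ffunE -[LHS]/(val (dgm_diff x) S) koszul_diffE.
rewrite /kdown big1 // => i _; rewrite /koszul_val ffunE.
have /negbTE-> : i |: S != set0 by apply/set0Pn; exists i; rewrite setU11.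
by rewrite /kz_down gsign0 mul0r sg0.
Qed.

Lemma poly_koszul : koszul A.
Proof.
exists K, koszul_aug; split; [exact: koszul_aug_qi|exact: free_minimal|].
exists {set 'I_n}, (koszul_basis _ _ _), (fun T : {set 'I_n} => #|T|).
exact: koszul_semibasis.
Qed.

Lemma poly_smooth : homologically_smooth A.
Proof. exact: finite_semi_free_compact (koszul_semibasis _ _ _) _ koszul_aug_qi. Qed.

(** Now the indices outside [S] contribute the extra [v], whence the weight [n - #|S|]. The minus
    sign in the homotopy matches that of [kz_up]. *)
Lemma poly_koszul_coexact (phi : dg_dual K) : dgm_diff phi = 0 ->
  exists chi, forall S, pfil (1 - (n - #|S|)) (coval (phi - dgm_diff chi) S).
Proof.
apply: (koszul_codescent hk (@pfilP k n) (f := fun _ i v => - pder i v)).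
- by move=> p i v w; rewrite pderB opprD.
- move=> p i j v ij; rewrite /kz_up /z pderN opprK pder_var (negbTE ij) add0r.
  by rewrite mulrN opprK.
move=> S r v hv; rewrite /kz_up /z.
have -> : \sum_(i | i \notin S) - pder i (- (pvar k i * v)) =
    (n - #|S|)%:R *: v + \sum_(i | i \notin S) pvar k i * pder i v.
  have -> : (n - #|S|)%N = #|~: S| by rewrite [RHS]cardsCs setCK card_ord.
  rewrite scaler_nat -sumr_const [in RHS](eq_bigl (fun i => i \notin S)) => [|i]; last first.
    by rewrite inE.
  rewrite -big_split; apply: eq_bigr => i _ /=.
  by rewrite pderN opprK pder_var eqxx.
have -> : \sum_(i in S) - (pvar k i * - pder i v) = \sum_(i in S) pvar k i * pder i v.
  by apply: eq_bigr => i _; rewrite mulrN opprK.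
have := pfil_euler hv; congr pfil.
rewrite (bigID (mem S)) /= natrD scalerDl [X in _ = X - _]addrC -addr_shuffle.
by rewrite [X in _ = X - _]addrC.
Qed.

Let top_dual : dg_dual K := free_dual (@pdiff0 k n) (kmat_deg z_deg) (kmat_sq z_comm)
  (fun S => if S == setT then 1 else 0).

Let coval_top S : coval top_dual S = if S == setT then 1 else 0.
Proof. by rewrite [LHS]free_dualE. Qed.

Let coval_scale (c : k) phi S : coval ((c%:A : dga_op A) *: phi) S = c *: coval phi S.
Proof.
rewrite -[LHS]/(@opmul k A (c *: 1) (coval phi S)) -opmulZl.
by congr (_ *: _); apply: opmul1l.
Qed.

(** Hence the augmentation of the top coordinate depends only on the cohomology class, which yields
    the uniqueness of the scalar in [poly_gorenstein]. *)
Let coval_diff_top chi : cdga_aug (coval (dgm_diff chi) setT) = 0.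
Proof.
rewrite koszul_codiffE aug_sum big1 // => i _; apply: aug_sg.
by rewrite augN augM (aug_deg (z_deg _ _)) // mul0r oppr0.
Qed.

Lemma poly_gorenstein : gorenstein A.
Proof.
exists K, koszul_aug; split.
  split; last exact: koszul_aug_qi.
  exists {set 'I_n}, (koszul_basis _ _ _), (fun=> 0), (fun T : {set 'I_n} => #|T|).
  exact: koszul_semibasis.
exists (fun=> top_dual); split=> [_|phi dphi].
  apply: dual_eqP => S; rewrite -[LHS]/(coval (dgm_diff top_dual) S) koszul_codiffE.
  rewrite [RHS]dual0E /kup big1 // => i iS; rewrite coval_top.
  have /negbTE-> : S :\ i != setT.
    by apply: contraTneq (in_setT i) => <-; rewrite setD11.
  by rewrite /kz_up mulr0 oppr0 sg0.
have [chi hchi] := poly_koszul_coexact dphi.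
pose c := cdga_aug (coval (phi - dgm_diff chi) setT).
exists (\row__ c); split.
  exists chi; apply/eqP; rewrite -subr_eq; apply/eqP; apply: dual_eqP => S.
  rewrite big_ord1 mxE -[LHS]/(coval (phi - dgm_diff chi) S).
  rewrite -[RHS]/(coval ((c%:A : dga_op A) *: top_dual) S) coval_scale coval_top.
  have := hchi S; have [->|ST] := eqVneq S setT.
    by rewrite cardsT card_ord subnn => /pfil1->.
  have cS : (#|S| < n)%N.
    by rewrite -[X in (_ < X)%N]card_ord -cardsT proper_card // properT.
  have -> : (1 - (n - #|S|) = 0)%N by apply/eqP; rewrite subn_eq0 subn_gt0.
  move/(fil0 (@pfilP k n))->.
  by rewrite scaler0.
move=> c' [y phiE]; apply/rowP => i; rewrite mxE ord1 /c koszul_covalB.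
rewrite augD augN coval_diff_top subr0 phiE big_ord1.
rewrite -[coval _ _]/(coval ((c' 0 0)%:A *: top_dual) setT + coval (dgm_diff y) setT).
by rewrite augD coval_diff_top addr0 coval_scale coval_top eqxx augZ aug1 mulr1.
Qed.

End KoszulPoly.

(** * The enveloping algebra *)

Section Enveloping.
Variables (k : fieldType) (n : nat).
Notation A := (trivial_poly_dga k n).
Notation cA := (@dga_comp k A).
Notation Ae := (dga_env A).
Notation cE := (@dga_comp k Ae).
Let gA := dga_grading A.
Implicit Types (i j : 'I_n) (S T : {set 'I_n}) (a b : A) (v w : Ae).

Definition ptens (a b : A) : Ae := @tens k A (cdga_op A) a b.

Lemma ptens_bilin : bilin ptens. Proof. exact: tens_bilin. Qed.
Lemma ptensDl a a' b : ptens (a + a') b = ptens a b + ptens a' b.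
Proof. exact: bilinDl ptens_bilin _ _ _. Qed.
Lemma ptensDr a b b' : ptens a (b + b') = ptens a b + ptens a b'.
Proof. exact: bilinDr ptens_bilin _ _ _. Qed.
Lemma ptens0l b : ptens 0 b = 0. Proof. exact: bilin0l ptens_bilin _. Qed.
Lemma ptens0r a : ptens a 0 = 0. Proof. exact: bilin0r ptens_bilin _. Qed.
Lemma ptensZl (c : k) a b : ptens (c *: a) b = c *: ptens a b.
Proof. exact: bilinZl ptens_bilin _ _ _. Qed.
Lemma ptensZr (c : k) a b : ptens a (c *: b) = c *: ptens a b.
Proof. exact: bilinZr ptens_bilin _ _ _. Qed.
Lemma ptensNl a b : ptens (- a) b = - ptens a b.
Proof. by rewrite -scaleN1r ptensZl scaleN1r. Qed.
Lemma ptensNr a b : ptens a (- b) = - ptens a b.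
Proof. by rewrite -scaleN1r ptensZr scaleN1r. Qed.
Lemma ptensKl d a b : ptens (ksign d a) b = ksign d (ptens a b).
Proof. by rewrite /ksign; case: par; rewrite ?ptensNl. Qed.
Lemma ptensKr d a b : ptens a (ksign d b) = ksign d (ptens a b).
Proof. by rewrite /ksign; case: par; rewrite ?ptensNr. Qed.

Lemma ptens_ind (P : Ae -> Prop) : P 0 -> (forall v w, P v -> P w -> P (v + w)) ->
  (forall a b, P (ptens a b)) -> forall v, P v.
Proof. exact: tens_ind. Qed.

(** Identities with Koszul signs are checked on homogeneous arguments, where the signs are
    explicit. *)
Lemma biadditive_ext (U : zmodType) (F G : A -> A -> U) :
  (forall a a' b, F (a + a') b = F a b + F a' b) ->
  (forall a b b', F a (b + b') = F a b + F a b') ->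
  (forall a a' b, G (a + a') b = G a b + G a' b) ->
  (forall a b b', G a (b + b') = G a b + G a b') ->
  (forall d e a b, of_deg cA d a -> of_deg cA e b -> F a b = G a b) ->
  forall a b, F a b = G a b.
Proof.
move=> FDl FDr GDl GDr h a b.
have F0l c : F 0 c = 0 by apply: (addrI (F 0 c)); rewrite -FDl !addr0.
have F0r c : F c 0 = 0 by apply: (addrI (F c 0)); rewrite -FDr !addr0.
have G0l c : G 0 c = 0 by apply: (addrI (G 0 c)); rewrite -GDl !addr0.
have G0r c : G c 0 = 0 by apply: (addrI (G c 0)); rewrite -GDr !addr0.
elim/(gr_ind gA): a => [|x y hx hy|d a ha]; rewrite ?F0l ?G0l ?FDl ?GDl ?hx ?hy //.
elim/(gr_ind gA): b => [|x y hx hy|e b hb]; rewrite ?F0r ?G0r ?FDr ?GDr ?hx ?hy //.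
exact: h ha hb.
Qed.

Lemma ptensM d e a b a' b' : of_deg cA d b -> of_deg cA e a' ->
  ptens a b * ptens a' b' = ksign (d * e) (ptens (a * a') (@opmul k A b b')).
Proof. move=> hb ha; exact: (@tmulE k A (cdga_op A) _ _ a b a' b' hb ha). Qed.

Lemma ptens_deg d e a b : of_deg cA d a -> of_deg cA e b -> of_deg cE (d + e) (ptens a b).
Proof. move=> ha hb; exact: (@tens_deg k A (cdga_op A) _ _ a b ha hb). Qed.

Lemma env_diff0 v : dga_diff v = 0.
Proof.
elim/ptens_ind: v => [|v w hv hw|a b]; first exact: dga_diff0.
  by rewrite dga_diffD hv hw addr0.
elim/(gr_ind gA): a => [|x y hx hy|d a ha].
- by rewrite ptens0l dga_diff0.
- by rewrite ptensDl dga_diffD hx hy addr0.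
rewrite [LHS](tdiffE _ ha) [X in tens X]pdiff0 [X in tens a X]pdiff0.
by rewrite [tens _ b]ptens0l [tens a _]ptens0r ksign0 addr0.
Qed.

Lemma env_neg d v : (d < 0)%R -> dga_comp d v = 0.
Proof.
move=> d0; have gE := dga_grading Ae; elim/ptens_ind: v => [|v w hv hw|a b].
- exact: gr0.
- by rewrite grD // hv hw addr0.
move: a b; apply: (biadditive_ext (F := fun a b => cE d (ptens a b))
  (G := fun _ _ => 0)).
- by move=> a a' b; rewrite ptensDl grD.
- by move=> a b b'; rewrite ptensDr grD.
- by move=> *; rewrite addr0.
- by move=> *; rewrite addr0.
move=> e f a b ha hb; rewrite (of_degP gE _ (ptens_deg ha hb)).
case: eqP => // def; case: (ltrP e 0) => he.
  by rewrite -ha cdga_neg // ptens0l.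
case: (ltrP f 0) => hf; first by rewrite -hb cdga_neg // ptens0r.
by move: d0; rewrite def ltNge addr_ge0.
Qed.

Definition eX i : Ae := ptens (pvar k i) 1.
Definition eY i : Ae := ptens 1 (pvar k i).

Lemma eX_deg i : of_deg cE 1 (eX i).
Proof. exact: ptens_deg (pvar_deg k i) (dga_one_deg A). Qed.
Lemma eY_deg i : of_deg cE 1 (eY i).
Proof. exact: ptens_deg (dga_one_deg A) (pvar_deg k i). Qed.

Lemma eX_mull i a b : eX i * ptens a b = ptens (pvar k i * a) b.
Proof.
move: a b; apply: (biadditive_ext (F := fun a b => eX i * ptens a b)
  (G := fun a b => ptens (pvar k i * a) b)).
- by move=> a a' b; rewrite ptensDl mulrDr.
- by move=> a b b'; rewrite ptensDr mulrDr.
- by move=> a a' b; rewrite mulrDr ptensDl.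
- by move=> a b b'; rewrite ptensDr.
move=> d e a b ha hb; rewrite (ptensM _ _ (dga_one_deg A) ha) mul0r.
by congr ptens; apply: opmul1l.
Qed.

Lemma eY_mull i a b : eY i * ptens a b = ptens (gsign 1 a) (@opmul k A (pvar k i) b).
Proof.
move: a b; apply: (biadditive_ext (F := fun a b => eY i * ptens a b)
  (G := fun a b => ptens (gsign 1 a) (@opmul k A (pvar k i) b))).
- by move=> a a' b; rewrite ptensDl mulrDr.
- by move=> a b b'; rewrite ptensDr mulrDr.
- by move=> a a' b; rewrite gsignD ptensDl.
- by move=> a b b'; rewrite opmulDr ptensDr.
move=> d e a b ha hb; rewrite (ptensM _ _ (pvar_deg k i) ha) (gsignE _ ha).
by rewrite !mul1r ptensKl.
Qed.

Lemma gsign_ptens a b : gsign 1 (ptens a b) = ptens (gsign 1 a) (gsign 1 b).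
Proof.
move: a b; apply: (biadditive_ext (F := fun a b => gsign 1 (ptens a b))
  (G := fun a b => ptens (gsign 1 a) (gsign 1 b))).
- by move=> a a' b; rewrite ptensDl gsignD.
- by move=> a b b'; rewrite ptensDr gsignD.
- by move=> a a' b; rewrite gsignD ptensDl.
- by move=> a b b'; rewrite gsignD ptensDr.
move=> d e a b ha hb; rewrite (gsignE _ (ptens_deg ha hb)) (gsignE _ ha) (gsignE _ hb).
by rewrite ptensKl ptensKr -ksign_add -mulrDr.
Qed.

Lemma eX_mulr i a b : ptens a b * eX i = ptens (a * pvar k i) (gsign 1 b).
Proof.
move: a b; apply: (biadditive_ext (F := fun a b => ptens a b * eX i)
  (G := fun a b => ptens (a * pvar k i) (gsign 1 b))).
- by move=> a a' b; rewrite ptensDl mulrDl.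
- by move=> a b b'; rewrite ptensDr mulrDl.
- by move=> a a' b; rewrite mulrDl ptensDl.
- by move=> a b b'; rewrite gsignD ptensDr.
move=> d e a b ha hb; rewrite (ptensM _ _ hb (pvar_deg k i)) (gsignE _ hb) ptensKr.
by rewrite mulr1 mul1r; congr (ksign _ (ptens _ _)); apply: opmul1r.
Qed.

Lemma eY_mulr i a b : ptens a b * eY i = ptens a (@opmul k A b (pvar k i)).
Proof.
move: a b; apply: (biadditive_ext (F := fun a b => ptens a b * eY i)
  (G := fun a b => ptens a (@opmul k A b (pvar k i)))).
- by move=> a a' b; rewrite ptensDl mulrDl.
- by move=> a b b'; rewrite ptensDr mulrDl.
- by move=> a a' b; rewrite ptensDl.
- by move=> a b b'; rewrite opmulDl ptensDr.
by move=> d e a b ha hb; rewrite (ptensM _ _ hb (dga_one_deg A)) mulr0 mulr1.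
Qed.

Lemma eXX i j : eX i * eX j = eX j * eX i.
Proof. by rewrite !eX_mull pmulC. Qed.
Lemma eYY i j : eY i * eY j = eY j * eY i.
Proof.
by rewrite !eY_mull !(opmulE (pvar_deg k _) (pvar_deg k _)) [pvar k j * _]pmulC.
Qed.
Lemma eYX i j : eY i * eX j = - (eX j * eY i).
Proof.
rewrite eY_mull eX_mull (gsignE _ (pvar_deg k j)) mulr1 -ptensNl.
by congr ptens; [rewrite mulr1|apply: opmul1r].
Qed.

(* In [A^e] the [x_i (x) 1] anticommute with the [1 (x) x_j]; the sign depending on
   the cardinality [p] of the index set is what makes the differential of the
   bimodule Koszul complex square to zero. *)
Definition ez (p : nat) i : Ae := eX i + sg (odd p) (eY i).

Lemma ez_deg p i : of_deg cE 1 (ez p i).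
Proof.
have gE := dga_grading Ae; apply: (of_degD gE (eX_deg i)).
by rewrite /sg; case: odd; [apply: (of_degN gE)|]; apply: eY_deg.
Qed.

(** With [s = (-1)^p], [X = eX] and [Y = eY], anticommutation turns the product into [X_i X_j - s
    (X_i Y_j + X_j Y_i) - Y_i Y_j], which is symmetric in [i] and [j]. *)
Lemma ez_comm p i j : ez p.+2 i * ez p.+1 j = ez p.+2 j * ez p.+1 i.
Proof.
have h (s : bool) (i' j' : 'I_n) : (eX i' + sg s (eY i')) * (eX j' + sg (~~ s) (eY j')) =
   eX i' * eX j' + sg s (eX j' * sg true (eY i') + sg true (eX i' * eY j')) - eY i' * eY j'.
  case: s; rewrite /= ?opprK !(mulrDl, mulrDr) ?mulNr ?mulrN ?opprK ?eYX ?opprK;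
  rewrite ?opprD ?opprK -!addrA; congr (_ + _); by rewrite addrCA.
by rewrite /ez /= !negbK !h eXX eYY /= !mulrN [- (eX j * _) + _]addrC.
Qed.

End Enveloping.

Lemma sum_setIC (V : nmodType) (I : finType) (S : {set I}) (F : I -> V) :
  \sum_(i in S) F i + \sum_(i | i \notin S) F i = \sum_i F i.
Proof. by rewrite [RHS](bigID (mem S)). Qed.

Section EnvelopingDerivations.
Variables (k : fieldType) (n : nat).
Notation A := (trivial_poly_dga k n).
Notation Ae := (dga_env A).
Implicit Types (i j : 'I_n) (a b : A) (v w : Ae).

Definition elift (phi : A -> A) (v : Ae) : Ae :=
  @tens_lift k A (cdga_op A) _ (fun a b => ptens (phi a) b) v.

Section Lift.
Variable phi : A -> A.
Hypothesis phiD : forall a b, phi (a + b) = phi a + phi b.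
Hypothesis phiZ : forall (c : k) a, phi (c *: a) = c *: phi a.

Let lift_bilin : @bilin k A (cdga_op A) Ae (fun a b => ptens (phi a) b).
Proof.
split=> [b|a] c x y /=; first by rewrite phiD phiZ ptensDl ptensZl.
exact: (ptens_bilin k n).2.
Qed.

Lemma eliftE a b : elift phi (ptens a b) = ptens (phi a) b.
Proof. exact: (tens_lift_tens _ _ lift_bilin). Qed.
Lemma eliftD v w : elift phi (v + w) = elift phi v + elift phi w.
Proof. exact: (lift_add lift_bilin). Qed.
Lemma elift0 : elift phi 0 = 0.
Proof. by apply: (addrI (elift phi 0)); rewrite -eliftD !addr0. Qed.
Lemma eliftN v : elift phi (- v) = - elift phi v.
Proof. by apply: (addrI (elift phi v)); rewrite -eliftD !subrr elift0. Qed.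
Lemma eliftB v w : elift phi (v - w) = elift phi v - elift phi w.
Proof. by rewrite eliftD eliftN. Qed.

End Lift.

(** The order in the first factor only, so that [efil 1] is [1 (x) A]. Asking for some expression by
    pure tensors avoids any choice of a basis of the tensor product. *)
Definition efil (r : nat) (v : Ae) : Prop := exists s : seq (A * A),
  (forall p, p \in s -> pfil r p.1) /\ v = \sum_(p <- s) ptens p.1 p.2.

Lemma efilD r v w : efil r v -> efil r w -> efil r (v + w).
Proof.
move=> [s [hs ->]] [t [ht ->]]; exists (s ++ t); split; last by rewrite big_cat.
by move=> p; rewrite mem_cat => /orP[/hs|/ht].
Qed.
Lemma efil_zero r : efil r 0.
Proof. by exists [::]; split=> //; rewrite big_nil. Qed.
Lemma efil_ptens r a b : pfil r a -> efil r (ptens a b).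
Proof.
by move=> ha; exists [:: (a, b)]; split; [move=> p /[!inE]/eqP->|rewrite big_seq1].
Qed.
Lemma efil_scale r (c : k) v : efil r v -> efil r (c *: v).
Proof.
move=> [s [hs ->]]; exists [seq (c *: p.1, p.2) | p <- s]; split.
  move=> _ /mapP[p /hs hp ->] /=; exact: (fil_scale (@pfilP k n)).
by rewrite big_map scaler_sumr; apply: eq_bigr => p _ /=; rewrite ptensZl.
Qed.
Lemma efilN r v : efil r v -> efil r (- v).
Proof. by rewrite -scaleN1r; apply: efil_scale. Qed.
Lemma efil_sg r s v : efil r v -> efil r (sg s v).
Proof. by case: s => //=; apply: efilN. Qed.
Lemma efil_sum r (I : Type) (s : seq I) (P : pred I) (F : I -> Ae) :
  (forall x, P x -> efil r (F x)) -> efil r (\sum_(x <- s | P x) F x).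
Proof. move=> h; apply: big_ind => //; [exact: efil_zero|exact: efilD]. Qed.

Lemma efil_ind r (P : Ae -> Prop) : P 0 -> (forall v w, P v -> P w -> P (v + w)) ->
  (forall a b, pfil r a -> P (ptens a b)) -> forall v, efil r v -> P v.
Proof.
move=> P0 PD Pt v [s [hs ->]]; rewrite big_seq; apply: big_ind => // p /hs.
exact: Pt.
Qed.

Lemma efilP : is_filtration efil.
Proof.
have mono r s v : (r <= s)%N -> efil r v -> efil s v.
  move=> rs [t [ht ->]]; exists t; split=> // p /ht.
  exact: (fil_mono (@pfilP k n)).
split; [|exact: efil_zero|exact: efil_scale| |].
- apply: efil_ind => // [v w -> ->|a b /(fil0 (@pfilP k n))->].
    by rewrite addr0.
  exact: ptens0l.
- exact: mono.
apply: ptens_ind => [|v w [r hr] [s hs]|a b].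
- by exists 0%N; apply: efil_zero.
- exists (maxn r s); apply: efilD.
    exact: mono (leq_maxl _ _) hr.
  exact: mono (leq_maxr _ _) hs.
have [r hr] := fil_ex (@pfilP k n) a; exists r; exact: efil_ptens.
Qed.

Lemma efil1 v : efil 1 v -> exists b, v = ptens 1 b.
Proof.
move: v; apply: efil_ind => [|v w [b ->] [c ->]|a b /pfil1->].
- by exists 0; rewrite ptens0r.
- by exists (b + c); rewrite ptensDr.
by exists (cdga_aug a *: b); rewrite ptensZl ptensZr.
Qed.

Lemma pfil_gsign r a : pfil r a -> pfil r (gsign 1 a).
Proof.
have h m : exists s, pcoef m (gsign 1 a) = sg s (pcoef m a).
  exists (odd (mdeg m)); have gA := dga_grading A.
  elim/(gr_ind gA): a => [|x y hx hy|d x hx].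
  - by rewrite gsign0 /pcoef mcoeff0 sg0.
  - by rewrite gsignD /pcoef !mcoeffD -!/(pcoef _ _) hx hy sgD.
  rewrite (gsignE _ hx) mul1r; move/pdegP: hx => hx.
  have [dm|dm] := eqVneq d (mdeg m).
    rewrite /ksign dm -[par _]/(odd (mdeg m)); case: odd => //=; exact: mcoeffN.
  rewrite [in RHS]hx // sg0 /ksign; case: par; last exact: hx.
  by rewrite [LHS]mcoeffN [X in - X]hx // oppr0.
by move=> ha m /ha a0; have [s ->] := h m; rewrite a0 sg0.
Qed.

End EnvelopingDerivations.

(** * The bimodule Koszul complex and its dual *)

Section KoszulEnv.
Variables (k : fieldType) (n : nat).
Hypothesis hk : [pchar k] =i pred0.
Notation A := (trivial_poly_dga k n).
Notation Ae := (dga_env A).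
Implicit Types (i j : 'I_n) (S T : {set 'I_n}) (a b : A) (v w : Ae).

Notation B := (koszul_dg (@env_diff0 k n) (@ez_deg k n) (@ez_comm k n)).
Notation val := (@koszul_val k Ae n (@ez k n) (@env_diff0 k n) (@ez_deg k n)
  (@ez_comm k n)).
Notation coval := (@koszul_coval k Ae n (@ez k n) (@env_diff0 k n) (@ez_deg k n)
  (@ez_comm k n)).

Lemma kz_down_env p i a b : kz_down (@ez k n) p i (ptens a b) =
  ptens (gsign 1 a * pvar k i) b +
  sg (~~ odd p) (ptens (gsign 1 a) (@opmul k A (gsign 1 b) (pvar k i))).
Proof.
rewrite /kz_down gsign_ptens /ez mulrDr eX_mulr gsignK /=; congr (_ + _).
by case: odd; rewrite /= ?mulrN eY_mulr.
Qed.

Lemma kz_up_env p i a b : kz_up (@ez k n) p i (ptens a b) =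
  - (ptens (pvar k i * a) b + sg (odd p) (ptens (gsign 1 a) (@opmul k A (pvar k i) b))).
Proof.
rewrite /kz_up /ez mulrDl eX_mull; congr (- (_ + _)).
by case: odd; rewrite /= ?mulNr eY_mull.
Qed.

(* [gsign 1] undoes the sign [(-1)^|c_T|] of the differential of the Koszul complex,
   so that the homotopy built on [D] is the de Rham differential. *)
Let D i a : A := gsign 1 (pder i a).
Let DD i a b : D i (a + b) = D i a + D i b.
Proof. by rewrite /D pderD gsignD. Qed.
Let DZ i (c : k) a : D i (c *: a) = c *: D i a.
Proof. by rewrite /D pderZ gsignZ. Qed.

Let D_var i j a : D j (gsign 1 a * pvar k i) =
  (if j == i then a else 0) + pvar k i * pder j a.
Proof.
rewrite /D [gsign 1 a * _]pmulC pder_var gsignD; congr (_ + _).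
  by case: eqP; rewrite ?gsign0 // gsignK.
rewrite gsignM pder_gsign gsignN gsignK (gsignE _ (pvar_deg k i)).
by rewrite /ksign /= mulrN mulNr opprK.
Qed.
Let D_gsign j a : D j (gsign 1 a) = - pder j a.
Proof. by rewrite /D pder_gsign gsignN gsignK. Qed.
Let gsign_D j a : gsign 1 (D j a) = pder j a.
Proof. exact: gsignK. Qed.

(** The terms with [1 (x) x_i] differentiate the first factor without multiplying it by [x_i] again,
    so they have order less than [r]; on leading symbols the computation is that of
    [poly_koszul_exact]. *)
Lemma env_koszul_exact (x : B) : dgm_diff x = 0 ->
  exists y : B, forall S, efil (1 - #|S|) (val (x - dgm_diff y) S).
Proof.
have dB := kz_downB (@ez k n).
have d0 p i : kz_down (@ez k n) p i 0 = 0 by rewrite /kz_down gsign0 mul0r.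
have dD p i v w : kz_down (@ez k n) p i (v + w) =
    kz_down (@ez k n) p i v + kz_down (@ez k n) p i w.
  by rewrite /kz_down gsignD mulrDl.
apply: (koszul_descent hk (@efilP k n) (g := fun _ i v => elift (D i) v)).
- by move=> p i v w; apply: eliftB.
- move=> p i j v ij; elim/ptens_ind: v => [|v w hv hw|a b].
  + by rewrite d0 !elift0 // d0.
  + by rewrite dD !eliftD // dD hv hw.
  rewrite eliftE // !kz_down_env eliftD // eliftE // gsign_D D_var eq_sym (negbTE ij).
  rewrite add0r pmulC; congr (_ + _) => /=.
  by case: odd; rewrite /= ?eliftN // ?eliftE // D_gsign ptensNl ?opprK.
move=> S r; apply: efil_ind => [|v w hv hw|a b ha].
- rewrite !big1 ?scaler0 ?subr0 ?addr0 => [|i _|i _]; first exact: efil_zero.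
    by rewrite d0 elift0.
  by rewrite elift0 // d0.
- move: (efilD hv hw); congr efil.
  rewrite scalerDr opprD [LHS]addrACA; congr (_ + _).
  rewrite [LHS]addrACA -!big_split; congr (_ + _); apply: eq_bigr => i _ /=.
    by rewrite eliftD // dD.
  by rewrite dD eliftD.
have -> : \sum_(i | i \notin S) kz_down (@ez k n) #|S| i (elift (D i) (ptens a b)) =
    \sum_(i | i \notin S) (ptens (pvar k i * pder i a) b +
      sg (~~ odd #|S|) (ptens (pder i a) (@opmul k A (gsign 1 b) (pvar k i)))).
  by apply: eq_bigr => i _; rewrite eliftE // kz_down_env gsign_D pmulC.
have -> : \sum_(i in S) elift (D i) (kz_down (@ez k n) #|S|.-1 i (ptens a b)) =
   #|S|%:R *: ptens a b + \sum_(i in S) (ptens (pvar k i * pder i a) b +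
      sg (~~ odd #|S|) (ptens (pder i a) (@opmul k A (gsign 1 b) (pvar k i)))).
  rewrite scaler_nat -sumr_const -big_split; apply: eq_bigr => i iS /=.
  rewrite kz_down_env eliftD // eliftE // D_var eqxx ptensDl -addrA.
  congr (_ + (_ + _)).
  have -> : ~~ odd #|S| = odd #|S|.-1 by rewrite (cardsD1 i S) iS /= negbK.
  by case: odd; rewrite /= ?eliftN // eliftE // D_gsign ptensNl ?opprK.
rewrite natrD scalerDl -addr_shuffle sum_setIC big_split /=.
rewrite addrAC; apply: efilD; last first.
  by apply: efil_sum => i _; apply/efil_sg/efil_ptens/pfil_der.
rewrite -ptensZl -(big_morph (fun a => ptens a b) (fun a c => ptensDl a c b) (ptens0l b)).
rewrite -ptensNl -ptensDl; apply: efil_ptens; exact: pfil_euler.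
Qed.

(** The same separation of leading symbols, applied to the dual: the terms in the second factor
    again have lower order. *)
Lemma env_koszul_coexact (phi : dg_dual B) : dgm_diff phi = 0 ->
  exists chi, forall S, efil (1 - (n - #|S|)) (coval (phi - dgm_diff chi) S).
Proof.
have u0 p i : kz_up (@ez k n) p i 0 = 0 by rewrite /kz_up mulr0 oppr0.
have uD p i v w : kz_up (@ez k n) p i (v + w) =
    kz_up (@ez k n) p i v + kz_up (@ez k n) p i w.
  by rewrite /kz_up mulrDr opprD.
have eD i := eliftD (@pderD k n i) (@pderZ k n i).
have e0 i := elift0 (@pderD k n i) (@pderZ k n i).
have eN i := eliftN (@pderD k n i) (@pderZ k n i).
have eE i := eliftE (@pderD k n i) (@pderZ k n i).
have uN p i v : kz_up (@ez k n) p i (- v) = - kz_up (@ez k n) p i v.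
  by rewrite /kz_up mulrN.
apply: (koszul_codescent hk (@efilP k n) (f := fun _ i v => - elift (pder i) v)).
- by move=> p i v w; rewrite eD eN opprD.
- move=> p i j v ij; elim/ptens_ind: v => [|v w hv hw|a b].
  + by rewrite u0 !e0 oppr0 u0.
  + by rewrite uD !eD !opprD uD hv hw.
  rewrite eE uN !kz_up_env eN !opprK eD eE pder_var (negbTE ij) add0r /= negbK.
  by congr (_ + _); case: odd; rewrite /= ?eN eE pder_gsign ptensNl ?opprK.
move=> S r; apply: efil_ind => [|v w hv hw|a b ha].
- rewrite !big1 ?scaler0 ?subr0 ?addr0 => [|i _|i _]; first exact: efil_zero.
    by rewrite e0 oppr0 u0.
  by rewrite u0 e0 oppr0.
- move: (efilD hv hw); congr efil.
  rewrite scalerDr opprD [LHS]addrACA; congr (_ + _).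
  rewrite [LHS]addrACA -!big_split; congr (_ + _); apply: eq_bigr => i _ /=.
    by rewrite uD eD opprD.
  by rewrite eD opprD uD.
have -> : \sum_(i | i \notin S) - elift (pder i) (kz_up (@ez k n) #|S|.+1 i (ptens a b)) =
   (n - #|S|)%:R *: ptens a b + \sum_(i | i \notin S) (ptens (pvar k i * pder i a) b +
      sg (odd #|S|) (ptens (gsign 1 (pder i a)) (@opmul k A (pvar k i) b))).
  have -> : (n - #|S|)%N = #|~: S| by rewrite [RHS]cardsCs setCK card_ord.
  rewrite scaler_nat -sumr_const [in RHS](eq_bigl (fun i => i \notin S)) => [|i]; last first.
    by rewrite inE.
  rewrite -big_split; apply: eq_bigr => i _ /=.
  rewrite kz_up_env eN opprK eD eE pder_var eqxx ptensDl -addrA; congr (_ + (_ + _)).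
  by rewrite /=; case: odd; rewrite /= ?eN eE pder_gsign ptensNl ?opprK.
have -> : \sum_(i in S) kz_up (@ez k n) #|S| i (- elift (pder i) (ptens a b)) =
    \sum_(i in S) (ptens (pvar k i * pder i a) b +
      sg (odd #|S|) (ptens (gsign 1 (pder i a)) (@opmul k A (pvar k i) b))).
  by apply: eq_bigr => i _; rewrite eE uN kz_up_env opprK.
rewrite natrD scalerDl [X in efil _ (X - _)]addrC -addr_shuffle.
rewrite [X in efil _ (X - _)]addrC sum_setIC big_split /=.
rewrite addrAC; apply: efilD; last first.
  by apply: efil_sum => i _; apply/efil_sg/efil_ptens/pfil_gsign/pfil_der.
rewrite -ptensZl -(big_morph (fun a => ptens a b) (fun a c => ptensDl a c b) (ptens0l b)).
rewrite -ptensNl -ptensDl; apply: efil_ptens; exact: pfil_euler.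
Qed.

End KoszulEnv.

(** * Cohomology classes under derived isomorphisms *)

Section Boundaries.
Variables (k : fieldType) (A : dgAlgebra k).
Implicit Types M N : dgModule A.

Definition bdry M (x : M) : Prop := exists y, x = dgm_diff y.

Lemma bdryD M (x y : M) : bdry x -> bdry y -> bdry (x + y).
Proof. by move=> [u ->] [v ->]; exists (u + v); rewrite dgm_diffD. Qed.
Lemma bdryN M (x : M) : bdry x -> bdry (- x).
Proof. by move=> [u ->]; exists (- u); rewrite dgm_diffN. Qed.
Lemma bdryB M (x y : M) : bdry x -> bdry y -> bdry (x - y).
Proof. by move=> hx hy; apply: bdryD => //; apply: bdryN. Qed.
Lemma bdry_subl M (x y : M) : bdry (x - y) -> bdry x -> bdry y.
Proof. by move=> hxy hx; rewrite -[y](subKr x); apply: bdryB. Qed.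
Lemma bdry_subr M (x y : M) : bdry (x - y) -> bdry y -> bdry x.
Proof. by move=> hxy hy; rewrite -[x](subrK y); apply: bdryD. Qed.

Lemma bdry_hom M N (f : M -> N) x : dg_hom f -> bdry x -> bdry (f x).
Proof. by move=> [_ df] [y ->]; exists (f y). Qed.

Lemma bdry_homotopic M N (f g : M -> N) x : homotopic f g -> dgm_diff x = 0 ->
  bdry (f x - g x).
Proof. by move=> [h hh hE] dx; exists (h x); rewrite hE dx (gh0 hh) addr0. Qed.

Lemma bdry_scale M i (a : A) (x : M) : of_deg (@dga_comp k A) i a -> dga_diff a = 0 ->
  bdry x -> bdry (a *: x).
Proof.
move=> ha da [y ->]; exists (ksign i (a *: y)).
by rewrite dgm_diff_ksign (dgm_leibniz _ ha) da scale0r add0r ksignK.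
Qed.

Lemma bdry_quasi_iso M N (f : M -> N) x : quasi_iso f -> dgm_diff x = 0 ->
  bdry (f x) -> bdry x.
Proof. by move=> [_ injf _]; apply: injf. Qed.

(* The image of a nonzero class under the isomorphism on cohomology: it is
   nonzero and has at least the same annihilator. *)
Lemma derived_iso_class M N (x : M) : derived_iso M N ->
    of_deg (@dgm_comp k A M) 0 x -> dgm_diff x = 0 -> ~ bdry x ->
  exists y : N, [/\ of_deg (@dgm_comp k A N) 0 y, dgm_diff y = 0, ~ bdry y &
    forall i (a : A), of_deg (@dga_comp k A) i a -> dga_diff a = 0 ->
      bdry (a *: x) -> bdry (a *: y)].
Proof.
move=> [[R s f] [[R' s' f'] [[hs hf] [hs' hf'] rr _]]] hx dx nx.
cbn [roof_mid roof_s roof_f] in hs, hf, hs', hf'.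
move: rr => [Z [u [v [hu hv huv [Z' [p [p' [hp hp' hsp hpp hfp]]]]]]]].
cbn [roof_mid roof_s roof_f roof_id] in *.
have [w [z [hw dw xE]]] := quasi_iso_lift0 hs hx dx.
have sw : bdry (x - s w) by exists z; rewrite xE addrAC subrr add0r.
exists (f w); split.
- by have := gh_deg hf.1 hw; rewrite addr0.
- by rewrite -hf.2 dw (gh0 hf.1).
- move=> fw; apply: nx.
  (* The composite roof represents the identity, so [x] lifts to a class [y] of its middle term. If
     [f w] is a boundary, the second roof makes [p' y] one, and [p' y] is homologous to [x]. *)
  have [y dy [z' yE]] : exists2 y, dgm_diff y = 0 & exists z, x = (s \o u \o p) y + dgm_diff z.
    by case: hsp => _ _; apply.
  have xy : bdry (x - s (u (p y))) by exists z'; rewrite yE /= addrAC subrr add0r.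
  apply: (bdry_subr xy); have dpy : dgm_diff (p y) = 0 by rewrite -hp.2 dy (gh0 hp.1).
  have hu' := quasi_iso_hom hu.
  have dupy : dgm_diff (u (p y)) = 0 by rewrite -hu'.2 dpy (gh0 hu'.1).
  have wupy : bdry (w - u (p y)).
    apply: (bdry_quasi_iso hs); first by rewrite dgm_diffB dw dupy subrr.
    rewrite (ghB (quasi_iso_hom hs).1) -[s w](subKr x) addrAC; apply: bdryB => //.
  have fupy : bdry (f (u (p y))).
    by apply: bdry_subl fw; rewrite -(ghB hf.1); apply: bdry_hom.
  have s'v : bdry (s' (v (p y))) by apply: (bdry_subl (bdry_homotopic huv dpy)).
  have dvp : dgm_diff (v (p y)) = 0 by rewrite -hv.2 dpy (gh0 hv.1).
  have vp := bdry_quasi_iso hs' dvp s'v.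
  have fvp := bdry_hom hf' vp.
  have p'y : bdry (p' y) := bdry_subl (bdry_homotopic hfp dy) fvp.
  exact: (bdry_subr (bdry_homotopic hpp dy) p'y).
move=> i a ha da hax; have [hh _] := hf.
have -> : a *: f w = f (a *: w) by rewrite (ghZ hh _ ha) mul0r.
apply: bdry_hom => //; apply: (bdry_quasi_iso hs).
  by rewrite (dgm_leibniz _ ha) da dw scaler0 scale0r add0r ksign0.
have -> : s (a *: w) = a *: s w by rewrite (ghZ (quasi_iso_hom hs).1 _ ha) mul0r.
apply: bdry_subl hax; rewrite -scalerBr; exact: bdry_scale ha da sw.
Qed.

Lemma quasi_iso_derived_iso M N (f : M -> N) : quasi_iso f -> derived_iso M N.
Proof.
move=> hf; have hf' := quasi_iso_hom hf.
have hid (L : dgModule A) := quasi_iso_id L; have did (L : dgModule A) := dg_hom_id L.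
have href (L L' : dgModule A) (g : L -> L') := homotopic_refl g.
exists (@Roof _ _ M N M id f), (@Roof _ _ N M M f id); split.
- by split.
- by split; [exact: hf|exact: did].
- exists M, id, id; split; [exact: hid|exact: did|exact: href|].
  by exists M, id, id; split; [exact: did|exact: did|exact: hid|exact: href|exact: href].
exists M, id, id; split; [exact: hid|exact: did|exact: href|].
by exists M, id, f; split; [exact: did|exact: hf'|exact: hf|exact: href|exact: href].
Qed.

End Boundaries.

(** * Pullback of cochains along DG maps *)

Section DualPullback.
Variables (k : fieldType) (A : dgAlgebra k).

Section OneMap.
Variables (M N : dgModule A) (h : M -> N).
Hypothesis hh : dg_hom h.

Lemma dual_pull_fin (phi : dg_dual N) : fin_hom ((phi : dualT N) \o h).
Proof.
have [s [g [hg ->]]] := dualP (phi : dualT N).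
exists s, (fun i => g i \o h); split.
  by move=> i; rewrite -[i]add0r; apply: gh_comp hh.1; rewrite add0r.
by apply/funext => x; rewrite /= !fct_sumE.
Qed.
Definition dual_pull (phi : dg_dual N) : dg_dual M := mk_dual (dual_pull_fin phi).

Lemma dual_pull_ghom p (phi : dg_dual N) :
  graded_hom p (phi : dualT N) -> graded_hom p (dual_pull phi : dualT M).
Proof.
by move=> hp; rewrite -[p]add0r; apply: (@gh_comp _ _ _ _ (dga_reg A)) hp hh.1.
Qed.

Lemma dual_pull_hom : dg_hom dual_pull.
Proof.
split; first split.
- by move=> f g; apply: dual_ext.
- move=> i f /dual_deg hf; rewrite addr0; apply/dual_deg; exact: dual_pull_ghom.
- by move=> i a f _; rewrite mul0r; apply: dual_ext.
move=> f; elim/(@dual_ind k A N): f => [|f g hf hg|p f hf].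
- have p0 : dual_pull 0 = 0 by apply: dual_ext.
  by rewrite dgm_diff0 p0 dgm_diff0.
- have pD (u v : dg_dual N) : dual_pull (u + v) = dual_pull u + dual_pull v.
    exact: dual_ext.
  by rewrite dgm_diffD !pD hf hg dgm_diffD.
apply: dual_ext => x; rewrite [RHS](dual_diffE _ (dual_pull_ghom hf)).
by rewrite [LHS](dual_diffE _ hf) /= hh.2.
Qed.

End OneMap.

(** The bounding cochain is [phi \o t]: a cocycle [phi] of degree 0 commutes with the differentials,
    so it carries the homotopy identity for [t] to a coboundary. *)
Lemma dual_pull_homotopic (M : dgModule A) (u : M -> M) (hu : dg_hom u) (phi : dg_dual M) :
  homotopic u id -> graded_hom 0 (phi : dualT M) -> dgm_diff phi = 0 ->
  bdry (dual_pull hu phi - phi).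
Proof.
move=> [t ht tE] hphi dphi.
have hc : graded_hom (-1) ((phi : dualT M) \o t).
  by rewrite -[-1]addr0; apply: gh_comp hphi ht.
exists (mk_dual (fin_hom_ghom hc) : dg_dual M); apply: dual_ext => x.
have d0 y : dgm_diff ((phi : dualT M) y) = (phi : dualT M) (dgm_diff y).
  have := congr1 (fun f : dg_dual M => (f : dualT M) y) dphi.
  by rewrite [X in X = _ -> _](dual_diffE _ hphi) => /eqP; rewrite subr_eq0 => /eqP.
transitivity (dgm_diff ((phi : dualT M) (t x)) + (phi : dualT M) (t (dgm_diff x))).
  by rewrite d0 -(ghD hphi) -tE (ghB hphi).
rewrite [RHS](@dual_diffE k A M (-1) (mk_dual (fin_hom_ghom hc)) x hc).
by rewrite /ksign /= opprK.
Qed.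

End DualPullback.

(** * The Calabi-Yau property *)

(** By commutativity the hypothesis is [2 a x_i = 0], while 2 is invertible and multiplication by
    [x_i] merely shifts coefficients. *)
Lemma pvar_anticomm_eq0 (k : fieldType) (n : nat) (hk : [pchar k] =i pred0) (i : 'I_n)
    (a : trivial_poly_dga k n) :
  a * pvar k i + pvar k i * a = 0 -> a = 0.
Proof.
rewrite [pvar k i * a]pmulC => h; apply: pcoefP => m.
have := congr1 (pcoef (U_(i) + m)%MM) h; rewrite /pcoef mcoeffD [LHS]/= !mcoeffMX !mcoeff0.
rewrite -mulr2n -mulr_natr => /eqP; rewrite mulf_eq0 (negbTE (natk_neq0 hk 1)) orbF.
by move/eqP.
Qed.

Section CalabiYau.
Variables (k : fieldType) (n : nat).
Hypothesis hk : [pchar k] =i pred0.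
Notation A := (trivial_poly_dga k n).
Notation cA := (@dga_comp k A).
Notation Ae := (dga_env A).
Notation cE := (@dga_comp k Ae).
Implicit Types (i j : 'I_n) (S T : {set 'I_n}) (a b : A).

Notation B := (koszul_dg (@env_diff0 k n) (@ez_deg k n) (@ez_comm k n)).
Notation val := (@koszul_val k Ae n (@ez k n) (@env_diff0 k n) (@ez_deg k n)
  (@ez_comm k n)).
Notation coval := (@koszul_coval k Ae n (@ez k n) (@env_diff0 k n) (@ez_deg k n)
  (@ez_comm k n)).
Notation NR := (susp (- 0) (dg_diagR A)).

Lemma env_semibasis : is_semibasis
  (koszul_basis (@env_diff0 k n) (@ez_deg k n) (@ez_comm k n))
  (fun=> 0) (fun T : {set 'I_n} => #|T|).
Proof. exact: koszul_semibasis. Qed.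

Let act (v : Ae) (a : A) : A := diagL_scale v a.

Let act_ptens a b c : act (ptens a b) c = a * @opmul k A b c.
Proof. exact: diagL_scaleE. Qed.

Let act_ez1 i : act (ez k 1 i) 1 = 0.
Proof.
have actD v w a : act (v + w) a = act v a + act w a by exact: diagL_scaleDl.
have actN v a : act (- v) a = - act v a.
  by apply: (addrI (act v a)); rewrite -actD !subrr; apply: diagL_scale0l.
rewrite /ez /= actD actN !act_ptens mul1r [X in _ * X]opmul1l [X in _ - X]opmul1r.
by rewrite mulr1 subrr.
Qed.

Definition env_aug (x : B) : dg_diagL A := diagL_scale (val x set0) 1.

Lemma env_aug_hom : dg_hom env_aug.
Proof.
split; first split.
- by move=> x y; rewrite /env_aug /koszul_val ffunE; apply: diagL_scaleDl.
- move=> d x /free_deg/(_ set0) hx.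
  exact: (diagL_act_deg hx (dga_one_deg A)).
- move=> d v x _; rewrite mul0r /env_aug /koszul_val ffunE; symmetry.
  exact: diagL_scaleA.
move=> x; rewrite /env_aug koszul_diffE.
have -> : kdown (kz_down (@ez k n)) (val x) set0 =
    \sum_i sg (psgn i set0) (gsign 1 (val x (i |: set0)) * ez k 1 i).
  by apply: eq_big => [i|i _]; rewrite ?inE // cards0.
apply: (big_ind (fun v => diagL_scale v 1 = 0)) => [|v w hv hw|i _].
- exact: diagL_scale0l.
- by rewrite diagL_scaleDl hv hw addr0.
have h (v : Ae) : diagL_scale (v * ez k 1 i) 1 = 0.
  by rewrite -diagL_scaleA [diagL_scale (ez k 1 i) 1]act_ez1 diagL_scale0r.
by case: psgn; rewrite /= -?mulNr h.
Qed.

Lemma env_aug_qi : quasi_iso env_aug.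
Proof.
have [h dh] := env_aug_hom.
split; first exact: env_aug_hom.
  move=> x dx [y xy]; have [w hw] := env_koszul_exact hk dx; exists w.
  apply/eqP; rewrite -subr_eq0; apply/eqP/ffunP => S; rewrite [RHS]ffunE.
  rewrite -[LHS]/(val (x - dgm_diff w) S); have := hw S.
  have [->|/set0Pn[i iS]] := eqVneq S set0; last first.
    by rewrite (cardsD1 i S) iS => /(fil0 (@efilP k n)).
  rewrite cards0 => /efil1[b bE]; rewrite bE.
  have : env_aug (x - dgm_diff w) = 0.
    by rewrite (ghB h) dh xy; apply: subrr.
  rewrite /env_aug bE [LHS]act_ptens mul1r [opmul _ _]opmul1r => ->.
  exact: ptens0r.
move=> a _; pose x : B := [ffun S => if S == set0 then ptens a 1 else 0] : {ffun _ -> Ae^o}.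
exists x; last first.
  exists 0; rewrite dgm_diff0 addr0 /env_aug /koszul_val ffunE eqxx [RHS]act_ptens.
  by rewrite [opmul _ _]opmul1l mulr1.
apply/ffunP => S; rewrite [RHS]ffunE -[LHS]/(val (dgm_diff x) S) koszul_diffE.
rewrite /kdown big1 // => i _; rewrite /koszul_val ffunE.
have /negbTE-> : i |: S != set0 by apply/set0Pn; exists i; rewrite setU11.
by rewrite /kz_down gsign0 mul0r sg0.
Qed.

Let top_val (v : Ae) : dg_dual B := free_dual (@env_diff0 k n) (kmat_deg (@ez_deg k n))
  (kmat_sq (@ez_comm k n)) (fun S => if S == setT then v else 0).

Let coval_top v S : coval (top_val v) S = if S == setT then v else 0.
Proof. by rewrite [LHS]free_dualE. Qed.

Let top_cycle v : dgm_diff (top_val v) = 0.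
Proof.
apply: dual_eqP => S; rewrite -[LHS]/(coval (dgm_diff (top_val v)) S) koszul_codiffE.
rewrite [RHS]dual0E /kup big1 // => i iS; rewrite coval_top.
have /negbTE-> : S :\ i != setT.
  by apply: contraTneq (in_setT i) => <-; rewrite setD11.
by rewrite /kz_up mulr0 oppr0 sg0.
Qed.

(** The map sending the dual of the top basis element to 1, extended by right linearity. *)
Definition env_coaug (phi : dg_dual B) : NR := diag_ract (coval phi setT) 1.

Let ract_ptens a b c : diag_ract (ptens a b) c = @opmul k A (c * a) b.
Proof. exact: diag_ractE. Qed.

(** For odd [n] the element is [x_i (x) 1 - 1 (x) x_i], which kills 1 on the right. Top coordinates
    of coboundaries are right multiples of such elements, so [env_coaug] is a map of complexes. *)
Let ract_ez i : odd n -> diag_ract (ez k n i) 1 = 0.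
Proof.
move=> on; rewrite /ez on /= diag_ractDl.
have -> : diag_ract (- eY k i) 1 = - diag_ract (eY k i) 1.
  by apply: (addrI (diag_ract (eY k i) 1)); rewrite -diag_ractDl !subrr diag_ract0l.
rewrite !ract_ptens !mul1r [X in X - _]opmul1r [X in _ - X]opmul1l.
exact: subrr.
Qed.

(** The product of the opposite algebra and the left action [diagR_scale] carry the same sign, so
    right linearity becomes linearity over the opposite algebra. *)
Let ract_opmul (t v : Ae) :
  diag_ract (@opmul k Ae t v) 1 = diagR_scale t (diag_ract v 1).
Proof.
have gE := dga_grading Ae.
elim/(gr_ind gE): t => [|x y hx hy|d t ht].
- by rewrite opmul0l diag_ract0l diagR_scale0l.
- by rewrite opmulDl diag_ractDl diagR_scaleDl hx hy.
elim/(gr_ind gE): v => [|x y hx hy|e v hv].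
- by rewrite opmul0r diag_ract0l diagR_scale0r.
- by rewrite opmulDr !diag_ractDl diagR_scaleDr hx hy.
rewrite (opmulE ht hv) diag_ractKl diag_ractM.
have := diag_ract_deg hv (dga_one_deg A); rewrite addr0 => hd.
by rewrite (diagR_scaleE ht hd).
Qed.

Lemma env_coaug_hom : odd n -> dg_hom env_coaug.
Proof.
move=> on; split; first split.
- move=> x y; rewrite /env_coaug.
  exact: (diag_ractDl 1 (coval x setT) (coval y setT)).
- move=> d phi /dual_deg hphi; rewrite addr0.
  have := gh_deg hphi (free_basis_deg (@env_diff0 k n) (kmat_deg (@ez_deg k n))
    (kmat_sq (@ez_comm k n)) setT).
  rewrite add0r => hd; rewrite /of_deg /= /susp_comp oppr0 addr0.
  have := diag_ract_deg hd (dga_one_deg A); rewrite addr0; exact.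
- move=> d t phi ht; rewrite mul0r -[RHS]/(t *: env_coaug phi).
  rewrite [RHS](susp_scaleE _ _ ht) oppr0 mul0r.
  exact: ract_opmul.
move=> phi; rewrite /env_coaug koszul_codiffE.
have -> : dgm_diff (diag_ract (coval phi setT) 1 : NR) = 0.
  by rewrite /= /susp_diff /= /poly_diff; apply: ksign0.
rewrite /kup; apply: (big_ind (fun v => diag_ract v 1 = 0)) => [|v w hv hw|i _].
- exact: diag_ract0l.
- by rewrite diag_ractDl hv hw addr0.
rewrite cardsT card_ord /kz_up.
have h (v : Ae) : diag_ract (ez k n i * v) 1 = 0.
  by rewrite diag_ractM ract_ez // diag_ract0r.
by case: psgn; rewrite /= ?opprK -?mulrN h.
Qed.

Lemma env_coaug_qi : odd n -> quasi_iso env_coaug.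
Proof.
move=> on; have [h dh] := env_coaug_hom on.
split; first exact: env_coaug_hom.
  move=> phi dphi [y xy]; have [chi hchi] := env_koszul_coexact hk dphi; exists chi.
  apply/eqP; rewrite -subr_eq0; apply/eqP/dual_eqP => S; rewrite [RHS]dual0E.
  rewrite -[LHS]/(coval (phi - dgm_diff chi) S); have := hchi S.
  have [->|ST] := eqVneq S setT; last first.
    have cS : (#|S| < n)%N.
      by rewrite -[X in (_ < X)%N]card_ord -cardsT proper_card // properT.
    have -> : (1 - (n - #|S|) = 0)%N by apply/eqP; rewrite subn_eq0 subn_gt0.
    by move/(fil0 (@efilP k n)).
  rewrite cardsT card_ord subnn => /efil1[b bE]; rewrite bE.
  have : env_coaug (phi - dgm_diff chi) = 0.
    rewrite (ghB h) dh xy; exact: subrr.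
  rewrite /env_coaug bE [LHS]ract_ptens mul1r [opmul _ _]opmul1l => ->.
  exact: ptens0r.
move=> a _; exists (top_val (ptens 1 a)); first exact: top_cycle.
exists 0; rewrite dgm_diff0 addr0 /env_coaug coval_top eqxx [RHS]ract_ptens mul1r.
by rewrite [RHS]opmul1l.
Qed.

Lemma poly_calabi_yau : odd n -> calabi_yau A 0.
Proof.
move=> on; split; first exact: poly_smooth.
exists B, env_aug; split.
  split; last exact: env_aug_qi.
  by exists {set 'I_n}, (koszul_basis _ _ _), (fun=> 0), (fun T : {set 'I_n} => #|T|);
    exact: env_semibasis.
exact: quasi_iso_derived_iso (env_coaug_qi on).
Qed.

Let phi0 : dg_dual B := top_val 1.

Let phi0_deg : graded_hom 0 (phi0 : dualT B).
Proof.
apply: free_dual_ghom => S; case: eqP => _; first exact: (dga_one_deg Ae).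
exact: of_deg0 (dga_grading Ae) _.
Qed.

(** Coordinates of a coboundary are sums of multiples of elements of degree 1 in an algebra without
    negative degrees, so their degree 0 part vanishes. *)
Let phi0_nonbdry : ~ bdry phi0.
Proof.
move=> [chi /(congr1 (fun phi => cE 0 (coval phi setT)))].
have gE := dga_grading Ae.
rewrite koszul_codiffE coval_top eqxx (dga_one_deg Ae) => /eqP.
rewrite [X in _ == X](_ : _ = 0) ?oner_eq0 //.
apply: (big_ind (fun v => cE 0 v = 0)) => [|v w hv hw|i _].
- exact: gr0.
- by rewrite grD // hv hw addr0.
have h (v : Ae) p : cE 0 (ez k p i * v) = 0.
  by rewrite (dga_comp_mull _ _ (ez_deg k p i)) env_neg ?mulr0.
by rewrite /kz_up /sg; case: psgn; rewrite -?mulrN ?opprK ?h // -mulrN h.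
Qed.

(** The cochain dual to the basis element at the full set minus [i] has a coboundary concentrated at
    the full set. *)
Let phi0_ann i : ~~ odd n -> bdry ((ez k n i : dga_op Ae) *: phi0).
Proof.
(* The sign of [c] compensates both the exterior sign and the minus sign in [kz_up]. *)
move=> en; pose c : Ae := - sg (psgn i setT) 1.
pose chi : dg_dual B := free_dual (@env_diff0 k n) (kmat_deg (@ez_deg k n))
  (kmat_sq (@ez_comm k n)) (fun S => if S == setT :\ i then c else 0).
exists chi; apply: dual_eqP => S.
have chiE T : coval chi T = if T == setT :\ i then c else 0 by rewrite [LHS]free_dualE.
rewrite -[RHS]/(coval (dgm_diff chi) S) koszul_codiffE.
rewrite -[LHS]/(@opmul k Ae (ez k n i) (coval phi0 S)) coval_top /kup.
have [->|ST] := eqVneq S setT.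
  rewrite (bigD1 i) ?in_setT // chiE eqxx big1 ?addr0 => [|j /andP[_ ji]].
    rewrite [RHS]addr0 cardsT card_ord /kz_up /c [LHS]opmul1r.
    by rewrite mulrN opprK; case: psgn; rewrite /= ?mulrN ?opprK mulr1.
  rewrite chiE ifN; first by rewrite /kz_up mulr0 oppr0 sg0.
  by apply: contra ji => /eqP/setP/(_ j); rewrite !inE eqxx; case: (j == i).
rewrite [LHS]opmul0r big1 // => j jS; rewrite chiE ifN.
  by rewrite /kz_up mulr0 oppr0 sg0.
apply: contraNneq ST => /setP E; apply/eqP/setP => l; rewrite [RHS]inE.
have [->//|lj] := eqVneq l j.
have := E l; rewrite !inE lj andbT /= => ->.
have jE : j = i by have := E j; rewrite !inE eqxx; case: eqP.
by rewrite -jE.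
Qed.

Lemma poly_not_calabi_yau : (0 < n)%N -> ~~ odd n -> ~ calabi_yau A 0.
Proof.
move=> n0 en [_ [F [q [[[E [e [deg [lev eP]]]] hq] hiso]]]].
have hqB := env_aug_qi.
(* Since [h \o g] is homotopic to the identity, pulling [phi0] back along [h] and then [g] returns
   its class; hence the pullback to the arbitrary resolution [F] is not a boundary. *)
have [h hh hE] := semi_free_lift_map eP hqB (quasi_iso_hom hq).
have [g hg gE] := semi_free_lift_map env_semibasis hq (quasi_iso_hom hqB).
have hgh : homotopic (h \o g) id.
  apply: (semi_free_lift_homotopy env_semibasis hqB); first exact: dg_hom_comp.
    exact: dg_hom_id.
  apply: homotopic_trans gE; exact: (homotopic_compr hg hE).
have [pD dpull] := dual_pull_hom hh.
have nphi : ~ bdry (dual_pull hh phi0).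
  move=> b; apply: phi0_nonbdry.
  have hhg := dg_hom_comp hh hg.
  apply: (bdry_subl (dual_pull_homotopic hhg hgh phi0_deg (top_cycle 1))).
  have -> : dual_pull hhg phi0 = dual_pull hg (dual_pull hh phi0) by apply: dual_ext.
  exact: bdry_hom (dual_pull_hom hg) b.
have [||m [hm _ nm mann]] := derived_iso_class hiso _ _ nphi.
- by apply/dual_deg; apply: dual_pull_ghom.
- by rewrite -dpull top_cycle (gh0 pD).
(* The differential of [A] is 0, so [m] fails to be a boundary exactly when it is nonzero; it
   remains to derive [m = 0]. *)
pose i := Ordinal n0; apply: nm; exists 0; rewrite dgm_diff0.
have [y yE] : bdry ((ez k n i : dga_op Ae) *: m).
  apply: mann; [exact: ez_deg|exact: env_diff0|].
  have -> : (ez k n i : dga_op Ae) *: dual_pull hh phi0 =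
      dual_pull hh ((ez k n i : dga_op Ae) *: phi0) by apply: dual_ext.
  exact: bdry_hom (dual_pull_hom hh) (phi0_ann i en).
have {}hm : of_deg cA 0 m := hm.
have he : of_deg (@dga_comp k (dga_op Ae)) 1 (ez k n i) := ez_deg k n i.
have mE : diagR_scale (ez k n i) (m : A) = 0.
  transitivity ((ez k n i : dga_op Ae) *: m).
    by rewrite [RHS](susp_scaleE _ _ he).
  by rewrite yE /= /susp_diff /= /poly_diff; apply: ksign0.
(* For even [n] both terms of [ez] have sign plus, and [m] has degree 0, so the relation reads
   [m x_i + x_i m = 0]. *)
move: mE; rewrite (diagR_scaleE (ez_deg k n i) hm) mulr0 /ez (negbTE en) /=.
rewrite diag_ractDl !ract_ptens mulr1.
rewrite [X in ksign _ (X + _)]opmul1r [X in ksign _ (_ + X)](opmulE hm (pvar_deg k i)).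
exact: pvar_anticomm_eq0.
Qed.

End CalabiYau.

Theorem corollary6p5 (k : closedFieldType) (hk : [pchar k] =i pred0)
    (n : nat) (hn : (1 <= n)%N) :
  [/\ koszul (trivial_poly_dga k n),
      homologically_smooth (trivial_poly_dga k n) &
      gorenstein (trivial_poly_dga k n)] /\
  (calabi_yau (trivial_poly_dga k n) 0 <-> odd n).
Proof.
split; first by split; [exact: poly_koszul|exact: poly_smooth|exact: poly_gorenstein].
split=> [cy|]; last exact: poly_calabi_yau.
by apply/negPn/negP => en; apply: (poly_not_calabi_yau hk hn en).
Qed.
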